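(* Let $2<q<\infty$ and let $w:\mathbb{Z}\to(0,\infty)$ be a weight. For $1<p<\infty$, the operator $\mathcal{V}_q\mathcal{A}$ is bounded on $\ell^p(\mathbb{Z},w)$ (i.e. there is $C$ with $\sum_n(\mathcal{V}_q\mathcal{A}(f)(n))^pw(n)\le C\sum_n|f(n)|^pw(n)$ for all $f\in\ell^p(\mathbb{Z},w)$) if and only if $w\in A_p$. Moreover, $\mathcal{V}_q\mathcal{A}$ is bounded from $\ell^1(\mathbb{Z},w)$ into $\ell^{1,\infty}(\mathbb{Z},w)$ (i.e. there is $C$ with $w(\{n:\mathcal{V}_q\mathcal{A}(f)(n)>\lambda\})\le\frac{C}{\lambda}\sum_n|f(n)|w(n)$ for all $f\in\ell^1(\mathbb{Z},w)$, $\lambda>0$) if and only if $w\in A_1$.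
   Context: For a complex-valued function $f$ on $\mathbb{Z}$ and $N\ge0$, $A_N(f)(n)=\frac1{2N+1}\sum_{i=-N}^Nf(n+i)$ and $\mathcal{A}(f)(n)=\{A_N(f)(n)\}_{N\ge0}$. For a sequence $a=\{a_N\}_{N\ge0}$ of complex numbers, $\|a\|_{v_q}=\sup\big(\sum_{j=0}^\infty|a_{N_j}-a_{N_{j+1}}|^q\big)^{1/q}$, the supremum over all increasing sequences $\{N_j\}$ of nonnegative integers. $\mathcal{V}_q\mathcal{A}(f)(n)=\|\mathcal{A}(f)(n)\|_{v_q}$. For a weight (positive function) $w$ on $\mathbb{Z}$, $w(E)=\sum_{n\in E}w(n)$ and $\ell^p(\mathbb{Z},w)$ is the space of $f$ with $\sum_n|f(n)|^pw(n)<\infty$. $w\in A_p$ ($1<p<\infty$) if there is a constant $C$ with $\sum_{i\in I}w(i)\big(\sum_{i\in I}w(i)^{-\frac1{p-1}}\big)^{p-1}\le C|I|^p$ for every finite interval $I\subset\mathbb{Z}$ ($|I|$ is the cardinality). $w\in A_1$ if there is a constant $C$ with $M(w)\le Cw$, where $M(f)(n)=\sup_I\frac1{|I|}\sum_{i\in I}|f(i)|$, the supremum over all finite intervals $I\subset\mathbb{Z}$ containing $n$. *)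

(* Defs.v *)
From HB Require Import structures.
From mathcomp Require Import all_boot all_order all_algebra finmap.
From mathcomp Require Import all_classical all_reals all_analysis.
From mathcomp Require Import complex.

Set Implicit Arguments.
Unset Strict Implicit.
Unset Printing Implicit Defensive.

Import Order.TTheory GRing.Theory Num.Theory.

Local Open Scope classical_set_scope.
Local Open Scope ring_scope.
Local Open Scope complex_scope.

(* The canonical norm on [R[i]] takes its values in [R[i]]; this one is the
   [R]-valued modulus. *)
Definition cabs (R : realType) (z : R[i]) : R := ComplexField.Normc.normc z.

(* The summation index [i < 2N+1] is shifted by [N], so that [i - N] ranges
   over [-N, ..., N]. *)
Definition avg (R : realType) (N : nat) (f : int -> R[i]) (n : int) : R[i] :=
  (N.*2.+1)%:R^-1 * \sum_(i < N.*2.+1) f (n + (i%:Z - N%:Z)).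

Definition avgs (R : realType) (f : int -> R[i]) (n : int) : nat -> R[i] :=
  fun N => avg N f n.

(* [increasing_seq] means strictly increasing; the value may be [+oo]. *)
Definition vnorm (R : realType) (q : R) (a : nat -> R[i]) : \bar R :=
  ereal_sup [set ((\sum_(0 <= j <oo)
                    (cabs (a (N j) - a (N j.+1)) `^ q)%:E) `^ q^-1)%E
            | N in [set N : nat -> nat | increasing_seq N]].

Definition VqA (R : realType) (q : R) (f : int -> R[i]) (n : int) : \bar R :=
  vnorm q (avgs f n).

Definition weight (R : realType) (w : int -> R) : Prop := forall n, 0 < w n.

Definition wmeas (R : realType) (w : int -> R) (E : set int) : \bar R :=
  (\esum_(n in E) (w n)%:E)%E.

Definition wsum (R : realType) (w : int -> R) (p : R) (f : int -> R[i]) :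
  \bar R := (\esum_(n in [set: int]) (cabs (f n) `^ p * w n)%:E)%E.

Definition ellp (R : realType) (w : int -> R) (p : R) : set (int -> R[i]) :=
  [set f | (wsum w p f < +oo)%E].

Definition bounded_ellp (R : realType) (w : int -> R) (p : R)
    (T : (int -> R[i]) -> int -> \bar R) : Prop :=
  exists C : R, forall f, f \in ellp w p ->
    (\esum_(n in [set: int]) ((T f n) `^ p * (w n)%:E) <= C%:E * wsum w p f)%E.

Definition bounded_weak_ell1 (R : realType) (w : int -> R)
    (T : (int -> R[i]) -> int -> \bar R) : Prop :=
  exists C : R, forall f, f \in ellp w 1 -> forall lambda : R, 0 < lambda ->
    (wmeas w [set n | lambda%:E < T f n] <=
       (C / lambda)%:E * \esum_(n in [set: int]) (cabs (f n) * w n)%:E)%E.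

(* The empty interval is allowed here; it only contributes [0 <= C * 0]. *)
Definition Ap (R : realType) (p : R) (w : int -> R) : Prop :=
  exists C : R, forall I : {fset int}, is_interval [set` I] ->
    (\sum_(i <- I) w i) * (\sum_(i <- I) w i `^ (- (1 / (p - 1)))) `^ (p - 1)
      <= C * (#|` I|%fset)%:R `^ p.

(* Uncentred discrete maximal function; the value may be [+oo]. *)
Definition maxfun (R : realType) (f : int -> R) (n : int) : \bar R :=
  ereal_sup [set (((#|` I|%fset)%:R)^-1 * \sum_(i <- I) `|f i|)%:E
            | I in [set I : {fset int} | is_interval [set` I] /\ n \in I]].

Definition A1 (R : realType) (w : int -> R) : Prop :=
  exists C : R, forall n, (maxfun w n <= (C * w n)%:E)%E.

(* Main.v *)
Require Import Defs.
From mathcomp Require Import all_boot all_order all_algebra finmap.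
From mathcomp Require Import all_classical all_reals all_analysis.
From mathcomp Require Import complex.
From mathcomp Require Import zify ring lra.

Set Implicit Arguments.
Unset Strict Implicit.
Unset Printing Implicit Defensive.

Import Order.TTheory GRing.Theory Num.Theory.

Local Open Scope ring_scope.

(* Sufficiency.  The supremum defining [V_q] is linearised along finite monotone
   sequences and [f] is split into four nonnegative parts.  Call a point of a
   dyadic cell [Q] good at scale [k] if the averages of [f] and [g] over the five
   neighbouring cells stay below [lam] and [mu] from scale [k] up to the scale of
   [Q].  On good scales the averages of [f] are a dyadic martingale plus a
   remainder.  The [q]-variation of the martingale, tested against [g], is bounded
   by counting [eps]-jumps for all [eps = 2^-m lam], the count being dominated by
   an energy potential; this is where [q > 2] is used.  The remainder is
   controlled by a square function, since a mean-zero difference of scale [j]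
   contributes to averages of scale [k >= j] only a geometrically small amount.
   The points of [Q] that are not good at scale 0 fill at most half of [Q] once
   [lam] and [mu] are large multiples of the averages on [Q], and recursion below
   the stopping scale bounds [sum g * V_q f] by [sum Phi] for every [Phi] such that
   the product of the averages is dominated by [sum_E Phi] for every [E] filling
   half of [Q].  For [w] in [A_p], [Phi] is built from the dyadic maximal functions
   of [f / sigma] and [g / w] with respect to [sigma = w^(-1/(p-1))] and [w], on two
   shifted grids, and the choice [g = (V_q f)^(p-1) w] closes the argument.  For [A_1], a
   Calderon--Zygmund decomposition reduces the good part to the case [p = 2], and
   the square function handles the bad part off the exceptional set.

   Necessity.  For [f >= 0] supported on an interval [I], averages of radii [|I|]
   and [3|I| + 1] at a point of [I] have the same numerator and denominators in
   ratio 3, so [V_q A f] is at least a multiple of the average of [f] on [I]; test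
   with [f = sigma 1_I] for [A_p] and with a point mass for [A_1]. *)

(** * Dyadic cells and averages *)

(** Duality shapes the argument: the variation is always paired with a weight [g], and a scale
    counts as good only when the averages of [g] are controlled too, because on a good cell the mass
    of [g] may then be replaced by [mu] times the number of points. Since [f] is only summable, its
    part inside a stopping cell has no useful bound in mean square; [energy] therefore squares the
    cell average of the modulus instead of averaging the square. The norm exponent never enters the
    recursion: it sits entirely in the choice of [Phi], so one unweighted argument serves every [p]
    and every weight. Up to the linearisation everything concerns finite sums, with constants
    independent of the cut-off [T] and of the length [L] of the sequences; hence the quantity
    absorbed in the strong bound is finite, and the operator itself is recovered by exhausting its
    suprema. Five neighbouring cells recur because a window of radius below [2^(k+1)] reaches at
    most two cells of scale [k] to either side. *)

Section IntervalSums.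
Context {R : realType}.
Implicit Types (F G : int -> R) (a c n : int) (k l : nat).

Definition isum a (len : nat) F : R := \sum_(i < len) F (a + i%:Z).

Definition pw k : int := (2 ^ k)%N%:Z.

Definition dsum k c F : R := isum (c * pw k) (2 ^ k) F.

Definition cell k n : int := (n %/ pw k)%Z.

Definition cavg k F n : R := dsum k (cell k n) F / (2 ^ k)%:R.

Lemma pw_gt0 k : 0 < pw k.
Proof. by rewrite /pw ltz_nat expn_gt0. Qed.

Lemma pwS k : pw k.+1 = 2 * pw k.
Proof. by rewrite /pw expnS PoszM. Qed.

Lemma pwD k l : pw (k + l) = pw k * pw l.
Proof. by rewrite /pw expnD PoszM. Qed.

Lemma ler_pw k l : (k <= l)%N -> pw k <= pw l.
Proof. by move=> kl; rewrite /pw lez_nat leq_exp2l. Qed.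

Lemma p2_gt0 k : 0 < (2 ^ k)%:R :> R.
Proof. by rewrite ltr0n expn_gt0. Qed.

Lemma p2S k : (2 ^ k.+1)%:R = 2 * (2 ^ k)%:R :> R.
Proof. by rewrite expnS natrM. Qed.

Lemma cellP k n c : (cell k n == c) = (c * pw k <= n < (c + 1) * pw k).
Proof.
have p0 := pw_gt0 k.
rewrite /cell; apply/eqP/andP => [<-|[h1 h2]].
  by rewrite lez_floor ?gt_eqF// ltz_ceil.
apply/eqP; rewrite eq_le; apply/andP; split.
  by rewrite -ltzD1 ltz_divLR.
by rewrite lez_divRL.
Qed.

Lemma cell_bounds k n : cell k n * pw k <= n < (cell k n + 1) * pw k.
Proof. by rewrite -cellP. Qed.

Lemma cell_dyadic k c (i : nat) : (i < 2 ^ k)%N -> cell k (c * pw k + i%:Z) = c.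
Proof. by move=> ik; apply/eqP; rewrite cellP /pw; lia. Qed.

Lemma cell_cell k l n : cell (k + l) n = cell l (cell k n).
Proof.
rewrite /cell pwD; apply/eqP.
rewrite -/(cell k n) -/(cell l _) -pwD -/(cell _ n) cellP.
have /andP[h1 h2] := cell_bounds k n.
have /andP[h3 h4] := cell_bounds l (cell k n).
have := pw_gt0 k; have := pw_gt0 l; rewrite pwD.
move: (pw k) (pw l) (cell k n) (cell l _) h1 h2 h3 h4 => x y u v *.
by apply/andP; split; nia.
Qed.

Lemma cellS k n : cell k.+1 n = (cell k n %/ 2)%Z.
Proof. by rewrite -addn1 cell_cell /cell /pw. Qed.

Lemma cell_shift k n c : cell k (n + c * pw k) = cell k n + c.
Proof.
apply/eqP; rewrite cellP; have := cell_bounds k n; have := pw_gt0 k.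
by move: (cell _ _) (pw k) => x y; nia.
Qed.

Lemma cell_eq k l n m : (k <= l)%N -> cell k n = cell k m -> cell l n = cell l m.
Proof. by move=> /subnKC <- e; rewrite !cell_cell e. Qed.

Lemma isum_ge0 a len F : (forall n, 0 <= F n) -> 0 <= isum a len F.
Proof. by move=> F0; apply: sumr_ge0 => i _. Qed.

Lemma isum_shift a len F c : isum a len (fun n => F (n + c)) = isum (a + c) len F.
Proof. by apply: eq_bigr => i _; congr F; rewrite addrAC. Qed.

Lemma isum_cat a l1 l2 F :
  isum a (l1 + l2) F = isum a l1 F + isum (a + l1%:Z) l2 F.
Proof.
rewrite /isum big_split_ord /=; congr (_ + _).
by apply: eq_bigr => i _; congr F; rewrite PoszD addrA.
Qed.

Lemma le_isum a len F G : (forall n, a <= n < a + len%:Z -> F n <= G n) ->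
  isum a len F <= isum a len G.
Proof. by move=> FG; apply: ler_sum => i _; apply: FG; have := ltn_ord i; lia. Qed.

Lemma eq_isum a len F G : (forall n, a <= n < a + len%:Z -> F n = G n) ->
  isum a len F = isum a len G.
Proof. by move=> FG; apply: eq_bigr => i _; apply: FG; have := ltn_ord i; lia. Qed.

Lemma isumD a len F G : isum a len (fun n => F n + G n) = isum a len F + isum a len G.
Proof. exact: big_split. Qed.

Lemma isumZ a len (x : R) F : isum a len (fun n => x * F n) = x * isum a len F.
Proof. by rewrite /isum mulr_sumr. Qed.

Lemma isumN a len F : isum a len (fun n => - F n) = - isum a len F.
Proof. by rewrite /isum sumrN. Qed.

Lemma isumB a len F G : isum a len (fun n => F n - G n) = isum a len F - isum a len G.
Proof. by rewrite isumD isumN. Qed.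

Lemma isum_const a len (x : R) : isum a len (fun=> x) = len%:R * x.
Proof. by rewrite /isum sumr_const card_ord mulr_natl. Qed.

Lemma isum_sum a len (I : Type) (r : seq I) (P : pred I) (F : I -> int -> R) :
  isum a len (fun n => \sum_(i <- r | P i) F i n) = \sum_(i <- r | P i) isum a len (F i).
Proof. exact: exchange_big. Qed.

Lemma isum_sub a b (l1 l2 : nat) F : (forall n, 0 <= F n) ->
  b <= a -> a + l1%:Z <= b + l2%:Z -> isum a l1 F <= isum b l2 F.
Proof.
move=> F0 ba ab.
pose d := absz (a - b).
have -> : l2 = (d + (l1 + (l2 - l1 - d)))%N by rewrite /d; lia.
rewrite !isum_cat.
have -> : b + d%:Z = a by rewrite /d; lia.
by rewrite -[leLHS]addr0 -[leLHS]add0r lerD ?lerD ?isum_ge0.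
Qed.

Lemma ler_norm_isum a len F : `|isum a len F| <= isum a len (fun n => `|F n|).
Proof. exact: ler_norm_sum. Qed.

Lemma le_isum_point a len F n : (forall n, 0 <= F n) -> a <= n < a + len%:Z ->
  F n <= isum a len F.
Proof.
move=> F0 h; have -> : F n = isum n 1 F by rewrite /isum big_ord1 addr0.
by apply: isum_sub => //; lia.
Qed.

Lemma isum_cauchy a len F :
  (isum a len F) ^+ 2 <= len%:R * isum a len (fun n => F n ^+ 2).
Proof.
case: len => [|len]; first by rewrite /isum !big_ord0 expr0n mul0r.
set L := len.+1; set S := isum a L F; set S2 := isum a L (fun n => F n ^+ 2).
have L0 : 0 < L%:R :> R by rewrite ltr0n.
have : 0 <= isum a L (fun n => (L%:R * F n - S) ^+ 2).
  by apply: isum_ge0 => n; exact: sqr_ge0.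
rewrite (_ : isum _ _ _ = L%:R * (L%:R * S2 - S ^+ 2)).
  by rewrite pmulr_rge0// subr_ge0.
rewrite (@eq_isum _ _ _ (fun n => L%:R ^+ 2 * F n ^+ 2 +
   ((- 2 * L%:R * S) * F n + S ^+ 2))); last by move=> n _; ring.
by rewrite !isumD !isumZ isum_const -/S -/S2; ring.
Qed.

Lemma dsum_ge0 k c F : (forall n, 0 <= F n) -> 0 <= dsum k c F.
Proof. exact: isum_ge0. Qed.

Lemma dsumS k c F : dsum k.+1 c F = dsum k (2 * c) F + dsum k (2 * c + 1) F.
Proof.
rewrite /dsum expnS mul2n -addnn isum_cat.
have -> : c * pw k.+1 = 2 * c * pw k by rewrite pwS; ring.
by rewrite [(2 * c + 1) * _]mulrDl mul1r.
Qed.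

Lemma dsum0 c F : dsum 0 c F = F c.
Proof. by rewrite /dsum /isum big_ord1 /pw mulr1 addr0. Qed.

Lemma le_dsum k c F G : (forall n, cell k n = c -> F n <= G n) ->
  dsum k c F <= dsum k c G.
Proof.
by move=> FG; apply: le_isum => n nk; apply: FG; apply/eqP; rewrite cellP /pw in nk *; lia.
Qed.

Lemma eq_dsum k c F G : (forall n, cell k n = c -> F n = G n) ->
  dsum k c F = dsum k c G.
Proof.
by move=> FG; apply: eq_isum => n nk; apply: FG; apply/eqP; rewrite cellP /pw in nk *; lia.
Qed.

Lemma dsum_cst k c F (x : R) : (forall n, cell k n = c -> F n = x) ->
  dsum k c F = (2 ^ k)%:R * x.
Proof. by move=> h; rewrite (eq_dsum h) /dsum isum_const. Qed.

Lemma dsum_shift k c F d : dsum k c (fun n => F (n + d * pw k)) = dsum k (c + d) F.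
Proof. by rewrite /dsum isum_shift mulrDl. Qed.

Lemma le_dsum_cells k l c F G : (k <= l)%N ->
  (forall d, dsum k d F <= dsum k d G) -> dsum l c F <= dsum l c G.
Proof.
move=> /subnK <-; elim: (l - k)%N c => [|m IH] c h //.
by rewrite addSn !dsumS lerD// IH.
Qed.

Lemma dsum_cavg k c F : dsum k c (cavg k F) = dsum k c F.
Proof.
have h n : cell k n = c -> cavg k F n = dsum k c F / (2 ^ k)%:R by move=> <-.
by rewrite (dsum_cst h) mulrC divfK// gt_eqF// p2_gt0.
Qed.

Lemma dsum_cavg_le k l c F : (k <= l)%N -> dsum l c (cavg k F) = dsum l c F.
Proof.
by move=> kl; apply: le_anti; apply/andP; split; apply: (le_dsum_cells _ kl) => d;
  rewrite dsum_cavg.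
Qed.

Lemma cavg_ge0 k F n : (forall n, 0 <= F n) -> 0 <= cavg k F n.
Proof. by move=> F0; rewrite divr_ge0 ?dsum_ge0. Qed.

Lemma cavg_cell k F n m : cell k n = cell k m -> cavg k F n = cavg k F m.
Proof. by rewrite /cavg => ->. Qed.

Lemma cavg0 F n : cavg 0 F n = F n.
Proof. by rewrite /cavg dsum0 divr1 /cell /pw divz1. Qed.

End IntervalSums.

(** * Variation within a scale *)

Section BlockVariation.
Context {R : realType}.
Implicit Types (x y : nat -> R) (t : nat -> nat) (u : int -> R) (n : int).

Lemma ler_dist_path x (a b : nat) : (a <= b)%N ->
  `|x a - x b| <= \sum_(a <= N < b) `|x N - x N.+1|.
Proof.
move=> /subnK <-; elim: (b - a)%N => [|m IH]; first by rewrite subrr normr0 sumr_ge0.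
rewrite addSn big_nat_recr ?leq_addl//=.
by apply: le_trans (ler_distD (x (m + a)%N) _ _) _; rewrite lerD2r.
Qed.

Lemma ler_sum_monotone x t (L M : nat) : (forall i, (t i <= t i.+1)%N) -> (t L <= M)%N ->
  \sum_(i < L) `|x (t i) - x (t i.+1)| <= \sum_(0 <= N < M) `|x N - x N.+1|.
Proof.
move=> tm tLM; rewrite (big_cat_nat (n := t L))//= -[leLHS]addr0 lerD ?sumr_ge0//.
elim: {M} L {tLM} => [|L IH]; first by rewrite big_ord0 sumr_ge0.
rewrite big_ord_recr/= (big_cat_nat (n := t L))//= lerD//.
exact: ler_dist_path.
Qed.

Lemma ler_sum_indicator (b : nat -> bool) (c : R) (M : nat) : 0 <= c ->
  (forall N N', b N -> b N' -> N = N') -> \sum_(0 <= N < M) (b N)%:R * c <= c.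
Proof.
move=> c0 bu; elim: M => [|M IH]; first by rewrite big_nil.
rewrite big_nat_recr//=; case: (boolP (b M)) => bM; last by rewrite mul0r addr0.
rewrite big_nat big1 ?add0r ?mul1r// => N NM.
by case: (boolP (b N)) => bN; rewrite ?mul0r//; have := bu _ _ bM bN; lia.
Qed.

(** Cutting [y] off outside [[lo, hi]] creates at most two new jumps, one on entering and one on
    leaving, each of size at most [s]. *)
Lemma variation_cutoff y (lo hi M : nat) (s v : R) : (lo <= hi)%N ->
  (forall N, (lo <= N <= hi)%N -> `|y N| <= s) ->
  \sum_(lo <= N < hi) `|y N - y N.+1| <= v ->
  \sum_(0 <= N < M) `|(lo <= N <= hi)%N%:R * y N - (lo <= N.+1 <= hi)%N%:R * y N.+1|
    <= 2 * s + v.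
Proof.
move=> lh ys yv.
have s0 : 0 <= s by apply: le_trans (ys lo _); rewrite ?leqnn ?lh.
apply: (@le_trans _ _ (\sum_(0 <= N < M) ((N.+1 == lo)%:R * s + (N == hi)%:R * s
    + (lo <= N < hi)%N%:R * `|y N - y N.+1|))).
  apply: ler_sum => N _.
  have nn (b : bool) (c : R) : 0 <= c -> 0 <= b%:R * c by move=> c0; rewrite mulr_ge0.
  have := ys N; have := ys N.+1.
  case: (boolP (lo <= N <= hi)%N) => b1; case: (boolP (lo <= N.+1 <= hi)%N) => b2.
  - have -> : (lo <= N < hi)%N by lia.
    by rewrite !mul1r lerDr addr_ge0// nn.
  - have -> : N == hi by lia.
    move=> _ /(_ isT) yN.
    by rewrite mul0r subr0 !mul1r (le_trans yN)// addrAC lerDr addr_ge0// nn.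
  - have -> : N.+1 == lo by lia.
    move=> /(_ isT) yN _.
    by rewrite mul0r sub0r normrN !mul1r (le_trans yN)// -addrA lerDl addr_ge0// nn.
  - by move=> _ _; rewrite !mul0r subr0 normr0 !addr_ge0// nn.
rewrite !big_split/= mulr_natl mulr2n lerD// ?lerD//.
- by apply: (ler_sum_indicator (b := fun N => N.+1 == lo)) => // N N' /eqP <- /eqP [].
- by apply: (ler_sum_indicator (b := fun N => N == hi)) => // N N' /eqP -> /eqP ->.
apply: le_trans yv.
have [hM|Mh] := leqP M lo.
  rewrite big_nat big1 ?sumr_ge0// => N NM.
  by rewrite (_ : (lo <= N < hi)%N = false) ?mul0r//; lia.
rewrite (big_cat_nat (n := lo))//=; last exact: ltnW.
rewrite [X in X + _]big_nat [X in X + _]big1 ?add0r; last first.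
  by move=> N NM; rewrite (_ : (lo <= N < hi)%N = false) ?mul0r//; lia.
have [hM|Mh'] := leqP hi M.
  rewrite (big_cat_nat (n := hi))//= [X in _ + X]big_nat [X in _ + X]big1 ?addr0; last first.
    by move=> N NM; rewrite (_ : (lo <= N < hi)%N = false) ?mul0r//; lia.
  by rewrite big_nat [leRHS]big_nat ler_sum// => N ->; rewrite mul1r.
rewrite [leRHS](big_cat_nat (n := M))//= ?(ltnW Mh) ?(ltnW Mh')//.
rewrite -[leLHS]addr0 lerD ?sumr_ge0//.
rewrite big_nat [leRHS]big_nat ler_sum// => N NM.
by rewrite (_ : (lo <= N < hi)%N = true) ?mul1r//; lia.
Qed.

(* For the [2]-variation it suffices to multiply the supremum by the [1]-variation. *)
Lemma variation2_cutoff y t (L lo hi : nat) (s v : R) :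
  (forall i, (t i <= t i.+1)%N) -> (lo <= hi)%N ->
  (forall N, (lo <= N <= hi)%N -> `|y N| <= s) ->
  \sum_(lo <= N < hi) `|y N - y N.+1| <= v ->
  \sum_(i < L) ((lo <= t i <= hi)%N%:R * y (t i)
                - (lo <= t i.+1 <= hi)%N%:R * y (t i.+1)) ^+ 2
    <= 2 * s * (2 * s + v).
Proof.
move=> tm lh ys yv.
have s0 : 0 <= s by apply: le_trans (ys lo _); rewrite ?leqnn ?lh.
pose x N := (lo <= N <= hi)%N%:R * y N.
have xs N : `|x N| <= s.
  rewrite /x; case: (boolP (lo <= N <= hi)%N) => h; last by rewrite mul0r normr0.
  by rewrite mul1r ys.
apply: (@le_trans _ _ (\sum_(i < L) 2 * s * `|x (t i) - x (t i.+1)|)).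
  apply: ler_sum => i _; rewrite -/(x _) -/(x _) -[leLHS]ger0_norm ?sqr_ge0// expr2 normrM.
  rewrite ler_wpM2r// (le_trans (ler_normB _ _))//.
  by rewrite mulr_natl mulr2n lerD.
rewrite -mulr_sumr ler_wpM2l ?mulr_ge0//.
apply: le_trans (@ler_sum_monotone x t L (t L) tm (leqnn _)) _.
exact: variation_cutoff.
Qed.

Definition rav (N : nat) u n : R := (N.*2.+1)%:R^-1 * isum (n - N%:Z) N.*2.+1 u.

Lemma ravD N u v n : rav N (fun m => u m + v m) n = rav N u n + rav N v n.
Proof. by rewrite /rav isumD mulrDr. Qed.

Lemma ravZ N u (c : R) n : rav N (fun m => c * u m) n = c * rav N u n.
Proof. by rewrite /rav isumZ mulrCA. Qed.

Lemma rav_sum N n (I : Type) (r : seq I) (P : pred I) (F : I -> int -> R) :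
  rav N (fun m => \sum_(i <- r | P i) F i m) n = \sum_(i <- r | P i) rav N (F i) n.
Proof. by rewrite /rav isum_sum mulr_sumr. Qed.

Lemma rav_cst N (c : R) n : rav N (fun=> c) n = c.
Proof. by rewrite /rav isum_const mulrA mulVf ?mul1r// pnatr_eq0. Qed.

Lemma rav_ge0 N u n : (forall m, 0 <= u m) -> 0 <= rav N u n.
Proof. by move=> u0; rewrite mulr_ge0 ?isum_ge0. Qed.

Lemma eq_rav N u v n : (forall m, n - N%:Z <= m <= n + N%:Z -> u m = v m) ->
  rav N u n = rav N v n.
Proof. by move=> uv; rewrite /rav; congr (_ * _); apply: eq_isum => m mN; apply: uv; lia. Qed.

(** Going from radius [N] to [N.+1] brings in two end values and rescales the old sum. In this form
    both contributions telescope over a block of radii. *)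
Lemma rav_step N u n (U : R) : (forall M, (M <= N.+1)%N -> isum (n - M%:Z) M.*2.+1 (fun m => `|u m|) <= U) ->
  `|rav N u n - rav N.+1 u n| <=
    (N.*2.+1)%:R^-1 * (isum (n - N.+1%:Z) N.+1.*2.+1 (fun m => `|u m|)
                       - isum (n - N%:Z) N.*2.+1 (fun m => `|u m|))
    + U * ((N.*2.+1)%:R^-1 - (N.+1.*2.+1)%:R^-1).
Proof.
move=> hU.
have E (v : int -> R) : isum (n - N.+1%:Z) N.+1.*2.+1 v
    = v (n - N.+1%:Z) + isum (n - N%:Z) N.*2.+1 v + v (n + N.+1%:Z).
  have -> : N.+1.*2.+1 = (1 + (N.*2.+1 + 1))%N by rewrite doubleS; lia.
  have -> : n - N%:Z = n - N.+1%:Z + 1%:Z by lia.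
  have -> : n + N.+1%:Z = n - N.+1%:Z + 1%:Z + N.*2.+1%:Z by lia.
  by rewrite !isum_cat addrA /isum !big_ord1 !addr0.
rewrite /rav !E.
set a := (N.*2.+1)%:R^-1; set b := (N.+1.*2.+1)%:R^-1.
have ab : 0 <= a - b by rewrite subr_ge0 lef_pV2 ?posrE ?ltr0n// ler_nat; lia.
have b0 : 0 <= b by rewrite invr_ge0.
set p := u (n - N.+1%:Z); set q := u (n + N.+1%:Z); set S := isum _ _ u; set S' := isum _ _ _.
have SU : `|S| <= U by apply: le_trans (ler_norm_isum _ _ _) (hU _ (leqnSn _)).
have -> : a * S - b * (p + S + q) = (a - b) * S - b * (p + q) by ring.
have -> : a * (`|p| + S' + `|q| - S') + U * (a - b) = (a - b) * U + a * (`|p| + `|q|) by ring.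
apply: le_trans (ler_normB _ _) _.
rewrite !normrM (ger0_norm ab) (ger0_norm b0) lerD ?ler_wpM2l//.
apply: ler_pM => //; first by rewrite -subr_ge0.
exact: ler_normD.
Qed.

Lemma inv_block_le (k N : nat) : (2 ^ k <= N.+1)%N -> (N.*2.+1)%:R^-1 <= (2 ^ k)%:R^-1 :> R.
Proof.
move=> kN; rewrite lef_pV2 ?posrE ?ltr0n ?expn_gt0// ler_nat.
have := expn_gt0 2 k; lia.
Qed.

(** Wide enough to contain every window of radius at most [2^(k+1) - 1] centred in the cell [c]. *)
Definition w5 (k : nat) (c : int) u : R := isum ((c - 2) * pw k) (5 * 2 ^ k) u.

Lemma w5E k c u : w5 k c u = dsum k (c - 2) u + dsum k (c - 1) u + dsum k c u
   + dsum k (c + 1) u + dsum k (c + 2) u.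
Proof.
rewrite /w5 /dsum.
have -> : (5 * 2 ^ k = 2 ^ k + (2 ^ k + (2 ^ k + (2 ^ k + 2 ^ k))))%N by lia.
rewrite !isum_cat -!/(pw k) !addrA.
have -> : (c - 2) * pw k + pw k = (c - 1) * pw k by ring.
have -> : (c - 1) * pw k + pw k = c * pw k by ring.
have -> : c * pw k + pw k = (c + 1) * pw k by ring.
have -> : (c + 1) * pw k + pw k = (c + 2) * pw k by ring.
by rewrite -[c + 1 + 1]addrA.
Qed.

Lemma rav_sup_w5 k N u n : (2 ^ k <= N.+1 <= 2 ^ k.+1)%N ->
  isum (n - N%:Z) N.*2.+1 (fun m => `|u m|) <= w5 k (cell k n) (fun m => `|u m|).
Proof.
move=> /andP[h1 h2]; apply: isum_sub => //; have /andP[] := cell_bounds k n.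
  by rewrite expnS in h2; rewrite /pw; lia.
by rewrite expnS in h2; rewrite /pw; lia.
Qed.

Lemma block_variation2 k (lo hi : nat) t L u n (s : R) :
  (forall i, (t i <= t i.+1)%N) -> (lo <= hi)%N ->
  (2 ^ k <= lo.+1)%N -> (hi.+1 <= 2 ^ k.+1)%N ->
  (forall N, (lo <= N <= hi)%N -> `|rav N u n| <= s) ->
  s <= (2 ^ k)%:R^-1 * w5 k (cell k n) (fun m => `|u m|) ->
  \sum_(i < L) ((lo <= t i <= hi)%N%:R * rav (t i) u n
                - (lo <= t i.+1 <= hi)%N%:R * rav (t i.+1) u n) ^+ 2
    <= 8 * s * ((2 ^ k)%:R^-1 * w5 k (cell k n) (fun m => `|u m|)).
Proof.
move=> tm lh klo khi hs sU; set U := w5 _ _ _ in sU *; set P := (2 ^ k)%:R^-1 in sU *.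
have s0 : 0 <= s by apply: le_trans (hs lo _); rewrite ?leqnn ?lh.
have P0 : 0 <= P by rewrite invr_ge0.
have U0 : 0 <= U by exact: isum_ge0.
have hU M : (lo <= M <= hi)%N -> isum (n - M%:Z) M.*2.+1 (fun m => `|u m|) <= U.
  by move=> hM; apply: rav_sup_w5; lia.
pose S (N : nat) : R := isum (n - N%:Z) N.*2.+1 (fun m => `|u m|).
have Smono M N : (M <= N)%N -> S M <= S N by move=> MN; apply: isum_sub => //; lia.
pose iv (N : nat) : R := (N.*2.+1)%:R^-1.
(* Over the block, new mass at most [U] enters at density at most [P], and the reciprocal lengths
   drop by at most [P] in total. Hence [v = 2 P U], and [s <= P U] turns [2 s (2 s + v)] into
   [8 s P U]. *)
apply: le_trans (variation2_cutoff (v := P * U + U * P) L tm lh hs _) _.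
  apply: (@le_trans _ _ (\sum_(lo <= N < hi) (P * (S N.+1 - S N) + U * (iv N - iv N.+1)))).
    rewrite big_nat [leRHS]big_nat; apply: ler_sum => N hN.
    apply: le_trans (@rav_step N u n U _) _.
      by move=> M MN; apply: le_trans (Smono _ N.+1 _) _ => //; apply: hU; lia.
    rewrite lerD// ler_wpM2r ?subr_ge0 ?Smono//.
    by apply: inv_block_le; lia.
  rewrite big_split/= -!mulr_sumr telescope_sumr// lerD// ler_wpM2l//.
    by rewrite lerBlDr (le_trans (hU hi _)) ?lh ?leqnn// lerDl isum_ge0.
  rewrite -(opprK (\sum_(_ <= _ < _) _)) -sumrN.
  under eq_bigr do rewrite opprB.
  rewrite telescope_sumr// opprB.
  by rewrite lerBlDr (le_trans (inv_block_le klo))// lerDl invr_ge0.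
have -> : 8 * s * (P * U) = 2 * s * (4 * (P * U)) by ring.
rewrite ler_wpM2l ?mulr_ge0// (mulrC U P).
lra.
Qed.

Lemma block_variation2_sup k (lo hi : nat) t L u n :
  (forall i, (t i <= t i.+1)%N) -> (lo <= hi)%N ->
  (2 ^ k <= lo.+1)%N -> (hi.+1 <= 2 ^ k.+1)%N ->
  \sum_(i < L) ((lo <= t i <= hi)%N%:R * rav (t i) u n
                - (lo <= t i.+1 <= hi)%N%:R * rav (t i.+1) u n) ^+ 2
    <= 8 * ((2 ^ k)%:R^-1 * w5 k (cell k n) (fun m => `|u m|)) ^+ 2.
Proof.
move=> tm lh klo khi; rewrite expr2 mulrA; apply: block_variation2 => // N hN.
rewrite /rav normrM ger0_norm ?invr_ge0//; apply: ler_pM => //.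
  by apply: inv_block_le; lia.
apply: le_trans (ler_norm_isum _ _ _) _.
by apply: rav_sup_w5; lia.
Qed.

End BlockVariation.

(** * Averages of functions with mean zero on cells *)

Section MeanZero.
Context {R : realType}.
Implicit Types (u : int -> R) (n a c : int) (j k : nat).

(** Constant on cells of scale [j], so its sum over such a cell is, up to the length, the square of
    an [l^1] norm. *)
Definition energy j u n : R := cavg j (fun m => `|u m|) n ^+ 2.

Lemma energy_ge0 j u n : 0 <= energy j u n.
Proof. exact: sqr_ge0. Qed.

Lemma sqr_dsum_energy j c u :
  dsum j c (fun m => `|u m|) ^+ 2 = (2 ^ j)%:R * dsum j c (energy j u).
Proof.
have h n : cell j n = c -> energy j u n = (dsum j c (fun m => `|u m|) / (2 ^ j)%:R) ^+ 2.
  by rewrite /energy /cavg => ->.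
rewrite (dsum_cst h); have := p2_gt0 (R := R) j; move: (dsum _ _ _) (_ %:R) => x y y0.
by field; rewrite gt_eqF.
Qed.

(** Whole cells contribute nothing. With [p x] the sum from the left end of the cell of [x] up to,
    but excluding, [x], the sum is the difference of the values of [p] at its two ends. *)
Lemma meanzero_isum j u a (len : nat) : (forall c, dsum j c u = 0) ->
  `|isum a len u| <= dsum j (cell j a) (fun m => `|u m|)
                     + dsum j (cell j (a + len%:Z)) (fun m => `|u m|).
Proof.
move=> u0.
pose p x : R := isum (cell j x * pw j) (absz (x - cell j x * pw j)%R) u.
have pS x : p (x + 1) = p x + u x.
  have /andP[h1 h2] := cell_bounds j x; have j0 := pw_gt0 j.
  (* If [x] is the last point of its cell, [p x + u x] is the sum over the whole cell and vanishes,
     as does the empty sum [p (x + 1)]. *)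
  have [e|ne] := eqVneq (x + 1) ((cell j x + 1) * pw j).
    have e' : cell j (x + 1) = cell j x + 1.
      by apply/eqP; rewrite cellP e lexx/= ltr_pM2r// ltzD1.
    rewrite /p e' e subrr absz0 [LHS]/isum big_ord0.
    have -> : u x = isum x 1 u by rewrite /isum big_ord1 addr0.
    have -> : isum x 1 u = isum (cell j x * pw j + (absz (x - cell j x * pw j)%R)%:Z)%R 1 u.
      by move: h1; move: (cell j x * pw j) => z h1; have -> : z + (absz (x - z)%R)%:Z = x by lia.
    rewrite -isum_cat.
    have -> : (absz (x - cell j x * pw j)%R + 1 = 2 ^ j)%N.
      by move: e h1 h2 j0; rewrite /pw mulrDl mul1r; move: (cell j x * pw j)%R => z; lia.
    by rewrite -/(dsum j _ u) u0.
  have e' : cell j (x + 1) = cell j x.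
    by apply/eqP; rewrite cellP; move: ne h1 h2; rewrite mulrDl mul1r; move: (cell j x * pw j)%R => z; lia.
  rewrite /p e'.
  have -> : absz (x + 1 - cell j x * pw j)%R = (absz (x - cell j x * pw j)%R + 1)%N.
    by move: h1; move: (cell j x * pw j)%R => z; lia.
  move: h1; move: (cell j x * pw j)%R => z h1.
  rewrite isum_cat [isum _ 1 u]/isum big_ord1 addr0.
  by have -> : z + (absz (x - z)%R)%:Z = x by lia.
have -> : isum a len u = p (a + len%:Z) - p a.
  elim: len => [|len IH]; first by rewrite /isum big_ord0 addr0 subrr.
  rewrite /isum big_ord_recr/= -/(isum a len u) IH -addn1 PoszD addrA pS.
  by rewrite addrAC.
have pb x : `|p x| <= dsum j (cell j x) (fun m => `|u m|).
  apply: le_trans (ler_norm_isum _ _ _) _; apply: isum_sub => //.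
  have := cell_bounds j x; rewrite mulrDl mul1r /pw; move: (cell j x * pw j)%R => z; lia.
by rewrite [leRHS]addrC (le_trans (ler_normB _ _))// lerD.
Qed.

Lemma le_dsum_w5 j k n x u : (j <= k)%N -> (forall m, 0 <= u m) ->
  cell k n - 2 <= cell k x <= cell k n + 2 ->
  dsum j (cell j x) u <= w5 k (cell k n) u.
Proof.
move=> /subnKC jk u0 /andP[h1 h2].
rewrite -jk in h1 h2 *; move: (k - j)%N h1 h2 => d; rewrite !cell_cell.
move: (cell d (cell j n)) => c h1 h2.
have /andP[b1 b2] := cell_bounds d (cell j x).
have j0 := pw_gt0 j; have d0 := pw_gt0 d.
apply: isum_sub => //; rewrite ?PoszM -!/(pw _) pwD.
  have -> : (c - 2) * (pw j * pw d) = ((c - 2) * pw d) * pw j by ring.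
  by rewrite ler_pM2r// (le_trans _ b1)// ler_pM2r.
have -> : (cell j x * pw j + pw j) = (cell j x + 1) * pw j by ring.
have -> : (c - 2) * (pw j * pw d) + 5%N%:Z * (pw j * pw d) = ((c + 3) * pw d) * pw j by ring.
rewrite ler_pM2r// lezD1 (lt_le_trans b2)// ler_pM2r//; lia.
Qed.

Lemma w5_cauchy j k n u : (j <= k)%N ->
  w5 k (cell k n) (fun m => `|u m|) ^+ 2
    <= 5 * (2 ^ k)%:R * w5 k (cell k n) (energy j u).
Proof.
move=> jk.
have -> : w5 k (cell k n) (fun m => `|u m|) = w5 k (cell k n) (cavg j (fun m => `|u m|)).
  by rewrite !w5E !(dsum_cavg_le _ _ jk).
by apply: le_trans (isum_cauchy _ _ _) _; rewrite natrM.
Qed.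

(** Only the two cells of scale [j] at the ends of the window contribute;
    [(x + y)^2 <= 2 x^2 + 2 y^2] produces the factor 4. *)
Lemma meanzero_rav j k N n u : (j <= k)%N -> (2 ^ k <= N.+1 <= 2 ^ k.+1)%N ->
  (forall c, dsum j c u = 0) ->
  rav N u n ^+ 2
    <= ((2 ^ k)%:R^-1) ^+ 2 * (4 * (2 ^ j)%:R * w5 k (cell k n) (energy j u)).
Proof.
move=> jk /andP[hN1 hN2] u0; rewrite /rav exprMn; apply: ler_pM; rewrite ?sqr_ge0//.
  by rewrite lerXn2r ?nnegrE ?invr_ge0// inv_block_le.
set W := w5 _ _ _.
have W0 : 0 <= W by apply: isum_ge0 => m; exact: energy_ge0.
have hb x : cell k n - 2 <= cell k x <= cell k n + 2 ->
    dsum j (cell j x) (fun m => `|u m|) ^+ 2 <= (2 ^ j)%:R * W.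
  move=> hx; rewrite sqr_dsum_energy ler_pM2l ?p2_gt0//.
  by apply: le_dsum_w5 => // m; exact: energy_ge0.
have hc (m : int) : - (2 * pw k) < m - n < 2 * pw k + 1 -> cell k n - 2 <= cell k m <= cell k n + 2.
  move=> hm; have := cell_bounds k n; have := cell_bounds k m; have := pw_gt0 k.
  by move: (cell k n) (cell k m) (pw k) hm => x y p; nia.
have hN2' : N%:Z + 1 <= 2 * pw k by rewrite expnS in hN2; rewrite /pw; lia.
have /hb d1 : cell k n - 2 <= cell k (n - N%:Z) <= cell k n + 2 by apply: hc; lia.
have /hb d2 : cell k n - 2 <= cell k (n - N%:Z + N.*2.+1%:Z) <= cell k n + 2.
  by apply: hc; lia.
have := @meanzero_isum j u (n - N%:Z) N.*2.+1 u0.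
move: (dsum _ _ _) (dsum j _ _) d1 d2 (@dsum_ge0 R j (cell j (n - N%:Z)) _ (fun m => normr_ge0 (u m))) => y x d1 d2 _ h.
rewrite -(real_normK (num_real _)).
apply: (@le_trans _ _ ((x + y) ^+ 2)).
  by rewrite lerXn2r ?nnegrE ?(le_trans _ h) 1?addrC.
have := sqr_ge0 (x - y); rewrite sqrrB sqrrD; lra.
Qed.

(** Cancellation improves the supremum over the block by [2^(-(k-j)/2)] but does nothing for the
    1-variation, so their product decays at that rate. The ratio [18/25] is a rational number
    slightly above [1/sqrt 2]. *)
Lemma block_variation2_meanzero j k (lo hi : nat) t L u n : (j <= k)%N ->
  (forall i, (t i <= t i.+1)%N) -> (lo <= hi)%N ->
  (2 ^ k <= lo.+1)%N -> (hi.+1 <= 2 ^ k.+1)%N ->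
  (forall c, dsum j c u = 0) ->
  \sum_(i < L) ((lo <= t i <= hi)%N%:R * rav (t i) u n
                - (lo <= t i.+1 <= hi)%N%:R * rav (t i.+1) u n) ^+ 2
    <= 40 * (18 / 25) ^+ (k - j) * ((2 ^ k)%:R^-1 * w5 k (cell k n) (energy j u)).
Proof.
move=> jk tm lh klo khi u0.
set W := w5 k _ (energy j u); set P : R := (2 ^ k)%:R^-1.
set U := w5 k (cell k n) (fun m => `|u m|).
have W0 : 0 <= W by apply: isum_ge0 => m; exact: energy_ge0.
have P0 : 0 <= P by rewrite invr_ge0.
have U0 : 0 <= U by exact: isum_ge0.
(* [block_variation2] asks for a bound of the supremum that is at most [P * U], hence the
   minimum. *)
pose s := Num.min (P * U) (P * Num.sqrt (4 * (2 ^ j)%:R * W)).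
have W4 : 0 <= 4 * (2 ^ j)%:R * W by rewrite !mulr_ge0.
apply: le_trans (@block_variation2 R k lo hi t L u n s tm lh klo khi _ _) _.
- move=> N hN; rewrite le_min; apply/andP; split.
    rewrite /rav normrM ger0_norm ?invr_ge0//; apply: ler_pM => //.
      by apply: inv_block_le; lia.
    apply: le_trans (ler_norm_isum _ _ _) _.
    by apply: rav_sup_w5; lia.
  rewrite -ler_sqr ?nnegrE ?normr_ge0 ?mulr_ge0 ?sqrtr_ge0// real_normK ?num_real// [leRHS]exprMn.
  rewrite sqr_sqrtr//; apply: meanzero_rav => //; lia.
- by rewrite ge_min lexx.
apply: (@le_trans _ _ (8 * (P * Num.sqrt (4 * (2 ^ j)%:R * W)) * (P * U))).
  by rewrite ler_wpM2r ?mulr_ge0// ler_wpM2l// ge_min lexx orbT.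
have hU : U <= Num.sqrt (5 * (2 ^ k)%:R * W).
  by rewrite -[leLHS]ger0_norm// -sqrtr_sqr ler_wsqrtr// w5_cauchy.
apply: (@le_trans _ _ (8 * P ^+ 2 * (Num.sqrt (4 * (2 ^ j)%:R * W) * Num.sqrt (5 * (2 ^ k)%:R * W)))).
  rewrite [leLHS](_ : _ = 8 * P ^+ 2 * (Num.sqrt (4 * (2 ^ j)%:R * W) * U)); last by ring.
  by rewrite ler_wpM2l ?mulr_ge0// ler_wpM2l ?sqrtr_ge0.
rewrite -sqrtrM//.
have h : (4 * (2 ^ j)%:R * W) * (5 * (2 ^ k)%:R * W)
    <= (5 * (18 / 25) ^+ (k - j) * (2 ^ k)%:R * W) ^+ 2 :> R.
  rewrite [leLHS](_ : _ = 20 * ((2 ^ j)%:R * (2 ^ k)%:R) * W ^+ 2); last by ring.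
  rewrite exprMn ler_wpM2r ?sqr_ge0// exprMn exprMn.
  rewrite -{1 3}(subnKC jk) expnD !natrM !natrX.
  set a : R := 2 ^+ j; set d := (k - j)%N.
  have a0 : 0 <= a ^+ 2 by rewrite sqr_ge0.
  have -> : 20 * (a * (a * 2 ^+ d)) = a ^+ 2 * (20 * 2 ^+ d) :> R by ring.
  have key (b : R) : (b ^+ d) ^+ 2 * (2 ^+ d) ^+ 2 = (b ^+ 2 * 4) ^+ d.
    by rewrite -!exprM mulnC !exprM -exprMn; congr (_ ^+ d); ring.
  have -> : 5 ^+ 2 * ((18 / 25) ^+ d) ^+ 2 * (a * 2 ^+ d) ^+ 2
      = a ^+ 2 * (25 * ((18 / 25) ^+ 2 * 4) ^+ d) :> R.
    by rewrite -key; move: ((18 / 25) ^+ d) (2 ^+ d) => x y; ring.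
  rewrite ler_wpM2l// ler_pM ?exprn_ge0//; first by lra.
  rewrite lerXn2r ?nnegrE//; lra.
apply: (@le_trans _ _ (8 * P ^+ 2 * (5 * (18 / 25) ^+ (k - j) * (2 ^ k)%:R * W))).
  rewrite ler_wpM2l ?mulr_ge0//.
  have q0 : 0 <= (18 / 25 : R) ^+ (k - j) by rewrite exprn_ge0//; lra.
  rewrite -[leRHS]ger0_norm ?mulr_ge0//.
  by rewrite -sqrtr_sqr ler_wsqrtr.
have e : P * (2 ^ k)%:R = 1 by rewrite mulVf// gt_eqF ?p2_gt0.
rewrite [leLHS](_ : _ = 40 * (18 / 25) ^+ (k - j) * (P * W) * (P * (2 ^ k)%:R)); last by ring.
by rewrite e mulr1.
Qed.

(* Cauchy--Schwarz with geometric weights [(9/10)^(k-j)]. *)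
Lemma sqr_sum_geometric (k : nat) (a : nat -> R) :
  (\sum_(j < k.+1) a j) ^+ 2 <= 10 * \sum_(j < k.+1) (10 / 9) ^+ (k - j) * a j ^+ 2.
Proof.
elim: k => [|k IH].
  rewrite !big_ord1 expr0 mul1r; have := sqr_ge0 (a 0%N); lra.
rewrite big_ord_recr [in leRHS]big_ord_recr/= subnn expr0 mul1r.
set S := \sum_(_ < _) a _ in IH *.
rewrite [X in _ <= 10 * (X + _)](_ : _ = 10 / 9 * \sum_(j < k.+1) (10 / 9) ^+ (k - j) * a j ^+ 2).
  move: (a k.+1) IH; move: (\sum_(j < _) _) => T x IH.
  have := sqr_ge0 (S / 3 - 3 * x); rewrite sqrrB sqrrD; lra.
rewrite mulr_sumr; apply: eq_bigr => j _; rewrite subSn ?exprS ?mulrA//.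
by have := ltn_ord j; lia.
Qed.

Lemma block_variation2_meanzero_sum k (lo hi : nat) t L (u : nat -> int -> R) n :
  (forall i, (t i <= t i.+1)%N) -> (lo <= hi)%N ->
  (2 ^ k <= lo.+1)%N -> (hi.+1 <= 2 ^ k.+1)%N ->
  (forall j c, (j <= k)%N -> dsum j c (u j) = 0) ->
  \sum_(i < L) ((lo <= t i <= hi)%N%:R * rav (t i) (fun m => \sum_(j < k.+1) u j m) n
      - (lo <= t i.+1 <= hi)%N%:R * rav (t i.+1) (fun m => \sum_(j < k.+1) u j m) n) ^+ 2
    <= 400 * \sum_(j < k.+1) (4 / 5) ^+ (k - j)
         * ((2 ^ k)%:R^-1 * w5 k (cell k n) (energy j (u j))).
Proof.
move=> tm lh klo khi u0.
pose D j (i : nat) : R := (lo <= t i <= hi)%N%:R * rav (t i) (u j) n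
                - (lo <= t i.+1 <= hi)%N%:R * rav (t i.+1) (u j) n.
apply: (@le_trans _ _ (\sum_(i < L) 10 * \sum_(j < k.+1) (10 / 9) ^+ (k - j) * D j i ^+ 2)).
  apply: ler_sum => i _; apply: le_trans _ (sqr_sum_geometric k (fun j => D j i)).
  have -> : \sum_(j < k.+1) D j i = (lo <= t i <= hi)%N%:R * rav (t i) (fun m => \sum_(j < k.+1) u j m) n
      - (lo <= t i.+1 <= hi)%N%:R * rav (t i.+1) (fun m => \sum_(j < k.+1) u j m) n.
    by rewrite !rav_sum !mulr_sumr -sumrB.
  exact: lexx.
rewrite -mulr_sumr exchange_big/=.
rewrite [leRHS](_ : _ = 10 * \sum_(j < k.+1) 40 * ((4 / 5) ^+ (k - j)
         * ((2 ^ k)%:R^-1 * w5 k (cell k n) (energy j (u j))))); last first.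
  by rewrite -mulr_sumr mulrA -natrM.
rewrite ler_wpM2l//; apply: ler_sum => j _; have jk : (j <= k)%N by rewrite -ltnS.
rewrite -mulr_sumr.
apply: (@le_trans _ _ ((10 / 9) ^+ (k - j) * (40 * (18 / 25) ^+ (k - j) *
    ((2 ^ k)%:R^-1 * w5 k (cell k n) (energy j (u j)))))).
  rewrite ler_wpM2l ?exprn_ge0//.
  by apply: block_variation2_meanzero => // c; apply: u0.
(* The loss [10/9] per scale from [sqr_sum_geometric] leaves the decay [10/9 * 18/25 = 4/5]. *)
rewrite [leLHS](_ : _ = 40 * ((10 / 9 * (18 / 25)) ^+ (k - j) *
    ((2 ^ k)%:R^-1 * w5 k (cell k n) (energy j (u j))))); last first.
  by rewrite [in RHS]exprMn; move: ((10 / 9) ^+ (k - j)) ((18 / 25) ^+ (k - j)) => x y; ring.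
rewrite ler_wpM2l// ler_wpM2r//.
  by rewrite mulr_ge0 ?invr_ge0//; apply: isum_ge0 => m; exact: energy_ge0.
rewrite lerXn2r ?nnegrE//; lra.
Qed.

End MeanZero.

(** * Stopped martingale differences *)

Section Stopping.
Context {R : realType}.
Variables (K : nat) (f : int -> R) (lam : R).
Hypothesis f0 : forall n, 0 <= f n.
Implicit Types (n m c : int) (j k l : nat).

(* Scanning the scales from [K] downwards for the stopping rule
   [lam < cavg k f n]: [ns k n] says that it has not fired down to scale [k], and
   [st j n] below that it fires first at scale [j]. *)
Definition ns k n : bool := [forall l : 'I_K.+1, (k <= l)%N ==> (cavg l f n <= lam)].

Lemma nsP k n : reflect (forall l, (k <= l <= K)%N -> cavg l f n <= lam) (ns k n).
Proof.
apply: (iffP forallP) => [h l /andP[kl lK]|h l].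
  by have /implyP := h (Ordinal (lK : (l < K.+1)%N)); apply.
by apply/implyP => kl; apply: h; rewrite kl -ltnS ltn_ord.
Qed.

Lemma ns_le k l n : (k <= l)%N -> ns k n -> ns l n.
Proof. by move=> kl /nsP h; apply/nsP => i /andP[li iK]; apply: h; lia. Qed.

Lemma nsS k n : (k <= K)%N -> ns k n = (cavg k f n <= lam) && ns k.+1 n.
Proof.
move=> kK; apply/idP/andP => [h|[h1 /nsP h2]].
  by split; [move/nsP : h; apply; lia|apply: ns_le h].
apply/nsP => l lK; have [<-//|kl] := eqVneq k l.
by apply: h2; lia.
Qed.

Lemma ns_cell k n m : cell k n = cell k m -> ns k n = ns k m.
Proof.
move=> e; apply/nsP/nsP => h l lK; have /andP[kl _] := lK; have := h l lK.
  by rewrite (cavg_cell _ (cell_eq kl e)).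
by rewrite (cavg_cell _ (cell_eq kl e)).
Qed.

Definition st j n : bool := [&& (j <= K)%N, lam < cavg j f n & ns j.+1 n].

Lemma st_cell j n m : cell j n = cell j m -> st j n = st j m.
Proof.
by move=> e; rewrite /st (cavg_cell _ e) (ns_cell (cell_eq (leqnSn j) e)).
Qed.

Lemma st_uniq j k n : st j n -> st k n -> j = k.
Proof.
wlog jk : j k / (j <= k)%N.
  move=> h sj sk; have [jk|kj] := leqP j k; first exact: h.
  by rewrite (h _ _ (ltnW kj) sk sj).
move=> /and3P[_ _ /nsP h] /and3P[kK hk _]; apply/eqP; rewrite eqn_leq jk leqNgt.
by apply/negP => jk'; have := h k; rewrite jk' kK => /(_ isT); rewrite leNgt hk.
Qed.

Lemma st_ns j n : st j n -> ~~ ns j n.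
Proof.
by move=> /and3P[jK h _]; apply/negP => /nsP /(_ j); rewrite leqnn jK leNgt h => /(_ isT).
Qed.

Lemma sum_st_le1 n k : \sum_(j < k) (st j n)%:R <= 1 :> R.
Proof.
have [/existsP[i si]|/existsPn h] := boolP [exists j : 'I_k, st j n].
  rewrite (bigD1 i)//= si big1 ?addr0// => j ji.
  by case: (boolP (st j n)) => // sj; rewrite (val_inj (st_uniq sj si)) eqxx in ji.
by rewrite big1// => j _; rewrite (negbTE (h j)).
Qed.

(** The Calderon--Zygmund bad function carried by the stopping cells of scale [j]. It reappears
    without the martingale increments in the weak bound. *)
Definition badpart j n : R := if st j n then f n - cavg j f n else 0.

(* [udiff j] is the [j]-th stopped martingale difference; at the stopping scale it
   contains all of the remaining fluctuation of [f], so that the sum over [j]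
   telescopes to [f] minus its average at the top scale. *)
Definition incr j n : R :=
  if ns j n then (if j is j'.+1 then cavg j' f n - cavg j f n else 0) else 0.

Definition udiff j n : R := incr j n + badpart j n.

Lemma dsum_badpart j c : dsum j c (badpart j) = 0.
Proof.
have [s|s] := boolP (st j (c * pw j)).
  have e n : cell j n = c -> cell j n = cell j (c * pw j).
    by move=> ->; apply/esym; have := @cell_dyadic j c 0; rewrite addr0 expn_gt0; apply.
  have h n : cell j n = c -> badpart j n = f n - cavg j f n.
    by move=> /e hn; rewrite /badpart (st_cell hn) s.
  by rewrite (eq_dsum h) /dsum isumB -/(dsum j c f) -/(dsum j c _) dsum_cavg subrr.
have h n : cell j n = c -> badpart j n = 0.
  move=> hn; rewrite /badpart (@st_cell _ _ (c * pw j)) ?(negbTE s)// hn.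
  by apply/esym; have := @cell_dyadic j c 0; rewrite addr0 expn_gt0; apply.
by rewrite (dsum_cst h) mulr0.
Qed.

Lemma cell_base j c : cell j (c * pw j) = c.
Proof. by have := @cell_dyadic j c 0; rewrite addr0 expn_gt0; apply. Qed.

Lemma dsum_incr j c : dsum j c (incr j) = 0.
Proof.
have [s|s] := boolP (ns j (c * pw j)); last first.
  have h n : cell j n = c -> incr j n = 0.
    by move=> hn; rewrite /incr (@ns_cell _ _ (c * pw j)) ?(negbTE s)// hn cell_base.
  by rewrite (dsum_cst h) mulr0.
have hs n : cell j n = c -> ns j n by move=> hn; rewrite (@ns_cell _ _ (c * pw j)) ?hn ?cell_base.
case: j s hs => [|j] s hs.
  have h n : cell 0 n = c -> incr 0 n = 0 by rewrite /incr if_same.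
  by rewrite (dsum_cst h) mulr0.
have h n : cell j.+1 n = c -> incr j.+1 n = cavg j f n - cavg j.+1 f n.
  by move=> /hs hn; rewrite /incr hn.
rewrite (eq_dsum h) /dsum isumB -!/(dsum _ _ _) dsum_cavg.
by rewrite dsum_cavg_le// subrr.
Qed.

Lemma dsum_udiff j c : dsum j c (udiff j) = 0.
Proof. by rewrite /dsum isumD -!/(dsum _ _ _) dsum_badpart dsum_incr addr0. Qed.

Lemma udiff_notns j n : (j <= K)%N -> ~~ ns j.+1 n -> udiff j n = 0.
Proof.
move=> jK h; rewrite /udiff /incr /badpart /st (negbTE h) !andbF addr0.
by rewrite nsS// (negbTE h) andbF.
Qed.

(** Induction on the scale. If the scan stops at the scale just below, the bad part there carries
    all of [f] minus its average and every finer difference vanishes; otherwise one martingale step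
    is added. *)
Lemma telescope_udiff k n : (k <= K)%N -> ns k n ->
  f n = cavg k f n + \sum_(j < k.+1) udiff j n.
Proof.
elim: k => [|k IH] kK h.
  by rewrite big_ord1 /udiff /incr /badpart /st if_same cavg0 subrr if_same !addr0.
have kK' : (k <= K)%N by exact: ltnW.
rewrite big_ord_recr/=.
have [h'|h'] := boolP (ns k n).
  have -> : udiff k.+1 n = cavg k f n - cavg k.+1 f n.
    rewrite /udiff /incr h /badpart.
    by rewrite (_ : st k.+1 n = false) ?addr0//; apply/negbTE/negP => /st_ns; rewrite h.
  rewrite {1}(IH kK' h'); move: (cavg k f n) (cavg k.+1 f n) (\sum_(j < _) _) => x y z; ring.
have sk : st k n.
  by move: h'; rewrite /st nsS// h kK' !andbT -ltNge.
rewrite big_ord_recr/= big1 ?add0r; last first.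
  move=> j _; apply: udiff_notns; first by have := ltn_ord j; lia.
  by apply: contra h'; apply: ns_le.
have -> : udiff k n = f n - cavg k f n.
  by rewrite /udiff /incr (negbTE h') /badpart sk add0r.
have -> : udiff k.+1 n = cavg k f n - cavg k.+1 f n.
  rewrite /udiff /incr h /badpart.
  by rewrite (_ : st k.+1 n = false) ?addr0//; apply/negbTE/negP => /st_ns; rewrite h.
ring.
Qed.

Lemma cavg_parent k n : cavg k f n <= 2 * cavg k.+1 f n.
Proof.
rewrite /cavg p2S cellS.
have half (x y : R) : 0 < y -> 2 * (x / (2 * y)) = x / y.
  by move=> y0; field; rewrite gt_eqF.
rewrite half ?p2_gt0//.
rewrite ler_wpM2r ?invr_ge0// dsumS.
have := divz_eq (cell k n) 2; set q := (_ %/ _)%Z; set r := (_ %% _)%Z => e.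
have r0 : 0 <= r by rewrite modz_ge0.
have r2 : r < 2 by rewrite ltz_pmod.
have [r0'|r1] : r = 0 \/ r = 1 by lia.
  by rewrite e r0' addr0 mulrC lerDl dsum_ge0.
by rewrite e r1 mulrC lerDr dsum_ge0.
Qed.

(** On a stopping cell the modulus of [f - cavg j f] averages to at most twice the average of [f];
    squaring gives the 4. *)
Lemma energy_badpart j n :
  energy j (badpart j) n <= (st j n)%:R * (4 * cavg j f n ^+ 2).
Proof.
rewrite /energy; have [s|s] := boolP (st j n); last first.
  have h m : cell j m = cell j n -> `|badpart j m| = 0.
    by move=> e; rewrite /badpart (st_cell e) (negbTE s) normr0.
  by rewrite {1}/cavg (dsum_cst h) mulr0 mul0r expr0n mul0r.
rewrite mul1r.
have -> : 4 * cavg j f n ^+ 2 = (2 * cavg j f n) ^+ 2 by ring.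
have c0 : 0 <= cavg j f n by exact: cavg_ge0.
have d0 : 0 <= 2 * cavg j f n by rewrite mulr_ge0.
have b0 : 0 <= cavg j (fun m => `|badpart j m|) n by exact: cavg_ge0.
rewrite lerXn2r ?nnegrE//.
rewrite {1}/cavg ler_pdivrMr ?p2_gt0//.
apply: (@le_trans _ _ (dsum j (cell j n) (fun m => f m + cavg j f n))).
  apply: le_dsum => m e; rewrite /badpart (st_cell e) s (cavg_cell _ e).
  by rewrite (le_trans (ler_normB _ _))// !ger0_norm.
rewrite /dsum isumD isum_const -/(dsum _ _ f).
rewrite [X in _ <= 2 * X * _](_ : _ = dsum j (cell j n) f / (2 ^ j)%:R)//.
rewrite /cavg; have := p2_gt0 (R := R) j; move: (dsum _ _ _) (_ %:R) => x y y0.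
by rewrite le_eqVlt; apply/orP; left; apply/eqP; field; rewrite gt_eqF.
Qed.

Lemma energy_udiff_st j n : ~~ ns j n -> energy j (udiff j) n = energy j (badpart j) n.
Proof.
move=> h; rewrite /energy /cavg; congr ((_ / _) ^+ 2); apply: eq_dsum => m e.
by rewrite /udiff /incr (ns_cell e) (negbTE h) add0r.
Qed.

Lemma energy_udiff_ns j n : ns j n -> energy j (udiff j) n = energy j (incr j) n.
Proof.
move=> h; rewrite /energy /cavg; congr ((_ / _) ^+ 2); apply: eq_dsum => m e.
rewrite /udiff /badpart (_ : st j m = false) ?addr0//.
by apply/negbTE/negP => /st_ns; rewrite (ns_cell e) h.
Qed.

Definition cellavg k c : R := dsum k c f / (2 ^ k)%:R.

Lemma cellavgS k c : cellavg k.+1 c = (cellavg k (2 * c) + cellavg k (2 * c + 1)) / 2.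
Proof.
rewrite /cellavg dsumS p2S; have := p2_gt0 (R := R) k.
by move: (_ %:R) => y y0; field; rewrite gt_eqF.
Qed.

Lemma cellavg_ge0 k c : 0 <= cellavg k c.
Proof. by rewrite divr_ge0 ?dsum_ge0. Qed.

Lemma dsum_cellavg k c : dsum k c f = (2 ^ k)%:R * cellavg k c.
Proof. by rewrite mulrC divfK// gt_eqF ?p2_gt0. Qed.

Lemma cell_child k c n : cell k.+1 n = c -> cell k n = 2 * c \/ cell k n = 2 * c + 1.
Proof. by rewrite cellS; lia. Qed.

Lemma cell_parent k c n : cell k n = 2 * c \/ cell k n = 2 * c + 1 -> cell k.+1 n = c.
Proof. by rewrite cellS; lia. Qed.

Lemma norm_incr k n : ns k.+1 n ->
  `|incr k.+1 n| = `|cellavg k (2 * cell k.+1 n) - cellavg k (2 * cell k.+1 n + 1)| / 2.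
Proof.
have hn (z z' : R) : z = z' / 2 -> `|z| = `|z'| / 2.
  by move=> ->; rewrite normrM [X in _ * X]ger0_norm.
move=> h; rewrite /incr h /cavg -!/(cellavg _ _) cellavgS.
by have [->|->] := cell_child (erefl (cell k.+1 n)); [|rewrite distrC]; apply: hn; field.
Qed.

Lemma energy_incr k n : ns k.+1 n ->
  energy k.+1 (incr k.+1) n =
    ((cellavg k (2 * cell k.+1 n) - cellavg k (2 * cell k.+1 n + 1)) / 2) ^+ 2.
Proof.
move=> h; rewrite /energy /cavg.
have h' m : cell k.+1 m = cell k.+1 n -> `|incr k.+1 m| =
    `|cellavg k (2 * cell k.+1 n) - cellavg k (2 * cell k.+1 n + 1)| / 2.
  by move=> e; rewrite norm_incr ?(ns_cell e)// e.
rewrite (dsum_cst h') mulrAC mulfV ?mul1r ?gt_eqF ?p2_gt0//.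
by rewrite !expr_div_n real_normK ?num_real.
Qed.

(** A Bellman-type function. By the parallelogram identity it is exactly additive when an unstopped
    cell is halved ([potentialS]), so the energies of all scales are bounded by what the cells at
    the end of the scan hold. *)
Definition potential k c : R :=
  (2 ^ k)%:R * cellavg k c ^+ 2 + \sum_(j < k.+1) dsum k c (energy j (udiff j)).

Lemma dsum_energy_udiff_notns j k c : (j < k <= K)%N -> ~~ ns k (c * pw k) ->
  dsum k c (energy j (udiff j)) = 0.
Proof.
move=> /andP[jk kK] h.
have h' n : cell k n = c -> energy j (udiff j) n = 0.
  move=> e; rewrite /energy /cavg (dsum_cst (x := 0)) ?mulr0 ?mul0r ?expr0n// => m em.
  rewrite udiff_notns ?normr0//; first by lia.
  apply: contra h => /(ns_le jk); rewrite (@ns_cell _ _ (c * pw k))// cell_base -e.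
  exact: cell_eq (ltnW jk) em.
by rewrite (dsum_cst h') mulr0.
Qed.

Lemma potential_ge k c : (2 ^ k)%:R * cellavg k c ^+ 2 <= potential k c.
Proof.
by rewrite lerDl sumr_ge0// => j _; apply: dsum_ge0 => n; exact: energy_ge0.
Qed.

Lemma potentialS k c : (k < K)%N -> ns k.+1 (c * pw k.+1) ->
  potential k.+1 c = potential k (2 * c) + potential k (2 * c + 1).
Proof.
move=> kK h; rewrite /potential big_ord_recr/=.
under eq_bigr do rewrite dsumS.
rewrite big_split/=.
have h' n : cell k.+1 n = c -> energy k.+1 (udiff k.+1) n =
    ((cellavg k (2 * c) - cellavg k (2 * c + 1)) / 2) ^+ 2.
  move=> e; have hn : ns k.+1 n by rewrite (@ns_cell _ _ (c * pw k.+1)) ?e ?cell_base.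
  by rewrite energy_udiff_ns// energy_incr// e.
by rewrite (dsum_cst h') p2S cellavgS; field.
Qed.

(** A stopped child of an unstopped cell has no energy at finer scales, and its average [a] is at
    most [2 * lam]. Its potential is thus at most [2^k (a^2 + 4 a^2) <= 10 lam 2^k a], which is the
    origin of the 10. *)
Lemma potential_le k c : 0 <= lam -> (k <= K)%N -> ns k (c * pw k) ->
  potential k c <= 10 * lam * dsum k c f.
Proof.
move=> lam0; elim: k c => [|k IH] c kK h.
  rewrite /potential big_ord1 expn0 mul1r.
  have h' n : cell 0 n = c -> energy 0 (udiff 0) n = 0.
    move=> e; rewrite energy_udiff_ns; last by rewrite (@ns_cell _ _ (c * pw 0)) ?e ?cell_base.
    by rewrite /energy cavg0 /incr if_same normr0 expr0n.
  rewrite (dsum_cst h') mulr0 addr0.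
  have hl : cellavg 0 c <= lam.
    by move/nsP : h => /(_ 0%N); rewrite /cavg -/(cellavg _ _) cell_base; apply.
  rewrite dsum_cellavg expn0 mul1r expr2 ler_wpM2r ?cellavg_ge0//; lra.
rewrite potentialS// dsumS mulrDr.
have key d : (forall n, cell k n = d -> cell k.+1 n = c) ->
    potential k d <= 10 * lam * dsum k d f.
  move=> hd; have [h'|h'] := boolP (ns k (d * pw k)).
    by apply: IH => //; exact: ltnW.
  rewrite /potential big_ord_recr/= big1 ?add0r; last first.
    by move=> j _; apply: dsum_energy_udiff_notns => //; have := ltn_ord j; lia.
  have hn : ns k.+1 (d * pw k).
    by rewrite (@ns_cell _ _ (c * pw k.+1)) ?cell_base// hd// cell_base.
  have a2 : cellavg k d <= 2 * lam.
    have := cavg_parent k (d * pw k); rewrite {1}/cavg cell_base -/(cellavg _ _) => /le_trans; apply.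
    by rewrite ler_wpM2l//; move/nsP : hn; apply; lia.
  have : dsum k d (energy k (udiff k)) <= (2 ^ k)%:R * (4 * cellavg k d ^+ 2).
    rewrite -(dsum_cst (k := k) (c := d) (F := fun=> 4 * cellavg k d ^+ 2))//.
    apply: le_dsum => n e; rewrite energy_udiff_st.
      apply: le_trans (energy_badpart _ _) _; rewrite [cavg k f n]/cavg e -/(cellavg _ _).
      have : 0 <= 4 * cellavg k d ^+ 2 by rewrite mulr_ge0 ?sqr_ge0.
      by case: (st k n); rewrite ?mul1r ?mul0r.
    by rewrite (@ns_cell _ _ (d * pw k)) ?e ?cell_base.
  have p0 := p2_gt0 (R := R) k.
  rewrite dsum_cellavg; move: (dsum _ _ _) (2 ^ k)%:R (cellavg k d) (cellavg_ge0 k d) a2 p0 => x y z z0 z2 y0 h2.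
  apply: (@le_trans _ _ (y * (5 * z * z))); first by rewrite expr2 in h2 *; lra.
  rewrite [leRHS](_ : _ = y * (5 * (2 * lam) * z)); last by ring.
  by rewrite ler_wpM2l ?(ltW y0)// ler_wpM2r// ler_wpM2l.
by apply: lerD; apply: key => n e; apply: cell_parent; lia.
Qed.

End Stopping.

(** * Jump counting *)

Section GreedyJumps.
Context {R : realType}.
Implicit Types (x : nat -> R) (gd : nat -> bool) (k l s t : nat) (a eps : R).

(* Number of [eps]-jumps met when the levels [k, k-1, ..., 0] are scanned
   greedily with reference value [a], stopping at the first bad level. *)
Fixpoint jumps eps x gd k a : nat :=
  let b := eps < `|x k - a| in
  if gd k then (b + (if k is k'.+1 then jumps eps x gd k' (if b then x k else a) else 0))%N
  else 0.

(** Makes the scan explicit: [r s] is the reference value held after level [s] has been scanned, and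
    [p s] counts the jumps made at the levels from [k0] up to [s - 1]. The reference can change only
    when the count does. *)
Lemma jumps_levels eps x gd k0 k a : 0 <= eps -> (k0 <= k)%N ->
  (forall l, (k0 <= l <= k)%N -> gd l) ->
  exists (p : nat -> nat) (r : nat -> R),
    [/\ forall s t, (k0 <= s <= t)%N -> (t <= k)%N ->
          (p s <= p t)%N /\ (p s = p t -> r s = r t),
        forall s, (k0 <= s <= k)%N -> `|x s - r s| <= eps,
        r k = (if eps < `|x k - a| then x k else a) &
        ((eps < `|x k - a|)%R + p k <= jumps eps x gd k a)%N].
Proof.
move=> e0 /subnKC <-; elim: (k - k0)%N a => [|d IH] a h.
  rewrite addn0 in h *; exists (fun=> 0%N), (fun=> if eps < `|x k0 - a| then x k0 else a).
  split=> //.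
    move=> s hs; have -> : s = k0 by lia.
    by case: ltP => // _; rewrite subrr normr0.
  by rewrite addn0; case: k0 h => [|k0] h /=; rewrite h ?leqnn// leq_addr.
rewrite addnS in h *.
set k1 := (k0 + d)%N in IH h *.
pose a' := if eps < `|x k1.+1 - a| then x k1.+1 else a.
have [|p [r [h1 h2 h3 h4]]] := IH a'.
  by move=> l hl; apply: h; lia.
pose b := eps < `|x k1 - a'|.
exists (fun l => if (l <= k1)%N then p l else (b + p k1)%N),
       (fun l => if (l <= k1)%N then r l else a').
split.
- move=> s t /andP[ks st] tk.
  have [sk|sk] := leqP s k1; last first.
    by have [tk'|_] := leqP t k1; [lia|split].
  have [tk'|tk'] := leqP t k1; first by apply: h1; rewrite ?ks ?st.
  have [p1 p2] := h1 s k1 (introT andP (conj ks sk)) (leqnn _).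
  split; first by apply: leq_trans p1 _; rewrite leq_addl.
  move=> e; have b0 : b = false by case: b e => //; lia.
  rewrite p2; last by lia.
  by rewrite h3 -/b b0.
- move=> s /andP[ks sk]; have [sk'|sk'] := leqP s k1; first by apply: h2; rewrite ks.
  have -> : s = k1.+1 by lia.
  by rewrite /a'; case: ltP => // _; rewrite subrr normr0.
- by rewrite ltnn.
- by rewrite ltnn /= h ?leqnn ?andbT; [rewrite leq_add2l -/a'|rewrite /k1; lia].
Qed.

(** A step longer than [2 * eps] forces the reference values at its two ends to differ, so it uses
    up a jump of the scan; since [s] is monotone, no jump is used twice. *)
Lemma count_jumps eps x gd k0 k a (s : nat -> nat) L : 0 <= eps -> (k0 <= k)%N ->
  (forall l, (k0 <= l <= k)%N -> gd l) ->
  (forall i, (s i <= s i.+1)%N) -> (forall i, (k0 <= s i <= k)%N) ->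
  (\sum_(i < L) (2 * eps < `|x (s i) - x (s i.+1)|)%R <= jumps eps x gd k a)%N.
Proof.
move=> e0 kk hg sm sk.
have [p [r [h1 h2 _ h4]]] := jumps_levels x a e0 kk hg.
apply: leq_trans h4; apply: leq_trans (leq_addl _ _).
apply: (@leq_trans (p (s L))); last first.
  by have /andP[h5 h6] := sk L; have [] := h1 (s L) k (sk L) (leqnn _).
elim: L => [|L IH]; first by rewrite big_ord0.
rewrite big_ord_recr/=.
have /andP[h5 h6] := sk L; have /andP[h7 h8] := sk L.+1.
have [p1 p2] := h1 (s L) (s L.+1) (introT andP (conj h5 (sm L))) h8.
case: (boolP (2 * eps < _)) => hx; last by rewrite addn0 (leq_trans IH).
rewrite addn1; apply: leq_ltn_trans IH _.
rewrite ltn_neqAle p1 andbT; apply/negP => /eqP /p2 e.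
have := h2 _ (sk L); have := h2 _ (sk L.+1); rewrite e => z1 z2.
move: hx; apply/negP; rewrite -leNgt.
apply: le_trans (ler_distD (r (s L.+1)) _ _) _.
by rewrite [X in _ + X]distrC mulr_natl mulr2n lerD.
Qed.

Lemma powR_exprn (y q : R) m : 0 <= y -> (y ^+ m) `^ q = (y `^ q) ^+ m.
Proof. by move=> y0; rewrite -powR_mulrn// powRAC powR_mulrn ?powR_ge0. Qed.

(** A discrete layer-cake formula. In the induction either [d] is below the new remainder, or [d]
    exceeds the threshold of the new level, whose term equals the old remainder. *)
Lemma powR_dyadic_levels (q lam d : R) M : 0 <= q -> 0 <= d <= lam ->
  d `^ q <= \sum_(m < M) (2 * (lam * 2^-1 ^+ m) < d)%R%:R * (4 * (lam * 2^-1 ^+ m)) `^ q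
           + (4 * (lam * 2^-1 ^+ M)) `^ q.
Proof.
move=> q0 /andP[d0 dl]; elim: M => [|M IH].
  rewrite big_ord0 add0r expr0 mulr1 ge0_ler_powR ?nnegrE//; lra.
rewrite big_ord_recr/=.
have s0 : 0 <= \sum_(m < M) (2 * (lam * 2^-1 ^+ m) < d)%R%:R * (4 * (lam * 2^-1 ^+ m)) `^ q.
  by apply: sumr_ge0 => m _; rewrite mulr_ge0 ?powR_ge0.
have e0 : 0 <= lam * 2^-1 ^+ M by rewrite mulr_ge0 ?exprn_ge0//; lra.
have [h|h] := lerP d (4 * (lam * 2^-1 ^+ M.+1)).
  rewrite -[leLHS]add0r lerD//; first by rewrite addr_ge0// mulr_ge0 ?powR_ge0.
  by rewrite ge0_ler_powR ?nnegrE//; lra.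
have -> : 2 * (lam * 2^-1 ^+ M) < d by move: h; rewrite exprS; lra.
rewrite mul1r; apply: le_trans IH _.
by rewrite -addrA lerD2l lerDl powR_ge0.
Qed.

Lemma geometric_sum_le (r : R) M : 0 <= r < 1 -> \sum_(m < M) r ^+ m <= (1 - r)^-1.
Proof.
move=> /andP[r0 r1]; rewrite -[leRHS]mul1r ler_pdivlMr ?subr_gt0//.
rewrite mulrC -opprB mulNr -subrX1 opprB; have := exprn_ge0 M r0; lra.
Qed.

Lemma jumps_sum_powR (q lam : R) x gd k0 k (s : nat -> nat) L M : 0 <= q -> 0 <= lam ->
  (k0 <= k)%N -> (forall l, (k0 <= l <= k)%N -> gd l) ->
  (forall l, (k0 <= l <= k)%N -> 0 <= x l <= lam) ->
  (forall i, (s i <= s i.+1)%N) -> (forall i, (k0 <= s i <= k)%N) ->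
  \sum_(i < L) `|x (s i) - x (s i.+1)| `^ q <=
   \sum_(m < M) (4 * (lam * 2^-1 ^+ m)) `^ q * (jumps (lam * 2^-1 ^+ m) x gd k 0)%:R
   + L%:R * (4 * (lam * 2^-1 ^+ M)) `^ q.
Proof.
move=> q0 l0 kk hg hx sm sk.
apply: (@le_trans _ _ (\sum_(i < L) (\sum_(m < M) (2 * (lam * 2^-1 ^+ m) < `|x (s i) - x (s i.+1)|)%R%:R
   * (4 * (lam * 2^-1 ^+ m)) `^ q + (4 * (lam * 2^-1 ^+ M)) `^ q))).
  apply: ler_sum => i _; apply: powR_dyadic_levels => //.
  rewrite normr_ge0/=; have := hx _ (sk i); have := hx _ (sk i.+1).
  by rewrite ler_norml; lra.
rewrite big_split/= sumr_const card_ord -[X in _ + X <= _]mulr_natl lerD2r.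
rewrite exchange_big/=; apply: ler_sum => m _.
rewrite -mulr_suml mulrC ler_wpM2l ?powR_ge0//.
rewrite -natr_sum ler_nat; apply: count_jumps sm sk => //.
by rewrite mulr_ge0// exprn_ge0// invr_ge0.
Qed.

End GreedyJumps.

Section JumpEnergy.
Context {R : realType}.
Variables (K : nat) (f g : int -> R) (lam mu : R) (gd : nat -> int -> bool).
Hypothesis f0 : forall n, 0 <= f n.
Hypothesis g0 : forall n, 0 <= g n.
Hypothesis gd_cell : forall k n m, cell k n = cell k m -> gd k n = gd k m.
Hypothesis gd_ns : forall k n, (k <= K)%N -> gd k n -> ns K f lam k n.
Hypothesis gd_g : forall k n, (k <= K)%N -> gd k n -> cavg k g n <= mu.
Hypothesis lam0 : 0 < lam.
Hypothesis mu0 : 0 <= mu.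

(* Each jump of the greedy scan resets the reference value [a]; the right-hand side
   is, up to the factor [mu], the [L^2] distance to [a] plus the energy still
   available in the cell, and pays [eps ^+ 2] for the jump. *)
Lemma jump_energy eps k c a : 0 <= eps -> (k <= K)%N ->
  eps ^+ 2 * dsum k c (fun n => g n * (jumps eps (fun l => cavg l f n) (gd^~ n) k a)%:R)
   <= mu * (potential K f lam k c - 2 * a * dsum k c f + (2 ^ k)%:R * a ^+ 2).
Proof.
move=> e0; elim: k c a => [|k IH] c a kK.
  have [gc|gc] := boolP (gd 0 c); last first.
    rewrite dsum0 /= (negbTE gc) mulr0 mulr0 mulr_ge0//.
    have := potential_ge K f lam 0 c; rewrite dsum_cellavg expn0 !mul1r => h.
    have := sqr_ge0 (cellavg f 0 c - a); rewrite sqrrB; move: h; lra.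
  rewrite dsum0 /= gc addn0.
  have gm : g c <= mu by have := gd_g kK gc; rewrite cavg0.
  have ca : cavg 0 f c = cellavg f 0 c by rewrite cavg0 /cellavg dsum0 expn0 divr1.
  rewrite ca dsum_cellavg expn0 !mul1r.
  have pc := potential_ge K f lam 0 c; rewrite expn0 mul1r in pc.
  apply: (@le_trans _ _ (mu * (cellavg f 0 c - a) ^+ 2)); last first.
    by rewrite ler_wpM2l// sqrrB; move: pc; lra.
  case: ltP => he; last by rewrite !mulr0 mulr_ge0 ?sqr_ge0.
  rewrite mulr1 mulrC ler_pM// ?sqr_ge0//.
  by rewrite -(real_normK (num_real (_ - _))) lerXn2r ?nnegrE// ltW.
have p0 := p2_gt0 (R := R) k.+1.
have [gc|gc] := boolP (gd k.+1 (c * pw k.+1)); last first.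
  rewrite (dsum_cst (x := 0)) ?mulr0; last first.
    move=> n e /=; rewrite (@gd_cell _ _ (c * pw k.+1)) ?(negbTE gc) ?mulr0//.
    by rewrite cell_base.
  rewrite mulr_ge0//.
  have := potential_ge K f lam k.+1 c; rewrite dsum_cellavg => h.
  have : 0 <= (2 ^ k.+1)%:R * (cellavg f k.+1 c - a) ^+ 2 by rewrite mulr_ge0 ?sqr_ge0.
  by rewrite sqrrB; move: h; lra.
have cx n : cell k.+1 n = c -> cavg k.+1 f n = cellavg f k.+1 c by move=> <-.
have cg n : cell k.+1 n = c -> gd k.+1 n.
  by move=> e; rewrite (@gd_cell _ _ (c * pw k.+1)) ?cell_base.
set x := cellavg f k.+1 c in cx *.
pose b : bool := eps < `|x - a|; pose a' := if b then x else a.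
have hn : ns K f lam k.+1 (c * pw k.+1) by exact: gd_ns.
rewrite (@eq_dsum _ _ _ _ (fun n => b%:R * g n +
    g n * (jumps eps (fun l => cavg l f n) (gd^~ n) k a')%:R)); last first.
  by move=> n e /=; rewrite cg// cx// -/b -/a' natrD mulrDr [b%:R * _]mulrC.
rewrite /dsum isumD isumZ -!/(dsum _ _ _) mulrDr.
have IH' : eps ^+ 2 * dsum k.+1 c (fun n => g n * (jumps eps (fun l => cavg l f n) (gd^~ n) k a')%:R)
    <= mu * (potential K f lam k.+1 c - 2 * a' * dsum k.+1 c f + (2 ^ k.+1)%:R * a' ^+ 2).
  have h1 := IH (2 * c) a' (ltnW kK); have h2 := IH (2 * c + 1) a' (ltnW kK).
  rewrite [dsum k.+1 c (fun n => _)]dsumS mulrDr (le_trans (lerD h1 h2))//.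
  by rewrite potentialS// dsumS p2S le_eqVlt; apply/orP; left; apply/eqP; ring.
apply: le_trans (lerD (lexx _) IH') _.
rewrite /a'; case: (boolP b) => hb; last by rewrite mul0r mulr0 add0r.
have dg : dsum k.+1 c g <= mu * (2 ^ k.+1)%:R.
  have := gd_g kK gc; rewrite /cavg cell_base ler_pdivrMr//.
have h3 : eps ^+ 2 <= (x - a) ^+ 2.
  by rewrite -(real_normK (num_real (_ - _))) lerXn2r ?nnegrE// ltW.
rewrite mul1r (dsum_cellavg f) -/x.
(* Resetting the reference from [a] to [x] lowers the quadratic form by exactly [2^(k+1) (x - a)^2],
   and the mass of [g] in the cell is at most [mu * 2^(k+1)]. *)
apply: (@le_trans _ _ ((x - a) ^+ 2 * (mu * (2 ^ k.+1)%:R) +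
  mu * (potential K f lam k.+1 c - 2 * x * ((2 ^ k.+1)%:R * x) + (2 ^ k.+1)%:R * x ^+ 2))).
  by rewrite lerD2r ler_pM ?sqr_ge0 ?dsum_ge0.
by rewrite le_eqVlt; apply/orP; left; apply/eqP; ring.
Qed.

Lemma long_variation (q : R) (s : int -> nat -> nat) (kap : int -> nat) L c :
  2 < q ->
  (forall n, (kap n <= K)%N) ->
  (forall n l, cell K n = c -> (kap n <= l <= K)%N -> gd l n) ->
  (forall n i, (s n i <= s n i.+1)%N) -> (forall n i, (kap n <= s n i <= K)%N) ->
  dsum K c g <= mu * (2 ^ K)%:R ->
  dsum K c (fun n => g n * \sum_(i < L) `|cavg (s n i) f n - cavg (s n i.+1) f n| `^ q)
    <= (4 `^ q * 10 / (1 - 4 * 2^-1 `^ q) + 1) * (lam `^ q * mu * (2 ^ K)%:R).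
Proof.
move=> q2 hk hg sm sk dg.
have q0 : 0 < q by lra.
have p0 := p2_gt0 (R := R) K.
have l0 : 0 <= lam by exact: ltW.
have [cex|cnex] := boolP (gd K (c * pw K)); last first.
  exfalso; move: cnex; apply/negP; rewrite negbK; apply: hg; rewrite ?cell_base//.
  by rewrite hk leqnn.
have hn : ns K f lam K (c * pw K) by exact: gd_ns.
have df : dsum K c f <= lam * (2 ^ K)%:R.
  by move/nsP : hn => /(_ K); rewrite leqnn /cavg cell_base ler_pdivrMr//; apply.
(* The count of jumps of size [lam * 2^-m] is bounded by a multiple of [4^m], and each contributes a
   multiple of [2^(-q m)]; the series converges exactly for [q > 2]. *)
have zq : 4 * 2^-1 `^ q < 1 :> R.
  have -> : 2^-1 `^ q = 2^-1 `^ (q - 2) * 2^-1 ^+ 2 :> R.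
    by rewrite -powR_mulrn ?invr_ge0// -powRD ?subrK// implybE; apply/orP; right; rewrite invr_neq0.
  have : 2^-1 `^ (q - 2) < 1 :> R.
    have : 2^-1 `^ (q - 2) < 1 `^ (q - 2) :> R.
      by apply: gt0_ltr_powR; rewrite ?subr_gt0 ?nnegrE ?invr_ge0//; lra.
    by rewrite powR1.
  by rewrite expr2; lra.
have z0 : 0 <= 4 * 2^-1 `^ q :> R by rewrite mulr_ge0 ?powR_ge0.
(* [M] only has to make the remainder of [powR_dyadic_levels], summed over the [L] steps, at most
   the [q]-th power of [lam]; it does not enter the final constant. *)
have [M hM] : exists M, L%:R * (4 * 2^-1 ^+ M) `^ q <= 1 :> R.
  exists (L * 4)%N.
  have h4 : (L * 4)%:R * 2^-1 ^+ (L * 4) <= 1 :> R.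
    rewrite exprVn ler_pdivrMr ?exprn_gt0// mul1r -natrX ler_nat.
    by apply: ltnW; apply: ltn_expl.
  case: L h4 {sm sk} => [|L'] h4; first by rewrite mul0r.
  have y1 : 4 * 2^-1 ^+ (L'.+1 * 4) <= L'.+1%:R^-1 :> R.
    rewrite -[leRHS]mul1r ler_pdivlMr ?ltr0n// mulrC mulrA -natrM//.
  have y0 : 0 < 4 * 2^-1 ^+ (L'.+1 * 4) :> R by rewrite mulr_gt0 ?exprn_gt0 ?invr_gt0.
  rewrite -ler_pdivlMl ?ltr0n// mulr1; apply: le_trans y1.
  apply: ge1r_powR; last by lra.
  rewrite y0/=; apply: le_trans h4; rewrite ler_wpM2r ?exprn_ge0 ?invr_ge0//.
  by rewrite ler_nat leq_pmull.
pose J m n : R := (jumps (lam * 2^-1 ^+ m) (fun l => cavg l f n) (gd^~ n) K 0)%:R.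
have e4 m : (4 * (lam * 2^-1 ^+ m)) `^ q = 4 `^ q * lam `^ q * (2^-1 `^ q) ^+ m :> R.
  rewrite powRM ?mulr_ge0 ?exprn_ge0 ?invr_ge0// powRM ?exprn_ge0 ?invr_ge0//.
  by rewrite powR_exprn ?invr_ge0// mulrA.
have hJ m : dsum K c (fun n => g n * J m n) <= 10 * mu * (2 ^ K)%:R * 4 ^+ m.
  have em0 : 0 <= lam * 2^-1 ^+ m by rewrite mulr_ge0 ?exprn_ge0 ?invr_ge0.
  have := @jump_energy (lam * 2^-1 ^+ m) K c 0 em0 (leqnn K).
  rewrite -/(J m _) mulr0 mul0r subr0 expr0n mulr0 addr0 => h.
  have pl := potential_le f0 l0 (leqnn K) hn.
  have : (lam * 2^-1 ^+ m) ^+ 2 * dsum K c (fun n => g n * J m n)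
      <= mu * (10 * lam * (lam * (2 ^ K)%:R)).
    apply: le_trans h _; rewrite ler_wpM2l// (le_trans pl)// ler_wpM2l// mulr_ge0//.
  rewrite exprMn -exprM mulnC exprM.
  have -> : (2^-1 ^+ 2 : R) = 4^-1 by rewrite exprVn; congr (_^-1); ring.
  rewrite exprVn; move: (dsum _ _ _) (p2_gt0 (R := R) K) => D; move: (2 ^ K)%:R => P P0 h'.
  have m0 : 0 < 4 ^+ m :> R by rewrite exprn_gt0.
  rewrite -ler_pdivrMr//.
  rewrite -(ler_pM2l (_ : 0 < lam ^+ 2)) ?exprn_gt0//.
  rewrite (_ : lam ^+ 2 * _ = lam ^+ 2 * (4 ^+ m)^-1 * D); last by ring.
  by apply: le_trans h' _; rewrite le_eqVlt; apply/orP; left; apply/eqP; ring.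
apply: (@le_trans _ _ (dsum K c (fun n => \sum_(m < M) (4 * (lam * 2^-1 ^+ m)) `^ q * (g n * J m n)
    + L%:R * (4 * (lam * 2^-1 ^+ M)) `^ q * g n))).
  apply: le_dsum => n e.
  apply: (@le_trans _ _ (g n * (\sum_(m < M) (4 * (lam * 2^-1 ^+ m)) `^ q * J m n
    + L%:R * (4 * (lam * 2^-1 ^+ M)) `^ q))).
    rewrite ler_wpM2l//; apply: (jumps_sum_powR (x := fun l => cavg l f n) (k0 := kap n)) => //.
      exact: ltW.
      by move=> l hl; apply: hg.
    move=> l hl; apply/andP; split; first exact: cavg_ge0.
    have /andP[_ lK] := hl; have /(gd_ns lK)/nsP h := hg n l e hl.
    by apply: h; rewrite leqnn.
  rewrite mulrDr mulr_sumr [g n * (_ * _)]mulrC lerD2r.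
  by apply: ler_sum => m _; rewrite mulrCA.
rewrite /dsum isumD isum_sum isumZ -!/(dsum _ _ _).
rewrite [leRHS]mulrDl mul1r lerD//; last first.
  rewrite e4.
  have -> : L%:R * (4 `^ q * lam `^ q * (2^-1 `^ q) ^+ M) = (L%:R * (4 * 2^-1 ^+ M) `^ q) * lam `^ q.
    by rewrite powRM ?exprn_ge0 ?invr_ge0// powR_exprn ?invr_ge0//; ring.
  rewrite -mulrA -[leRHS]mul1r -[lam `^ q * mu * _]mulrA.
  rewrite ler_pM ?mulr_ge0 ?powR_ge0 ?dsum_ge0//.
  by rewrite ler_wpM2l ?powR_ge0.
set r := 4 * 2^-1 `^ q in zq z0 *.
apply: (@le_trans _ _ (\sum_(m < M) 4 `^ q * lam `^ q * 10 * mu * (2 ^ K)%:R * r ^+ m)).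
  apply: ler_sum => m _; rewrite -/(dsum _ _ _) /dsum isumZ -/(dsum _ _ _) e4.
  apply: (@le_trans _ _ (4 `^ q * lam `^ q * (2^-1 `^ q) ^+ m * (10 * mu * (2 ^ K)%:R * 4 ^+ m))).
    by rewrite ler_wpM2l// !mulr_ge0 ?powR_ge0 ?exprn_ge0 ?powR_ge0.
  rewrite /r exprMn; move: (4 `^ q) (2^-1 `^ q) => x y.
  by rewrite le_eqVlt; apply/orP; left; apply/eqP; ring.
rewrite -mulr_sumr.
have := geometric_sum_le M (introT andP (conj z0 zq)); move: (\sum_(m < M) _) => S hS.
rewrite [leRHS](_ : _ = 4 `^ q * lam `^ q * 10 * mu * (2 ^ K)%:R * (1 - r)^-1); last by ring.
by rewrite ler_wpM2l// !mulr_ge0 ?powR_ge0.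
Qed.

End JumpEnergy.

(** * Oscillation between adjacent cells *)

Section NeighbourDifferences.
Context {R : realType}.
Variables (K : nat) (f : int -> R) (lam : R).
Hypothesis f0 : forall n, 0 <= f n.
Implicit Types (n m c : int) (j k l : nat).

Local Notation ns := (ns K f lam).
Local Notation incr := (incr K f lam).
Local Notation udiff := (udiff K f lam).

Lemma energy_incr_le j n : energy j (incr j) n <= energy j (udiff j) n.
Proof.
have [h|h] := boolP (ns j n); first by rewrite energy_udiff_ns.
rewrite [leLHS]/energy /cavg (dsum_cst (x := 0)) ?mulr0 ?mul0r ?expr0n ?energy_ge0//.
by move=> m e; rewrite /incr (ns_cell _ _ _ e) (negbTE h) normr0.
Qed.

(** The stopped martingale. It agrees with the average of [f] on unstopped cells and remains defined
    past the stopping scale, so adjacent cells can be compared everywhere. *)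
Definition stopped k n : R := cavg K f n + \sum_(k.+1 <= j < K.+1) incr j n.

Lemma stoppedS k n : (k < K)%N -> stopped k n = stopped k.+1 n + incr k.+1 n.
Proof. by move=> kK; rewrite /stopped big_ltn// -addrA [_ + incr _ _]addrC. Qed.

Lemma stoppedK n : stopped K n = cavg K f n.
Proof. by rewrite /stopped big_geq ?addr0. Qed.

Lemma stopped_ns k n : (k <= K)%N -> ns k n -> stopped k n = cavg k f n.
Proof.
move=> /subKn <-; elim: (K - k)%N => [|d IH]; first by rewrite subn0 stoppedK.
have [dK|dK] := ltnP d K; last first.
  by move: IH; rewrite (_ : K - d = K - d.+1)%N//; lia.
move=> h; have e : (K - d = (K - d.+1).+1)%N by lia.
have h' : ns (K - d.+1).+1 n by apply: ns_le h.
have -> : stopped (K - d.+1) n = stopped (K - d) n + incr (K - d.+1).+1 n.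
  by rewrite stoppedS -?e//; lia.
rewrite IH ?e// /incr h'; ring.
Qed.

Lemma cell_add_pw k n : cell k (n + pw k) = cell k n + 1.
Proof. by rewrite -[pw k]mul1r cell_shift. Qed.

(** A Haar coefficient of the stopped martingale: the increment takes this value on the left child
    and the opposite value on the right child. *)
Definition halfdiff k c : R :=
  if ns k.+1 (c * pw k.+1) then (cellavg f k (2 * c) - cellavg f k (2 * c + 1)) / 2 else 0.

Lemma incr_left k c n : cell k n = 2 * c -> incr k.+1 n = halfdiff k c.
Proof.
move=> e; have e' : cell k.+1 n = c by apply: cell_parent; left.
rewrite /incr /halfdiff (@ns_cell _ _ _ _ k.+1 n (c * pw k.+1)) ?cell_base//.
by case: ifP => // _; rewrite /cavg e e' -!/(cellavg _ _ _) cellavgS; field.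
Qed.

Lemma incr_right k c n : cell k n = 2 * c + 1 -> incr k.+1 n = - halfdiff k c.
Proof.
move=> e; have e' : cell k.+1 n = c by apply: cell_parent; right.
rewrite /incr /halfdiff (@ns_cell _ _ _ _ k.+1 n (c * pw k.+1)) ?cell_base//.
by case: ifP => // _; rewrite ?oppr0// /cavg e e' -!/(cellavg _ _ _) cellavgS; field.
Qed.

Lemma energy_halfdiff k c n : cell k.+1 n = c -> energy k.+1 (incr k.+1) n = halfdiff k c ^+ 2.
Proof.
move=> e; have [h|h] := boolP (ns k.+1 n).
  rewrite energy_incr// e /halfdiff.
  by rewrite (@ns_cell _ _ _ _ k.+1 (c * pw k.+1) n) ?cell_base// h.
rewrite /halfdiff (@ns_cell _ _ _ _ k.+1 (c * pw k.+1) n) ?cell_base// (negbTE h) expr0n.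
rewrite /energy /cavg (dsum_cst (x := 0)) ?mulr0 ?mul0r ?expr0n//.
by move=> m em; rewrite /incr (ns_cell _ _ _ em) (negbTE h) normr0.
Qed.

Lemma incr_cell k n m : cell k n = cell k m -> incr k.+1 n = incr k.+1 m.
Proof.
move=> e; have [h|h] := cell_child (erefl (cell k.+1 n)).
  by rewrite (incr_left h) (@incr_left _ (cell k.+1 n))// -e.
by rewrite (incr_right h) (@incr_right _ (cell k.+1 n))// -e.
Qed.

Lemma stopped_cell k n m : (k <= K)%N -> cell k n = cell k m -> stopped k n = stopped k m.
Proof.
move=> /subKn <-; elim: (K - k)%N => [|d IH] e.
  by rewrite subn0 in e *; rewrite !stoppedK (cavg_cell _ e).
have [dK|dK] := ltnP d K; last first.
  by move: IH e; rewrite (_ : K - d = K - d.+1)%N//; lia.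
have ed : (K - d = (K - d.+1).+1)%N by lia.
have eS x : stopped (K - d.+1) x = stopped (K - d) x + incr (K - d.+1).+1 x.
  by rewrite stoppedS -?ed//; lia.
by rewrite !eS (incr_cell e) IH// ed; apply: cell_eq e.
Qed.

(* The oscillation between adjacent cells, controlled from the top scale down by a
   recursion with ratio [3/4]. *)
Definition gam k n : R := (stopped k (n + pw k) - stopped k n) ^+ 2.

Lemma gam_ge0 k n : 0 <= gam k n.
Proof. exact: sqr_ge0. Qed.

Lemma gam_cell k n m : (k <= K)%N -> cell k n = cell k m -> gam k n = gam k m.
Proof.
by move=> kK e; rewrite /gam (stopped_cell kK e) (@stopped_cell k (n + pw k) (m + pw k))//;
  rewrite !cell_add_pw e.
Qed.

(** The right neighbour of a left child is its sibling, so only the right half of the cell inherits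
    the oscillation of the coarser scale. With [(a + b)^2 <= 3/2 a^2 + 3 b^2] there, the ratio
    becomes [1/2 * 3/2 = 3/4]. *)
Lemma gam_step_cell k c : (k < K)%N ->
  dsum k.+1 c (gam k) <= dsum k.+1 c (fun n => 3 / 4 * gam k.+1 n
     + (5 * energy k.+1 (incr k.+1) n + 3 * energy k.+1 (incr k.+1) (n + pw k.+1))).
Proof.
move=> kK; set X := stopped k.+1 (c * pw k.+1); set X' := stopped k.+1 ((c + 1) * pw k.+1).
set d := halfdiff k c; set d' := halfdiff k (c + 1).
have hX n : cell k.+1 n = c -> stopped k.+1 n = X.
  by move=> e; apply: stopped_cell => //; rewrite cell_base.
have hX' n : cell k.+1 n = c + 1 -> stopped k.+1 n = X'.
  by move=> e; apply: stopped_cell => //; rewrite cell_base.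
have eS x : stopped k x = stopped k.+1 x + incr k.+1 x by exact: stoppedS.
have hl n : cell k n = 2 * c -> gam k n = (- d - d) ^+ 2.
  move=> e; rewrite /gam !eS hX; last by rewrite (@cell_parent _ c)// cell_add_pw e; right.
  rewrite hX; last by rewrite (@cell_parent _ c)// e; left.
  rewrite (@incr_right k c (n + pw k)) ?cell_add_pw ?e// (incr_left e) -/d; congr (_ ^+ 2); ring.
have hr n : cell k n = 2 * c + 1 -> gam k n = (X' + d' - (X - d)) ^+ 2.
  move=> e; have e1 : cell k (n + pw k) = 2 * (c + 1) by rewrite cell_add_pw e; ring.
  rewrite /gam !eS hX'; last by rewrite (@cell_parent _ (c + 1))//; left.
  rewrite hX; last by rewrite (@cell_parent _ c)// e; right.
  by rewrite (incr_left e1) (incr_right e).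
rewrite dsumS (dsum_cst hl) (dsum_cst hr).
rewrite (@dsum_cst _ _ _ _ (3 / 4 * (X' - X) ^+ 2 + (5 * d ^+ 2 + 3 * d' ^+ 2))); last first.
  move=> n e; rewrite (energy_halfdiff e) (@energy_halfdiff k (c + 1)) ?cell_add_pw ?e//.
  by rewrite /gam (hX' (n + pw k.+1)) ?(hX n e)// cell_add_pw e.
rewrite p2S -mulrDr.
rewrite [leRHS](_ : _ = (2 ^ k)%:R * (2 * (3 / 4 * (X' - X) ^+ 2
  + (5 * d ^+ 2 + 3 * d' ^+ 2)))); last by ring.
rewrite ler_wpM2l//.
move: (X) (X') (d) (d') => x x' y y'.
have := sqr_ge0 ((x' - x) - 2 * (y + y')); have := sqr_ge0 (y - y').
rewrite !expr2; lra.
Qed.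

Lemma le_dsum_shift k c F : (k <= K)%N -> (forall n, 0 <= F n) ->
  dsum K c (fun n => F (n + pw k)) <= dsum K c F + dsum K (c + 1) F :> R.
Proof.
move=> kK F0; rewrite /dsum isum_shift mulrDl mul1r -isum_cat.
have := ler_pw kK; have := pw_gt0 k; rewrite /pw => *.
by apply: isum_sub => //; lia.
Qed.

Lemma geometric_recursion (G e : nat -> R) M : 0 <= G 0%N ->
  (forall k, (k < M)%N -> G k <= 3 / 4 * G k.+1 + 8 * e k.+1) ->
  \sum_(k < M.+1) G k <= 4 * G M + 32 * \sum_(k < M) e k.+1.
Proof.
move=> G0; elim: M => [|M IH] h; first by rewrite big_ord1 big_ord0; lra.
rewrite big_ord_recr/= [in leRHS]big_ord_recr/=.
have h1 := h M (leqnn _); have := IH (fun k kM => h k (ltnW kM)).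
lra.
Qed.

Lemma sum_energy_le c : 0 <= lam -> ns K (c * pw K) ->
  \sum_(j < K.+1) dsum K c (energy j (udiff j)) <= 10 * lam * dsum K c f.
Proof.
move=> l0 h; apply: le_trans (potential_le f0 l0 (leqnn K) h).
by rewrite lerDr mulr_ge0 ?sqr_ge0.
Qed.

(** [644 = 4 + 32 * 20]: the top oscillation is at most [lam^2 2^K], and the energies over the two
    adjacent cells add up to at most [20 lam^2 2^K]. *)
Lemma sum_gam_le c : 0 <= lam -> ns K (c * pw K) -> ns K ((c + 1) * pw K) ->
  \sum_(k < K.+1) dsum K c (gam k) <= 644 * (lam ^+ 2 * (2 ^ K)%:R).
Proof.
move=> l0 h1 h2.
have a1 : cellavg f K c <= lam.
  by move/nsP : h1 => /(_ K); rewrite leqnn /cavg cell_base; apply.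
have a2 : cellavg f K (c + 1) <= lam.
  by move/nsP : h2 => /(_ K); rewrite leqnn /cavg cell_base; apply.
pose e j := dsum K c (energy j (incr j)) + dsum K (c + 1) (energy j (incr j)).
apply: le_trans (@geometric_recursion (fun k => dsum K c (gam k)) e K _ _) _.
- by apply: dsum_ge0 => n; exact: gam_ge0.
- move=> k kK; apply: le_trans (le_dsum_cells c kK (fun d => gam_step_cell d kK)) _.
  rewrite /dsum !isumD !isumZ -!/(dsum _ _ _) lerD2l.
  have := @le_dsum_shift k.+1 c (energy k.+1 (incr k.+1)) kK (fun n => energy_ge0 _ _ _).
  have := @dsum_ge0 R K (c + 1) (energy k.+1 (incr k.+1)) (fun n => energy_ge0 _ _ _).
  by rewrite /e; lra.
have -> : dsum K c (gam K) = (2 ^ K)%:R * (cellavg f K (c + 1) - cellavg f K c) ^+ 2.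
  apply: dsum_cst => n en; rewrite /gam !stoppedK /cavg cell_add_pw en//.
have he : \sum_(k < K) e k.+1 <= 10 * lam * dsum K c f + 10 * lam * dsum K (c + 1) f.
  apply: le_trans (lerD (sum_energy_le l0 h1) (sum_energy_le l0 h2)).
  rewrite !big_ord_recl /e big_split/=; apply: lerD; rewrite -[leLHS]add0r; apply: lerD;
   try (by apply: dsum_ge0 => n; exact: energy_ge0);
   by apply: ler_sum => j _; apply: le_dsum => n _; exact: energy_incr_le.
have hg : (cellavg f K (c + 1) - cellavg f K c) ^+ 2 <= lam ^+ 2.
  rewrite -(real_normK (num_real (_ - _))) lerXn2r ?nnegrE// ler_norml.
  by have := cellavg_ge0 f0 K c; have := cellavg_ge0 f0 K (c + 1); lra.
rewrite !dsum_cellavg in he; have p0 := p2_gt0 (R := R) K.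
move: (2 ^ K)%:R (cellavg f K c) (cellavg f K (c + 1)) p0 a1 a2 he hg => P x y p0 a1 a2 he hg.
have b1 : 10 * lam * (P * x) <= 10 * lam * (P * lam).
  by rewrite ler_wpM2l ?mulr_ge0// ler_wpM2l// ltW.
have b2 : 10 * lam * (P * y) <= 10 * lam * (P * lam).
  by rewrite ler_wpM2l ?mulr_ge0// ler_wpM2l// ltW.
have b3 : P * (y - x) ^+ 2 <= P * lam ^+ 2 by rewrite ler_wpM2l// ltW.
move: he b1 b2 b3; rewrite !expr2; lra.
Qed.

End NeighbourDifferences.

(** * Good scales and the assignment of radii to scales *)

Definition shifts5 : seq int := [:: -2; -1; 0; 1; 2].
Definition shifts4 : seq int := [:: -2; -1; 0; 1].

Section FiveGood.
Context {R : realType}.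
Implicit Types (f F : int -> R) (b : R) (n m c i : int) (j k l K : nat).

Lemma shifts5P i : (i \in shifts5) = (-2 <= i <= 2).
Proof. by rewrite !inE; lia. Qed.

Lemma shifts4P i : (i \in shifts4) = (-2 <= i <= 1).
Proof. by rewrite !inE; lia. Qed.

Definition good K F b k n : bool :=
  [forall l : 'I_K.+1, (k <= l)%N ==> all (fun i => cavg l F (n + i * pw l) <= b) shifts5].

Lemma goodP K F b k n : reflect
  (forall l i, (k <= l <= K)%N -> -2 <= i <= 2 -> cavg l F (n + i * pw l) <= b)
  (good K F b k n).
Proof.
apply: (iffP forallP) => [h l i /andP[kl lK] hi|h l].
  have /implyP/(_ kl)/allP := h (Ordinal (lK : (l < K.+1)%N)); apply.
  by rewrite shifts5P.
apply/implyP => kl; apply/allP => i; rewrite shifts5P => hi.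
by apply: h; rewrite ?kl -1?ltnS ?ltn_ord.
Qed.

Lemma good_le K F b k l n : (k <= l)%N -> good K F b k n -> good K F b l n.
Proof. by move=> kl /goodP h; apply/goodP => i j hi hj; apply: h => //; lia. Qed.

Lemma good_cell K F b k n m : cell k n = cell k m -> good K F b k n = good K F b k m.
Proof.
move=> e; have e' l i : (k <= l)%N -> cell l (n + i * pw l) = cell l (m + i * pw l).
  by move=> kl; rewrite !cell_shift (cell_eq kl e).
apply/goodP/goodP => h l i lK hi; have /andP[kl _] := lK; have := h l i lK hi.
  by rewrite (cavg_cell _ (e' l i kl)).
by rewrite (cavg_cell _ (e' l i kl)).
Qed.

Lemma cell_near k l n m : (k <= l)%N -> -2 <= cell k m - cell k n <= 2 ->
  -2 <= cell l m - cell l n <= 2.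
Proof.
move=> /subnKC <-; rewrite !cell_cell; move: (cell k m) (cell k n) => x y h.
have := cell_bounds (l - k) x; have := cell_bounds (l - k) y; have := pw_gt0 (l - k).
by move: (pw _) (cell _ x) (cell _ y) => p u v *; nia.
Qed.

(** Cells at distance at most 2 stay at distance at most 2 on coarser scales, so every coarser cell
    around [m] is among the five controlled around [n]. *)
Lemma good_ns K F b k n m : good K F b k n -> -2 <= cell k m - cell k n <= 2 ->
  ns K F b k m.
Proof.
move=> /goodP h hm; apply/nsP => l lK; have /andP[kl _] := lK.
have := h l (cell l m - cell l n) lK (cell_near kl hm).
by rewrite (@cavg_cell _ l F _ m)// cell_shift addrC subrK.
Qed.

Lemma w5_cavg k n F :
  (2 ^ k)%:R^-1 * w5 k (cell k n) F = \sum_(i <- shifts5) cavg k F (n + i * pw k).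
Proof.
rewrite w5E !mulrDr !big_cons big_nil addr0 /cavg !cell_shift !(mulrC _^-1) addr0.
by rewrite !addrA.
Qed.

(* The averages of radius [N] are assigned to the scale [k] with
   [2 ^ k <= N + 1 < 2 ^ k.+1], truncated at [K]; the radii of scale [k] form the
   interval [[blo k, bhi K k]]. *)
Definition lev K N : nat := minn K (trunc_log 2 N.+1).
Definition blo k : nat := (2 ^ k).-1.
Definition bhi K k : nat := if k == K then (2 ^ K.+1).-1 else (2 ^ k.+1).-2.

(** The top block also keeps the radius [2^(K+1) - 1], at which [cutvar] truncates and to which the
    logarithm alone would assign the scale [K + 1]. *)
Lemma lev_block K N k : (k <= K)%N -> (N < 2 ^ K.+1)%N ->
  (blo k <= N <= bhi K k)%N = (lev K N == k).
Proof.
move=> kK hN; rewrite /lev /blo /bhi.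
have /andP[h1 h2] := @trunc_log_bounds 2 N.+1 isT isT.
move: (trunc_log 2 N.+1) h1 h2 => T h1 h2.
have e0 : (0 < 2 ^ k)%N by rewrite expn_gt0.
have e1 := expnS 2 k.
have eK := expnS 2 K; have eT := expnS 2 T.
have mono (x y : nat) : (x <= y)%N -> (2 ^ x <= 2 ^ y)%N by move=> xy; rewrite leq_exp2l.
have [ekK|nkK] := eqVneq k K.
  subst k; apply/idP/idP.
    move=> h; have KT : (K <= T)%N.
      by rewrite leqNgt; apply/negP => /mono; lia.
    by rewrite (minn_idPl KT).
  move=> /eqP h; have /mono : (K <= T)%N by lia.
  by lia.
apply/idP/idP => h.
  have kT : (k <= T)%N by rewrite leqNgt; apply/negP => /mono; lia.
  have Tk : (T <= k)%N by rewrite leqNgt; apply/negP => /mono; lia.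
  by apply/eqP; lia.
have e : T = k by move/eqP: h; lia.
by subst T; lia.
Qed.

Lemma blo_bhi K k : (k <= K)%N -> (blo k <= bhi K k)%N.
Proof.
rewrite /blo /bhi => kK; have : (0 < 2 ^ k)%N by rewrite expn_gt0.
have := expnS 2 K; have := expnS 2 k.
by case: eqP => [->|_]; lia.
Qed.

Lemma blo_ge k : (2 ^ k <= (blo k).+1)%N.
Proof. by rewrite /blo prednK ?expn_gt0. Qed.

Lemma bhi_le K k : ((bhi K k).+1 <= 2 ^ k.+1)%N.
Proof.
rewrite /bhi; have : (0 < 2 ^ k)%N by rewrite expn_gt0.
have := expnS 2 K; have := expnS 2 k.
by case: eqP => [->|_]; lia.
Qed.

(** The outer points are reached in two steps, so the sum is at most [p + 2 b + 2 d + q];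
    Cauchy--Schwarz gives [10 = 1 + 4 + 4 + 1]. *)
Lemma sqr_norm_shifts (x : int -> R) c :
  (\sum_(i <- shifts5) `|x (c + i) - x c|) ^+ 2
    <= 10 * \sum_(i <- shifts4) (x (c + i + 1) - x (c + i)) ^+ 2.
Proof.
rewrite !big_cons !big_nil !addr0 subrr normr0 add0r.
have -> : c - 2 + 1 = c - 1 by lia.
have -> : c - 1 + 1 = c by lia.
have -> : c + 1 + 1 = c + 2 by lia.
set a := `|x (c - 2) - x c|; set b := `|x (c - 1) - x c|.
set d := `|x (c + 1) - x c|; set e := `|x (c + 2) - x c|.
pose p := `|x (c - 1) - x (c - 2)|; pose q := `|x (c + 2) - x (c + 1)|.
have ha : a <= p + b by rewrite /a /p (distrC (x (c - 1))) /b ler_distD.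
have he : e <= q + d by rewrite /e /q /d ler_distD.
rewrite -(real_normK (num_real (x (c - 1) - x (c - 2)))) -/p.
rewrite -(real_normK (num_real (x c - x (c - 1)))) (distrC (x c) (x (c - 1))) -/b.
rewrite -(real_normK (num_real (x (c + 1) - x c))) -/d.
rewrite -(real_normK (num_real (x (c + 2) - x (c + 1)))) -/q.
have [a0 b0 d0] : [/\ 0 <= a, 0 <= b & 0 <= d] by split; exact: normr_ge0.
have [e0 p0 q0] : [/\ 0 <= e, 0 <= p & 0 <= q] by split; exact: normr_ge0.
move: a b d e p q a0 b0 d0 e0 p0 q0 ha he => a b d e p q a0 b0 d0 e0 p0 q0 ha he.
apply: (@le_trans _ _ ((p + 2 * b + (2 * d + q)) ^+ 2)).
  by rewrite lerXn2r ?nnegrE ?addr_ge0 ?mulr_ge0//; lra.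
have := sqr_ge0 (2 * p - b); have := sqr_ge0 (2 * p - d); have := sqr_ge0 (p - q).
have := sqr_ge0 (b - d); have := sqr_ge0 (2 * q - b); have := sqr_ge0 (2 * q - d).
rewrite !expr2; lra.
Qed.

End FiveGood.

Section ShortVariation.
Context {R : realType}.
Variables (K : nat) (f : int -> R) (lam : R).
Hypothesis f0 : forall n, 0 <= f n.
Implicit Types (n m c : int) (j k l N : nat).

Local Notation udiff := (udiff K f lam).
Local Notation gam := (gam K f lam).

Definition remainder n N : R := rav N f n - cavg (lev K N) f n.

Lemma window_near k N n m : (2 ^ k <= N.+1 <= 2 ^ k.+1)%N ->
  n - N%:Z <= m <= n + N%:Z -> -2 <= cell k m - cell k n <= 2.
Proof.
move=> /andP[h1 h2] hm; have := cell_bounds k n; have := cell_bounds k m.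
have := pw_gt0 k; have hN : N%:Z + 1 <= 2 * pw k by rewrite expnS in h2; rewrite /pw; lia.
by move: (pw k) (cell k m) (cell k n) hN => p x y *; nia.
Qed.

(** No cell of scale [k] met by the window has stopped, so [telescope_udiff] applies at each of its
    points. This separates the oscillation between cells from the mean-zero differences of scale at
    most [k]. *)
Lemma remainder_block n k N : (k <= K)%N -> good K f lam k n ->
  (2 ^ k <= N.+1 <= 2 ^ k.+1)%N ->
  rav N f n - cavg k f n =
    rav N (fun m => stopped K f lam k m - stopped K f lam k n) n
    + rav N (fun m => \sum_(j < k.+1) udiff j m) n.
Proof.
move=> kK hg hN; have nsn : ns K f lam k n by apply: (good_ns hg); lia.
rewrite (stopped_ns kK nsn) -ravD.
rewrite (@eq_rav _ _ f (fun m => (stopped K f lam k m - cavg k f n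
    + \sum_(j < k.+1) udiff j m) + cavg k f n)).
  by rewrite ravD rav_cst addrK.
move=> m hm; have nsm : ns K f lam k m by apply: (good_ns hg); exact: window_near hm.
by rewrite (stopped_ns kK nsm) (telescope_udiff kK nsm); ring.
Qed.

(** Reduces increments across blocks to increments inside blocks: if the two radii lie in different
    blocks, each cut-off sequence sees just one of them, as a jump to or from 0. *)
Lemma sqr_diff_single (a b : nat -> R) (P : pred nat) k1 k2 : (k1 <= K)%N -> (k2 <= K)%N ->
  P k1 -> P k2 ->
  (a k1 - b k2) ^+ 2 <= 2 * \sum_(k < K.+1 | P k) ((k1 == k)%:R * a k - (k2 == k)%:R * b k) ^+ 2.
Proof.
move=> h1 h2 P1 P2; have [e|ne] := eqVneq k1 k2.
  subst k2; rewrite (bigD1 (Ordinal (h1 : (k1 < K.+1)%N)))//= eqxx !mul1r.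
  have : 0 <= \sum_(i < K.+1 | P i && (i != Ordinal (h1 : (k1 < K.+1)%N)))
      ((k1 == i)%:R * a i - (k1 == i)%:R * b i) ^+ 2.
    by apply: sumr_ge0 => i _; exact: sqr_ge0.
  have := sqr_ge0 (a k1 - b k1); lra.
rewrite (bigD1 (Ordinal (h1 : (k1 < K.+1)%N)))//= eqxx !mul1r.
rewrite (eq_sym k2) (negbTE ne) mul0r subr0.
rewrite (bigD1 (Ordinal (h2 : (k2 < K.+1)%N)))//=; last first.
  by rewrite P2/= -val_eqE/= eq_sym.
rewrite eqxx !mul1r (negbTE ne) mul0r sub0r sqrrN.
set S := \sum_(_ < _ | _) _.
have : 0 <= S by apply: sumr_ge0 => i _; exact: sqr_ge0.
have := sqr_ge0 (a k1 + b k2); rewrite sqrrD sqrrB; lra.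
Qed.

(** [320 = 2 * 2 * 8 * 10] and [1600 = 2 * 2 * 400]: one factor 2 sorts the radii into blocks, the
    other separates the oscillation from the mean-zero part. *)
Lemma remainder_variation2 n kap (t : nat -> nat) L : (kap <= K)%N ->
  good K f lam kap n -> (forall i, (t i <= t i.+1)%N) ->
  (forall i, (2 ^ kap <= (t i).+1 <= 2 ^ K.+1)%N) ->
  \sum_(i < L) (remainder n (t i) - remainder n (t i.+1)) ^+ 2 <=
    \sum_(k < K.+1 | (kap <= k)%N)
      (320 * \sum_(i <- shifts4) gam k (n + i * pw k)
       + 1600 * \sum_(j < k.+1) (4 / 5) ^+ (k - j)
           * \sum_(i <- shifts5) cavg k (energy j (udiff j)) (n + i * pw k)).
Proof.
move=> kK hg tm ht.
pose ch k N : R := (blo k <= N <= bhi K k)%N%:R.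
pose y k N : R := rav N f n - cavg k f n.
pose z k m : R := stopped K f lam k m - stopped K f lam k n.
pose v k m : R := \sum_(j < k.+1) udiff j m.
have hlev N : (2 ^ kap <= N.+1 <= 2 ^ K.+1)%N -> (kap <= lev K N <= K)%N.
  move=> /andP[h1 h2]; rewrite /lev geq_minl andbT leq_min kK/=.
  by rewrite -(@trunc_expnK 2 kap)// leq_trunc_log.
have hy k N : (k <= K)%N -> (kap <= k)%N -> ch k N * y k N = ch k N * rav N (z k) n + ch k N * rav N (v k) n.
  move=> hk hkk; rewrite -mulrDr /ch; case: (boolP (_ <= _ <= _)%N) => hN; last by rewrite !mul0r.
  rewrite !mul1r; apply: remainder_block => //; first exact: good_le hg.
  by have := blo_ge k; have := bhi_le K k; lia.
have sq (p r s w : R) : (p + r - (s + w)) ^+ 2 <= 2 * (p - s) ^+ 2 + 2 * (r - w) ^+ 2.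
  by have := sqr_ge0 ((p - s) - (r - w)); rewrite !expr2; lra.
apply: (@le_trans _ _ (\sum_(i < L) 2 * \sum_(k < K.+1 | (kap <= k)%N)
    (2 * (ch k (t i) * rav (t i) (z k) n - ch k (t i.+1) * rav (t i.+1) (z k) n) ^+ 2
     + 2 * (ch k (t i) * rav (t i) (v k) n - ch k (t i.+1) * rav (t i.+1) (v k) n) ^+ 2))).
  apply: ler_sum => i _; rewrite /remainder.
  have /andP[a1 a2] := hlev _ (ht i); have /andP[b1 b2] := hlev _ (ht i.+1).
  apply: le_trans (sqr_diff_single (fun k => y k (t i)) (fun k => y k (t i.+1))
    (P := fun k => (kap <= k)%N) a2 b2 a1 b1) _.
  rewrite ler_wpM2l//; apply: ler_sum => k hk.
  have kK' : (k <= K)%N by rewrite -ltnS.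
  rewrite -!lev_block//; try by have := ht i; have := ht i.+1; lia.
  rewrite -!/(ch _ _) !hy//.
rewrite -mulr_sumr exchange_big/= mulr_sumr; apply: ler_sum => k hk.
have kK' : (k <= K)%N by rewrite -ltnS.
rewrite big_split/= -!mulr_sumr mulrDr.
have h1 := @block_variation2_sup R k (blo k) (bhi K k) t L (z k) n tm (blo_bhi kK') (blo_ge k) (bhi_le K k).
have h2 := @block_variation2_meanzero_sum _ k (blo k) (bhi K k) t L udiff n tm
   (blo_bhi kK') (blo_ge k) (bhi_le K k) (fun j c _ => dsum_udiff K f lam j c).
apply: lerD.
  apply: (@le_trans _ _ (2 * (2 * (8 * ((2 ^ k)%:R^-1 * w5 k (cell k n) (fun m => `|z k m|)) ^+ 2)))).
    by rewrite ler_wpM2l// ler_wpM2l.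
  rewrite w5_cavg.
  pose x c := stopped K f lam k (c * pw k).
  have hx m : stopped K f lam k m = x (cell k m).
    by apply: stopped_cell => //; rewrite cell_base.
  have -> : \sum_(i <- shifts5) cavg k (fun m => `|z k m|) (n + i * pw k)
      = \sum_(i <- shifts5) `|x (cell k n + i) - x (cell k n)|.
    apply: eq_bigr => i _; rewrite /cavg (dsum_cst (x := `|x (cell k n + i) - x (cell k n)|)).
      by rewrite mulrC mulKf// gt_eqF ?p2_gt0.
    by move=> m e; rewrite /z !hx e cell_shift.
  have -> : \sum_(i <- shifts4) gam k (n + i * pw k)
      = \sum_(i <- shifts4) (x (cell k n + i + 1) - x (cell k n + i)) ^+ 2.
    by apply: eq_bigr => i _; rewrite /gam !hx cell_add_pw cell_shift.
  have := sqr_norm_shifts x (cell k n); lra.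
apply: (@le_trans _ _ (2 * (2 * (400 * \sum_(j < k.+1) (4 / 5) ^+ (k - j)
         * ((2 ^ k)%:R^-1 * w5 k (cell k n) (energy j (udiff j))))))).
  by rewrite ler_wpM2l// ler_wpM2l.
rewrite [\sum_(j < k.+1) _ * _](eq_bigr (fun j : 'I_k.+1 => (4 / 5) ^+ (k - j) *
    \sum_(i <- shifts5) cavg k (energy j (udiff j)) (n + i * pw k))); last first.
  by move=> j _; rewrite w5_cavg.
by move: (\sum_(_ < _) _) => S; rewrite le_eqVlt; apply/orP; left; apply/eqP; ring.
Qed.

End ShortVariation.

(** * Finite sequence norms *)

Section QuadraticNorms.
Context {R : realType}.
Implicit Types (a b : nat -> R) (q : R).

Definition pnorm q (L : nat) a : R := (\sum_(i < L) `|a i| `^ q) `^ q^-1.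

Lemma pnorm_ge0 q L a : 0 <= pnorm q L a.
Proof. exact: powR_ge0. Qed.

Lemma sum_powR_ge0 q L a : 0 <= \sum_(i < L) `|a i| `^ q.
Proof. by apply: sumr_ge0 => i _; exact: powR_ge0. Qed.

Lemma pnorm_powR q L a : q != 0 -> pnorm q L a `^ q = \sum_(i < L) `|a i| `^ q.
Proof. by move=> q0; rewrite /pnorm -powRrM mulVf// powRr1// sum_powR_ge0. Qed.

Lemma eq_pnorm q L a b : (forall i, a i = b i) -> pnorm q L a = pnorm q L b.
Proof. by move=> ab; congr (_ `^ _); apply: eq_bigr => i _; rewrite ab. Qed.

Lemma le_pnorm q L a b : 0 <= q -> (forall i, `|a i| <= `|b i|) -> pnorm q L a <= pnorm q L b.
Proof.
move=> q0 ab; rewrite /pnorm ge0_ler_powR ?nnegrE ?invr_ge0 ?sum_powR_ge0//.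
by apply: ler_sum => i _; rewrite ge0_ler_powR ?nnegrE.
Qed.

(** [(x + y) / (A + B)] is a convex combination of [x / A] and [y / B] with weights proportional to
    [A] and [B]. Taking for [A] and [B] the two norms gives Minkowski's inequality. *)
Lemma convex_powR_pair q (x y A B : R) : 1 <= q -> 0 <= x -> 0 <= y -> 0 < A -> 0 < B ->
  ((x + y) / (A + B)) `^ q <= A / (A + B) * (x / A) `^ q + B / (A + B) * (y / B) `^ q.
Proof.
move=> q1 x0 y0 A0 B0.
have AB0 : 0 < A + B by rewrite addr_gt0.
have t01 : 0 <= A / (A + B) <= 1.
  by rewrite divr_ge0 ?(ltW A0) ?(ltW AB0)//= ler_pdivrMr// mul1r lerDl ltW.
have /andP[t0 t1] := t01.
have := @convex_powR R q q1 (Itv01 t0 t1) (x / A) (y / B).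
rewrite !inE/= !in_itv/= !andbT (divr_ge0 x0 (ltW A0)) (divr_ge0 y0 (ltW B0)).
move=> /(_ isT isT).
have e : 1 - A / (A + B) = B / (A + B) by field; rewrite gt_eqF.
rewrite convRE [X in X `^ _ <= _ -> _]convRE /= /unstable.onem e.
rewrite (_ : A / (A + B) * (x / A) + _ = (x + y) / (A + B))//.
by field; rewrite !gt_eqF.
Qed.

Lemma pnorm_le q L a (S : R) : 0 < q -> 0 <= S ->
  \sum_(i < L) `|a i| `^ q <= S `^ q -> pnorm q L a <= S.
Proof.
move=> q0 S0 h; rewrite -[leRHS]powRr1// -(mulfV (lt0r_neq0 q0)) powRrM.
by rewrite ge0_ler_powR ?nnegrE ?invr_ge0 ?powR_ge0 ?sum_powR_ge0// ltW.
Qed.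

Lemma minkowski_pnorm q L a b : 1 <= q ->
  pnorm q L (fun i => a i + b i) <= pnorm q L a + pnorm q L b.
Proof.
move=> q1; have q0 : 0 < q by lra.
have z0 (c d : nat -> R) : pnorm q L c = 0 -> pnorm q L (fun i => c i + d i) <= pnorm q L d.
  move=> hc; have : \sum_(i < L) `|c i| `^ q = 0 by rewrite -pnorm_powR ?gt_eqF// hc powR0 ?gt_eqF.
  move=> /eqP; rewrite psumr_eq0 => [|i _]; last exact: powR_ge0.
  move=> /allP h; rewrite /pnorm le_eqVlt; apply/orP; left; apply/eqP.
  congr (_ `^ _); apply: eq_bigr => i _.
  have /eqP/powR_eq0_eq0/eqP := h i (mem_index_enum _).
  by rewrite normr_eq0 => /eqP ->; rewrite add0r.
have [a0|a0] := eqVneq (pnorm q L a) 0; first by rewrite a0 add0r z0.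
have [b0|b0] := eqVneq (pnorm q L b) 0.
  have -> : pnorm q L (fun i => a i + b i) = pnorm q L (fun i => b i + a i).
    by apply: eq_pnorm => i; rewrite addrC.
  by rewrite b0 addr0 z0.
have A0 : 0 < pnorm q L a by rewrite lt_neqAle eq_sym a0 pnorm_ge0.
have B0 : 0 < pnorm q L b by rewrite lt_neqAle eq_sym b0 pnorm_ge0.
move eA : (pnorm q L a) A0 => A A0.
move eB : (pnorm q L b) B0 => B B0.
have AB0 : 0 < A + B by exact: addr_gt0.
apply: pnorm_le => //; first exact: ltW.
have hsum (c : nat -> R) (C : R) : 0 < C -> pnorm q L c = C ->
    \sum_(i < L) (`|c i| / C) `^ q = 1.
  move=> C0 hc; rewrite (eq_bigr (fun i : 'I_L => (C `^ q)^-1 * `|c i| `^ q)); last first.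
    by move=> i _; rewrite powRM ?invr_ge0 ?(ltW C0)// mulrC -powR_inv1 ?(ltW C0)// -powRrM mulN1r powRN.
  by rewrite -mulr_sumr -pnorm_powR ?gt_eqF// hc mulVf// gt_eqF ?powR_gt0.
have hq : \sum_(i < L) ((`|a i| + `|b i|) / (A + B)) `^ q <= 1.
  apply: (@le_trans _ _ (\sum_(i < L) (A / (A + B) * (`|a i| / A) `^ q + B / (A + B) * (`|b i| / B) `^ q))).
    by apply: ler_sum => i _; exact: convex_powR_pair.
  rewrite big_split/= -!mulr_sumr (hsum a A A0 eA) (hsum b B B0 eB).
  by rewrite !mulr1 -mulrDl mulfV// gt_eqF.
apply: (@le_trans _ _ (\sum_(i < L) (A + B) `^ q * ((`|a i| + `|b i|) / (A + B)) `^ q)).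
  apply: ler_sum => i _; rewrite -powRM ?(ltW AB0) ?divr_ge0 ?addr_ge0 ?(ltW AB0) ?(ltW A0) ?(ltW B0)//.
  rewrite mulrC divfK ?gt_eqF// ge0_ler_powR ?nnegrE ?addr_ge0 ?(ltW q0)//.
  exact: ler_normD.
by rewrite -mulr_sumr -[leRHS]mulr1 ler_wpM2l ?powR_ge0.
Qed.

(** The [q]-norm is at most the 2-norm [S], and [S <= lam + S^2 / lam]. A bound linear in the sum of
    squares is what can be summed against [g]. *)
Lemma pnorm_le_sqr q L a (lam : R) : 2 <= q -> 0 < lam ->
  pnorm q L a <= lam * (1 + \sum_(i < L) a i ^+ 2 / lam ^+ 2).
Proof.
move=> q2 l0; have q0 : 0 < q by lra.
set S2 := \sum_(i < L) a i ^+ 2; have S20 : 0 <= S2 by apply: sumr_ge0 => i _; exact: sqr_ge0.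
pose S := Num.sqrt S2; have S0 : 0 <= S by exact: sqrtr_ge0.
have SS : S ^+ 2 = S2 by exact: sqr_sqrtr.
apply: (@le_trans _ _ S); last first.
  rewrite -mulr_suml -/S2 -SS mulrDr mulr1.
  have -> : lam * (S ^+ 2 / lam ^+ 2) = S ^+ 2 / lam by field; rewrite gt_eqF.
  rewrite -(ler_pM2r l0) mulrDl divfK ?gt_eqF//.
  have := sqr_ge0 (S - lam); have := mulr_ge0 S0 (ltW l0); rewrite sqrrB -!expr2; lra.
apply: pnorm_le => //.
have aS (i : 'I_L) : `|a i| <= S.
  rewrite -sqrtr_sqr ler_wsqrtr// /S2 (bigD1 i)//= lerDl.
  by apply: sumr_ge0 => j _; exact: sqr_ge0.
apply: (@le_trans _ _ (\sum_(i < L) S `^ (q - 2) * a i ^+ 2)).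
  apply: ler_sum => i _.
  have -> : `|a i| `^ q = `|a i| `^ (q - 2) * `|a i| ^+ 2.
    have [->|ai] := eqVneq `|a i| 0; first by rewrite powR0 ?gt_eqF// expr0n mulr0.
    by rewrite -powR_mulrn// -powRD ?subrK// ai implybT.
  rewrite real_normK ?num_real// ler_wpM2r ?sqr_ge0// ge0_ler_powR ?nnegrE//; lra.
rewrite -mulr_sumr -/S2 -SS.
have [->|s0] := eqVneq S 0; first by rewrite expr0n mulr0 powR_ge0.
by rewrite -powR_mulrn// -powRD ?subrK// s0 implybT.
Qed.

Lemma pnorm_le_powR q L a (lam : R) : 1 <= q -> 0 < lam ->
  pnorm q L a <= lam * (1 + (\sum_(i < L) `|a i| `^ q) / lam `^ q).
Proof.
move=> q1 l0; have q0 : 0 < q by lra.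
rewrite -pnorm_powR ?gt_eqF//; set P := pnorm q L a.
have P0 : 0 <= P by exact: pnorm_ge0.
have -> : P = lam * (P / lam) by rewrite mulrC divfK ?gt_eqF.
have y0 : 0 <= P / lam by rewrite divr_ge0// ltW.
rewrite ler_pM2l// powRM ?(ltW l0)// mulrAC mulfV ?mul1r ?gt_eqF ?powR_gt0//.
move: (P / lam) y0 => y y0; have [y1|y1] := lerP y 1.
  by rewrite (le_trans y1)// lerDl powR_ge0.
by rewrite (le_trans (le1r_powR (ltW y1) q1))// lerDr.
Qed.

End QuadraticNorms.

Lemma geometric_double_sum (R : realType) (a : nat -> R) M : (forall j, 0 <= a j) ->
  \sum_(k < M) \sum_(j < k.+1) (4 / 5) ^+ (k - j) * a j <= 5 * \sum_(j < M) a j.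
Proof.
(* The induction also carries the last row with weight [4 = (4/5) / (1 - 4/5)], which prepays its
   decay in all later rows. *)
move=> a0; suff : \sum_(k < M) \sum_(j < k.+1) (4 / 5) ^+ (k - j) * a j
    + 4 * \sum_(j < M) (4 / 5) ^+ (M.-1 - j) * a j <= 5 * \sum_(j < M) a j.
  apply: le_trans; rewrite lerDl mulr_ge0//; apply: sumr_ge0 => j _.
  by rewrite mulr_ge0// exprn_ge0.
elim: M => [|M IH]; first by rewrite !big_ord0; lra.
rewrite big_ord_recr/= [X in _ <= 5 * X]big_ord_recr/=.
have -> : \sum_(j < M.+1) (4 / 5) ^+ (M - j) * a j
    = a M + 4 / 5 * \sum_(j < M) (4 / 5) ^+ (M.-1 - j) * a j.
  rewrite big_ord_recr/= subnn expr0 mul1r addrC; congr (_ + _).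
  rewrite mulr_sumr; apply: eq_bigr => j _; rewrite mulrA -exprS; congr (_ ^+ _ * _).
  by have := ltn_ord j; lia.
lra.
Qed.

(** * Bound on a single stopping region *)

Section Windows.
Context {R : realType}.
Variables (K : nat) (c0 : int).
Implicit Types (n : int) (k : nat) (F : int -> R).

Lemma le_window5 k (i : int) F : (k <= K)%N -> (forall n, 0 <= F n) -> -2 <= i <= 2 ->
  dsum K c0 (fun n => F (n + i * pw k)) <= w5 K c0 F.
Proof.
move=> kK F0 hi; rewrite /dsum isum_shift; have := ler_pw kK; have := pw_gt0 k.
have h : (2 ^ K)%N%:Z = pw K by [].
have h5 : (5 * 2 ^ K)%N%:Z = 5 * pw K by rewrite PoszM.
by move=> *; apply: isum_sub => //; rewrite ?h ?h5; nia.
Qed.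

Lemma le_window4 k (i : int) F : (k <= K)%N -> (forall n, 0 <= F n) -> -2 <= i <= 1 ->
  dsum K c0 (fun n => F (n + i * pw k)) <= \sum_(d <- shifts4) dsum K (c0 + d) F.
Proof.
move=> kK F0 hi.
have -> : \sum_(d <- shifts4) dsum K (c0 + d) F = isum ((c0 - 2) * pw K) (4 * 2 ^ K) F.
  rewrite !big_cons big_nil !addr0 /dsum.
  have -> : (4 * 2 ^ K = 2 ^ K + (2 ^ K + (2 ^ K + 2 ^ K)))%N by lia.
  rewrite !isum_cat -!/(pw K).
  have -> : (c0 - 2) * pw K + pw K = (c0 - 1) * pw K by ring.
  have -> : (c0 - 1) * pw K + pw K = c0 * pw K by ring.
  by have -> : c0 * pw K + pw K = (c0 + 1) * pw K by ring.
rewrite /dsum isum_shift; have := ler_pw kK; have := pw_gt0 k.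
have h : (2 ^ K)%N%:Z = pw K by [].
have h5 : (4 * 2 ^ K)%N%:Z = 4 * pw K by rewrite PoszM.
by move=> *; apply: isum_sub => //; rewrite ?h ?h5; nia.
Qed.

End Windows.

Section SingleScale.
Context {R : realType}.
Variables (K : nat) (c0 : int) (f g : int -> R) (lam mu : R).
Hypothesis f0 : forall n, 0 <= f n.
Hypothesis g0 : forall n, 0 <= g n.
Hypothesis lam0 : 0 < lam.
Hypothesis mu0 : 0 < mu.
Hypothesis f_top : forall i : int, -2 <= i <= 2 -> dsum K (c0 + i) f <= lam * (2 ^ K)%:R.
Hypothesis g_top : dsum K c0 g <= mu * (2 ^ K)%:R.
Implicit Types (n m c : int) (j k l N : nat) (F H : int -> R).

Local Notation udiff := (udiff K f lam).
Local Notation gam := (gam K f lam).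

Definition good2 k n := good K f lam k n && good K g mu k n.

Lemma good2_cell k n m : cell k n = cell k m -> good2 k n = good2 k m.
Proof. by move=> e; rewrite /good2 !(good_cell _ _ _ e). Qed.

Lemma good2_g k n : (k <= K)%N -> good2 k n -> cavg k g n <= mu.
Proof.
move=> kK /andP[_ /goodP /(_ k 0)]; rewrite mul0r addr0; apply => //.
by rewrite leqnn kK.
Qed.

(** As [H] is constant on cells of scale [k], [g] enters only through its average there, and this is
    at most [mu] on good cells. *)
Lemma le_dsum_good k H : (k <= K)%N -> (forall n, 0 <= H n) ->
  (forall n m, cell k n = cell k m -> H n = H m) ->
  dsum K c0 (fun n => g n * ((good2 k n)%:R * H n)) <= mu * dsum K c0 H.
Proof.
move=> kK H0 Hc; rewrite -isumZ; apply: (le_dsum_cells c0 kK) => d.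
have e n : cell k n = d -> cell k n = cell k (d * pw k) by rewrite cell_base.
have [gd|gd] := boolP (good2 k (d * pw k)); last first.
  rewrite (dsum_cst (x := 0)) ?mulr0.
    by apply: dsum_ge0 => n; rewrite mulr_ge0// ltW.
  by move=> n /e en; rewrite (good2_cell en) (negbTE gd) mul0r mulr0.
have -> : dsum k d (fun n => g n * ((good2 k n)%:R * H n)) = H (d * pw k) * dsum k d g.
  rewrite -isumZ; apply: eq_dsum => n /e en.
  by rewrite (good2_cell en) gd mul1r (Hc _ _ en) mulrC.
rewrite (@dsum_cst _ k d (fun n => mu * H n) (mu * H (d * pw k))); last first.
  by move=> n /e en; rewrite (Hc _ _ en).
have := good2_g kK gd; rewrite /cavg cell_base ler_pdivrMr ?p2_gt0// => hg.
by rewrite mulrC [leRHS]mulrA ler_wpM2r// mulrC.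
Qed.

Lemma top_ns (i : int) : -2 <= i <= 2 -> ns K f lam K ((c0 + i) * pw K).
Proof.
move=> hi; apply/nsP => l lK; have -> : l = K by lia.
by rewrite /cavg cell_base ler_pdivrMr ?p2_gt0// f_top.
Qed.

Lemma short_bound k n : 0 <= (320 * \sum_(i <- shifts4) gam k (n + i * pw k)
       + 1600 * \sum_(j < k.+1) (4 / 5) ^+ (k - j)
           * \sum_(i <- shifts5) cavg k (energy j (udiff j)) (n + i * pw k) : R).
Proof.
apply: addr_ge0; apply: mulr_ge0; rewrite ?ler0n//; apply: sumr_ge0 => i _.
  exact: gam_ge0.
rewrite mulr_ge0 ?exprn_ge0//; apply: sumr_ge0 => j _.
by apply: cavg_ge0 => m; exact: energy_ge0.
Qed.

(** [16 * 644] is four shifts, each spread over four cells, times the constant of [sum_gam_le]. In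
    the other product the first 5 is the double geometric sum, the second the five shifts, and
    [10 * 5] the energy bound over five cells. *)
Definition short_const : R := 320 * (16 * 644) + 1600 * (5 * (5 * (10 * 5))).

Lemma short_variation (t : int -> nat -> nat) (kap : int -> nat) L :
  (forall n, (kap n <= K)%N) -> (forall n, cell K n = c0 -> good2 (kap n) n) ->
  (forall n i, (t n i <= t n i.+1)%N) ->
  (forall n i, (2 ^ kap n <= (t n i).+1 <= 2 ^ K.+1)%N) ->
  dsum K c0 (fun n => g n * \sum_(i < L) (remainder K f n (t n i) - remainder K f n (t n i.+1)) ^+ 2)
    <= short_const * (lam ^+ 2 * mu * (2 ^ K)%:R).
Proof.
move=> hk hg tm ht.
pose Hb k n : R := 320 * \sum_(i <- shifts4) gam k (n + i * pw k)
       + 1600 * \sum_(j < k.+1) (4 / 5) ^+ (k - j)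
           * \sum_(i <- shifts5) cavg k (energy j (udiff j)) (n + i * pw k).
apply: (@le_trans _ _ (dsum K c0 (fun n => \sum_(k < K.+1) g n * ((good2 k n)%:R * Hb k n)))).
  apply: le_dsum => n en; rewrite -mulr_sumr ler_wpM2l//.
  have /andP[gf gg] := hg n en.
  have := @remainder_variation2 _ K f lam n (kap n) (t n) L (hk n) gf (tm n) (ht n).
  move/le_trans; apply.
  rewrite big_mkcond/=; apply: ler_sum => k _.
  case: (boolP (kap n <= k)%N) => hkk.
    by rewrite /good2 (good_le hkk gf) (good_le hkk gg) mul1r.
  by rewrite mulr_ge0//; exact: short_bound.
rewrite /dsum isum_sum -!/(dsum _ _ _).
apply: (@le_trans _ _ (\sum_(k < K.+1) mu * dsum K c0 (Hb k))).
  apply: ler_sum => k _; have kK : (k <= K)%N by rewrite -ltnS.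
  apply: le_dsum_good => //; first by move=> n; exact: short_bound.
  move=> n m e; rewrite /Hb; congr (_ * _ + _ * _).
    by apply: eq_bigr => i _; apply: gam_cell => //; rewrite !cell_shift e.
  apply: eq_bigr => j _; congr (_ * _); apply: eq_bigr => i _.
  by apply: cavg_cell; rewrite !cell_shift e.
rewrite -mulr_sumr.
have l0 : 0 <= lam by exact: ltW.
have p0 := p2_gt0 (R := R) K.
have hgam : \sum_(k < K.+1) dsum K c0 (fun n => \sum_(i <- shifts4) gam k (n + i * pw k))
   <= 16 * (644 * (lam ^+ 2 * (2 ^ K)%:R)).
  apply: (@le_trans _ _ (\sum_(k < K.+1) 4 * \sum_(d <- shifts4) dsum K (c0 + d) (gam k))).
    apply: ler_sum => k _; have kK : (k <= K)%N by rewrite -ltnS.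
    rewrite /dsum isum_sum -!/(dsum _ _ _).
    apply: (@le_trans _ _ (\sum_(i <- shifts4) \sum_(d <- shifts4) dsum K (c0 + d) (gam k))).
      rewrite big_seq [leRHS]big_seq; apply: ler_sum => i; rewrite shifts4P => hi.
      by apply: le_window4 => // n; exact: gam_ge0.
    by rewrite big_const_seq /= !big_cons big_nil; lra.
  rewrite -mulr_sumr exchange_big/=.
  rewrite (_ : 16 * _ = 4 * \sum_(d <- shifts4) 644 * (lam ^+ 2 * (2 ^ K)%:R)); last first.
    by rewrite !big_cons big_nil; ring.
  rewrite ler_wpM2l// big_seq [leRHS]big_seq; apply: ler_sum => d; rewrite shifts4P => hd.
  apply: sum_gam_le => //; first by apply: top_ns; lia.
  by rewrite -addrA; apply: top_ns; lia.
have hw5 : \sum_(j < K.+1) w5 K c0 (energy j (udiff j)) <= 10 * lam * (5 * (lam * (2 ^ K)%:R)).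
  have hs (i : int) : -2 <= i <= 2 ->
     \sum_(j < K.+1) dsum K (c0 + i) (energy j (udiff j)) <= 10 * lam * (lam * (2 ^ K)%:R).
    move=> hi; apply: le_trans (sum_energy_le f0 l0 (top_ns hi)) _.
    by rewrite ler_wpM2l ?mulr_ge0// f_top.
  under eq_bigr do rewrite w5E.
  rewrite !big_split/=.
  have := hs (- 2) isT; have := hs (- 1) isT; have := hs 0 isT; have := hs 1 isT; have := hs 2 isT.
  rewrite addr0; lra.
have hen : \sum_(k < K.+1) dsum K c0 (fun n => \sum_(j < k.+1) (4 / 5) ^+ (k - j)
           * \sum_(i <- shifts5) cavg k (energy j (udiff j)) (n + i * pw k))
   <= 5 * (5 * (10 * lam * (5 * (lam * (2 ^ K)%:R)))).
  apply: (@le_trans _ _ (\sum_(k < K.+1) \sum_(j < k.+1) (4 / 5) ^+ (k - j)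
      * (5 * w5 K c0 (energy j (udiff j))))).
    apply: ler_sum => k _; have kK : (k <= K)%N by rewrite -ltnS.
    rewrite /dsum isum_sum; apply: ler_sum => j _; rewrite isumZ ler_wpM2l ?exprn_ge0//.
    rewrite isum_sum -!/(dsum _ _ _).
    apply: (@le_trans _ _ (\sum_(i <- shifts5) w5 K c0 (energy j (udiff j)))).
      rewrite big_seq [leRHS]big_seq; apply: ler_sum => i; rewrite shifts5P => hi.
      have -> : w5 K c0 (energy j (udiff j)) = w5 K c0 (cavg k (energy j (udiff j))).
        by rewrite !w5E !(dsum_cavg_le _ _ kK).
      apply: (@le_window5 _ K c0 k i (cavg k (energy j (udiff j)))) => // n.
      by apply: cavg_ge0 => m; exact: energy_ge0.
    by rewrite !big_cons big_nil; lra.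
  apply: le_trans (geometric_double_sum (a := fun j => 5 * w5 K c0 (energy j (udiff j))) _ _) _.
    by move=> j; rewrite mulr_ge0//; apply: isum_ge0 => n; exact: energy_ge0.
  by rewrite ler_wpM2l// -mulr_sumr ler_wpM2l.
have -> : \sum_(k < K.+1) dsum K c0 (Hb k) =
   320 * (\sum_(k < K.+1) dsum K c0 (fun n => \sum_(i <- shifts4) gam k (n + i * pw k)))
   + 1600 * (\sum_(k < K.+1) dsum K c0 (fun n => \sum_(j < k.+1) (4 / 5) ^+ (k - j)
           * \sum_(i <- shifts5) cavg k (energy j (udiff j)) (n + i * pw k))).
  by rewrite !mulr_sumr -big_split; apply: eq_bigr => k _; rewrite /Hb /dsum isumD !isumZ.
rewrite [leRHS](_ : _ = mu * (short_const * (lam ^+ 2 * (2 ^ K)%:R))); last by ring.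
rewrite ler_wpM2l ?(ltW mu0)//.
move: hgam hen; move: (\sum_(_ < _) _) (\sum_(k < _) _) => S1 S2.
rewrite /short_const !expr2; lra.
Qed.

(** The long variation, then the short one; the 2 comes from the terms 1 in [pnorm_le_powR] and
    [pnorm_le_sqr]. *)
Definition single_scale_const (q : R) : R :=
  (4 `^ q * 10 / (1 - 4 * 2^-1 `^ q) + 1) + (short_const + 2).

Lemma short_const_ge0 : 0 <= short_const.
Proof. by apply: addr_ge0; rewrite -!natrM ler0n. Qed.

Lemma single_scale_const_ge0 (q : R) : 2 < q -> 0 <= single_scale_const q.
Proof.
move=> q2; have zq : 2^-1 `^ (q - 2) <= 1 :> R.
  have : 2^-1 `^ (q - 2) < 1 `^ (q - 2) :> R.
    by apply: gt0_ltr_powR; rewrite ?subr_gt0 ?nnegrE ?invr_ge0//; lra.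
  by rewrite powR1 => /ltW.
have e : 2^-1 `^ q = 2^-1 `^ (q - 2) * 2^-1 ^+ 2 :> R.
  by rewrite -powR_mulrn ?invr_ge0// -powRD ?subrK// implybE; apply/orP; right; rewrite invr_neq0.
have zq4 : 0 <= 1 - 4 * 2^-1 `^ q :> R by rewrite e expr2; lra.
apply: addr_ge0; last exact: addr_ge0 short_const_ge0 (ler0n _ _).
by apply: addr_ge0; rewrite ?ler01// mulr_ge0 ?invr_ge0// mulr_ge0 ?powR_ge0 ?ler0n.
Qed.

Lemma single_scale (q : R) (t : int -> nat -> nat) (kap : int -> nat) L : 2 < q ->
  (forall n, (kap n <= K)%N) -> (forall n, cell K n = c0 -> good2 (kap n) n) ->
  (forall n i, (t n i <= t n i.+1)%N) ->
  (forall n i, (2 ^ kap n <= (t n i).+1 <= 2 ^ K.+1)%N) ->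
  dsum K c0 (fun n => g n * pnorm q L (fun i => rav (t n i) f n - rav (t n i.+1) f n))
    <= single_scale_const q * (lam * mu * (2 ^ K)%:R).
Proof.
move=> q2 hk hg tm ht; have q0 : 0 < q by lra.
pose e n i := cavg (lev K (t n i)) f n.
pose r n i := remainder K f n (t n i).
have hlev n i : (kap n <= lev K (t n i) <= K)%N.
  have /andP[h1 h2] := ht n i; rewrite /lev geq_minl andbT leq_min hk/=.
  by rewrite -(@trunc_expnK 2 (kap n))// leq_trunc_log.
have long : dsum K c0 (fun n => g n * \sum_(i < L) `|e n i - e n i.+1| `^ q)
    <= (4 `^ q * 10 / (1 - 4 * 2^-1 `^ q) + 1) * (lam `^ q * mu * (2 ^ K)%:R).
  apply: (long_variation (gd := good2) (kap := kap) f0 g0 good2_cell _ good2_g lam0 (ltW mu0) (s := fun n i => lev K (t n i))) => //.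
  - by move=> k n kK /andP[h _]; apply: (good_ns h); lia.
  - move=> n l en /andP[h1 h2]; have /andP[gf gg] := hg n en.
    by rewrite /good2 (good_le h1 gf) (good_le h1 gg).
  - move=> n i; rewrite /lev leq_min geq_minl /=.
    by apply: leq_trans (geq_minr _ _) _; rewrite leq_trunc_log ?ltnS ?tm.
have short := @short_variation t kap L hk hg tm ht.
apply: (@le_trans _ _ (dsum K c0 (fun n =>
    2 * lam * g n + (lam / lam `^ q * (g n * \sum_(i < L) `|e n i - e n i.+1| `^ q)
    + lam / lam ^+ 2 * (g n * \sum_(i < L) (r n i - r n i.+1) ^+ 2))))).
  apply: le_dsum => n en.
  have -> : pnorm q L (fun i => rav (t n i) f n - rav (t n i.+1) f n) =
      pnorm q L (fun i => (e n i - e n i.+1) + (r n i - r n i.+1)).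
    by apply: eq_pnorm => i; rewrite /e /r /remainder; ring.
  apply: (@le_trans _ _ (g n * (lam * (1 + (\sum_(i < L) `|e n i - e n i.+1| `^ q) / lam `^ q)
      + lam * (1 + \sum_(i < L) (r n i - r n i.+1) ^+ 2 / lam ^+ 2)))).
    rewrite ler_wpM2l// (le_trans (minkowski_pnorm _ _ _ _)) ?lerD//; first by lra.
      by apply: pnorm_le_powR => //; lra.
    by apply: pnorm_le_sqr => //; lra.
  rewrite -mulr_suml; move: (\sum_(i < L) _) (\sum_(i < L) _) => A B.
  by rewrite le_eqVlt; apply/orP; left; apply/eqP; ring.
rewrite /dsum !isumD !isumZ -!/(dsum _ _ _).
have lq : 0 < lam `^ q by rewrite powR_gt0.
have h1 : 2 * lam * dsum K c0 g <= 2 * lam * (mu * (2 ^ K)%:R).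
  by rewrite ler_wpM2l// mulr_ge0// ltW.
have h2 := ler_wpM2l (divr_ge0 (ltW lam0) (ltW lq)) long.
have h3 := ler_wpM2l (divr_ge0 (ltW lam0) (sqr_ge0 lam)) short.
apply: (le_trans (lerD h1 (lerD h2 h3))).
rewrite /single_scale_const le_eqVlt; apply/orP; left; apply/eqP.
move: (4 `^ q * 10 / _ + 1) (lam `^ q) lq (2 ^ K)%:R => C l l0 P.
by field; rewrite !gt_eqF.
Qed.

End SingleScale.

(** * Sparse recursion *)

Section BadSet.
Context {R : realType}.
Implicit Types (F : int -> R) (n m c : int) (k l K : nat) (b : R).

Lemma notns_st K F b l n : (l <= K)%N -> ~~ ns K F b l n ->
  exists2 j, (l <= j <= K)%N & st K F b j n.
Proof.
move=> /subKn <-; move: (K - l)%N => d; elim: d => [|d IH] h.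
  exists K; first by rewrite subn0 leqnn.
  rewrite /st leqnn/=; apply/andP; split; last by apply/nsP => i; lia.
  move: h; rewrite subn0 nsS// negb_and -ltNge => /orP[//|/negP[]].
  by apply/nsP => i; lia.
have [dK|dK] := ltnP d K; last first.
  have e : (K - d.+1 = K - d)%N by lia.
  by rewrite e in h *; exact: IH.
have e : (K - d = (K - d.+1).+1)%N by lia.
have [h'|/IH[j hj sj]] := boolP (ns K F b (K - d) n); last first.
  by exists j => //; lia.
exists (K - d.+1)%N; first by lia.
rewrite /st -e h' andbT leq_subr/=; move: h; rewrite nsS ?leq_subr// -e h' andbT.
by rewrite -ltNge.
Qed.

(** A cell near [n] whose average exceeds [b] lies in a stopping cell of the same or a coarser scale
    [j], and that cell is still within two cells of [n] at scale [j]. *)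
Lemma notgood_le K F b k n : (~~ good K F b k n)%:R <=
  \sum_(j < K.+1) \sum_(i <- shifts5) (st K F b j (n + i * pw j))%:R :> R.
Proof.
have [//|/goodP h] := boolP (good K F b k n).
  by move=> _; apply: sumr_ge0 => j _; apply: sumr_ge0.
have [l [i [lK hi hb]]] : exists l i, [/\ (k <= l <= K)%N, -2 <= i <= 2 & b < cavg l F (n + i * pw l)].
  apply: contrapT => hn; apply: h => l i lK hi; rewrite leNgt; apply/negP => hb.
  by apply: hn; exists l, i.
have /andP[_ lK'] := lK.
have nn : ~~ ns K F b l (n + i * pw l).
  by apply/negP => /nsP /(_ l); rewrite leqnn lK' leNgt hb => /(_ isT).
have [j /andP[lj jK] sj] := notns_st lK' nn.
pose i' := cell j (n + i * pw l) - cell j n.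
have hi' : -2 <= i' <= 2 by apply: (cell_near lj); rewrite cell_shift; lia.
have sj' : st K F b j (n + i' * pw j).
  by rewrite -(@st_cell _ K F b j (n + i * pw l))// cell_shift /i' [RHS]addrC subrK.
rewrite (bigD1 (Ordinal (jK : (j < K.+1)%N)))//= (big_rem i') ?shifts5P//= sj'.
rewrite -addrA lerDl addr_ge0//; first by rewrite sumr_ge0.
by apply: sumr_ge0 => ? _; apply: sumr_ge0.
Qed.

(** The weak-type bound of the dyadic maximal function: stopping cells are disjoint, and on each of
    them [F] has average above [b]. *)
Lemma sum_st_dsum K F b c : 0 <= b -> (forall n, 0 <= F n) ->
  b * \sum_(j < K.+1) dsum K c (fun n => (st K F b j n)%:R) <= dsum K c F.
Proof.
move=> b0 F0; rewrite mulr_sumr.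
apply: (@le_trans _ _ (\sum_(j < K.+1) dsum K c (fun n => (st K F b j n)%:R * F n))).
  apply: ler_sum => j _; have jK : (j <= K)%N by rewrite -ltnS.
  rewrite -isumZ; apply: (le_dsum_cells c jK) => d.
  have e n : cell j n = d -> st K F b j n = st K F b j (d * pw j).
    by move=> en; apply: st_cell; rewrite cell_base.
  have [s|s] := boolP (st K F b j (d * pw j)); last first.
    rewrite (dsum_cst (x := 0)) ?mulr0; first by apply: dsum_ge0 => n; rewrite mulr_ge0.
    by move=> n /e ->; rewrite (negbTE s) mulr0.
  rewrite (dsum_cst (x := b)); last by move=> n /e ->; rewrite s mulr1.
  have -> : dsum j d (fun n => (st K F b j n)%:R * F n) = dsum j d F.
    by apply: eq_dsum => n /e ->; rewrite s mul1r.
  rewrite (dsum_cellavg F) ler_wpM2l//.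
  by move: s; rewrite /st /cavg cell_base => /and3P[_ /ltW].
rewrite /dsum -isum_sum; apply: le_isum => n _.
by rewrite -mulr_suml -[leRHS]mul1r ler_wpM2r// sum_st_le1.
Qed.

Lemma dsum_notgood_le K F b c : 0 <= b -> (forall n, 0 <= F n) ->
  b * dsum K c (fun n => (~~ good K F b 0 n)%:R) <= 5 * w5 K c F.
Proof.
move=> b0 F0.
apply: (@le_trans _ _ (b * (5 * \sum_(j < K.+1) w5 K c (fun n => (st K F b j n)%:R)))).
  rewrite ler_wpM2l//.
  apply: (@le_trans _ _ (dsum K c (fun n =>
      \sum_(j < K.+1) \sum_(i <- shifts5) (st K F b j (n + i * pw j))%:R))).
    by apply: le_dsum => n _; exact: notgood_le.
  rewrite /dsum isum_sum mulr_sumr; apply: ler_sum => j _; rewrite isum_sum.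
  have jK : (j <= K)%N by rewrite -ltnS.
  apply: (@le_trans _ _ (\sum_(i <- shifts5) w5 K c (fun n => (st K F b j n)%:R))).
    rewrite big_seq [leRHS]big_seq; apply: ler_sum => i; rewrite shifts5P => hi.
    by apply: (@le_window5 _ K c j i (fun n => (st K F b j n)%:R)).
  by rewrite !big_cons big_nil; lra.
rewrite mulrCA ler_wpM2l//.
under eq_bigr do rewrite w5E.
rewrite !big_split/= w5E !mulrDr !lerD//; exact: sum_st_dsum.
Qed.

End BadSet.

Lemma clamp_bounds (x y z : nat) : (0 < x <= y)%N ->
  (x <= (maxn x.-1 (minn y.-1 z)).+1 <= y)%N.
Proof. lia. Qed.

Section Recursion.
Context {R : realType}.
Variables (q : R) (f g : int -> R) (t : int -> nat -> nat) (L : nat).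
Hypothesis q2 : 2 < q.
Hypothesis f0 : forall n, 0 <= f n.
Hypothesis g0 : forall n, 0 <= g n.
Hypothesis tm : forall n i, (t n i <= t n i.+1)%N.
Implicit Types (n m c : int) (k l K : nat).

(* The variation along [t], with the radii truncated at the end of scale [k]. *)
Definition cutvar k n : R :=
  pnorm q L (fun i => rav (minn (2 ^ k.+1).-1 (t n i)) f n
                      - rav (minn (2 ^ k.+1).-1 (t n i.+1)) f n).

Lemma cutvar_ge0 k n : 0 <= cutvar k n.
Proof. exact: pnorm_ge0. Qed.

(** Cuts a path of radii at [M]: a step across [M] becomes a step to [M] and a step from [M]. *)
Lemma split_minmax (a : nat -> R) (M m m' : nat) :
  a m - a m' = (a (minn M m) - a (minn M m')) + (a (maxn M m) - a (maxn M m')).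
Proof.
have e x : a (minn M x) + a (maxn M x) = a M + a x.
  by case: (leqP M x) => h; [|rewrite addrC].
have := e m; have := e m'; lra.
Qed.

Section OneScale.
Variables (K : nat) (c0 : int) (lam mu : R).

(* Equal to [K] when no smaller scale is good. *)
Definition stopscale n : nat := find (fun k => good2 K f g lam mu k n) (iota 0 K).

Lemma stopscale_le n : (stopscale n <= K)%N.
Proof. by rewrite -[X in (_ <= X)%N](size_iota 0 K) find_size. Qed.

Lemma good2_le k l n : (k <= l)%N -> good2 K f g lam mu k n -> good2 K f g lam mu l n.
Proof. by move=> kl /andP[h1 h2]; rewrite /good2 !(good_le kl). Qed.

Lemma stopscale_good n : good2 K f g lam mu K n -> good2 K f g lam mu (stopscale n) n.
Proof.
move=> h; rewrite /stopscale; set a := (fun k => _); have [ha|ha] := boolP (has a (iota 0 K)).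
  have := nth_find 0%N ha; rewrite nth_iota//.
  by rewrite has_find size_iota in ha.
by move: ha; rewrite has_find size_iota -leqNgt => hK; apply: good2_le h.
Qed.

Lemma stopscale_notgood n k : (k < stopscale n)%N -> ~~ good2 K f g lam mu k n.
Proof.
move=> h; have := before_find 0%N h; rewrite nth_iota => [->//|].
exact: leq_trans h (stopscale_le n).
Qed.

(** The sum has at most one nonzero term, at the scale just below [stopscale]. Writing it over all
    scales makes each coefficient constant on the cells of its own scale, as the recursion needs. *)
Lemma cutvar_stop n : good2 K f g lam mu K n ->
  cutvar K n <= \sum_(k < K) (good2 K f g lam mu k.+1 n && ~~ good2 K f g lam mu k n)%:R * cutvar k n
    + pnorm q L (fun i => rav (maxn (2 ^ stopscale n).-1 (minn (2 ^ K.+1).-1 (t n i))) f n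
         - rav (maxn (2 ^ stopscale n).-1 (minn (2 ^ K.+1).-1 (t n i.+1))) f n).
Proof.
have q1 : 1 <= q by move: q2; lra.
move=> hg; have sg := stopscale_good hg; have sK := stopscale_le n.
have sn k := @stopscale_notgood n k.
move: (stopscale n) sg sK sn => s sg sK sn.
have S0 : 0 <= \sum_(k < K) (good2 K f g lam mu k.+1 n && ~~ good2 K f g lam mu k n)%:R * cutvar k n.
  by apply: sumr_ge0 => k _; rewrite mulr_ge0 ?cutvar_ge0.
case: s sg sK sn => [|s] sg sK sn.
  have e : cutvar K n = pnorm q L (fun i => rav (maxn (2 ^ 0).-1 (minn (2 ^ K.+1).-1 (t n i))) f n
         - rav (maxn (2 ^ 0).-1 (minn (2 ^ K.+1).-1 (t n i.+1))) f n).
    by apply: eq_pnorm => i; rewrite expn0 !max0n.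
  by rewrite -e lerDr.
have h2 : ((2 ^ s.+1).-1 <= (2 ^ K.+1).-1)%N.
  have : (2 ^ s.+1 <= 2 ^ K.+1)%N by rewrite leq_exp2l//; lia.
  lia.
have mm x : minn (2 ^ s.+1).-1 (minn (2 ^ K.+1).-1 x) = minn (2 ^ s.+1).-1 x.
  by rewrite minnA (minn_idPl h2).
apply: (@le_trans _ _ (cutvar s n + pnorm q L (fun i => rav (maxn (2 ^ s.+1).-1 (minn (2 ^ K.+1).-1 (t n i))) f n
         - rav (maxn (2 ^ s.+1).-1 (minn (2 ^ K.+1).-1 (t n i.+1))) f n))).
  pose a1 i := rav (minn (2 ^ s.+1).-1 (t n i)) f n - rav (minn (2 ^ s.+1).-1 (t n i.+1)) f n.
  pose a2 i := rav (maxn (2 ^ s.+1).-1 (minn (2 ^ K.+1).-1 (t n i))) f n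
         - rav (maxn (2 ^ s.+1).-1 (minn (2 ^ K.+1).-1 (t n i.+1))) f n.
  have -> : cutvar K n = pnorm q L (fun i => a1 i + a2 i).
    by apply: eq_pnorm => i; rewrite (split_minmax (fun N => rav N f n) (2 ^ s.+1).-1) !mm.
  by apply: (@minkowski_pnorm _ q L a1 a2 q1).
rewrite lerD2r (bigD1 (Ordinal sK))//= sg sn// mul1r lerDl.
by apply: sumr_ge0 => k _; rewrite mulr_ge0 ?cutvar_ge0.
Qed.

End OneScale.

Lemma cutvar_f0 K c n : w5 K c f = 0 -> cell K n = c -> cutvar K n = 0.
Proof.
move=> h e.
have r0 N : rav (minn (2 ^ K.+1).-1 N) f n = 0.
  apply/eqP; rewrite eq_le rav_ge0// andbT /rav mulr_ge0_le0 ?invr_ge0//.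
  have e0 : (0 < 2 ^ K)%N by rewrite expn_gt0.
  have e1 := expnS 2 K.
  have := cell_bounds K n; rewrite e => hb.
  have := geq_minl (2 ^ K.+1).-1 N; set M := minn _ _ => hM.
  by rewrite -h; apply: isum_sub => //; move: hb; rewrite /pw; lia.
rewrite /cutvar /pnorm big1 => [|i _]; first by rewrite powR0// invr_neq0// gt_eqF//; move: q2; lra.
by rewrite !r0 subrr normr0 powR0// gt_eqF//; move: q2; lra.
Qed.

Lemma dsum_le_w5 K c (i : int) F : (forall n, 0 <= F n) -> -2 <= i <= 2 ->
  dsum K (c + i) F <= w5 K c F :> R.
Proof.
move=> F0 hi; rewrite -dsum_shift.
exact: (@le_window5 _ K c K i F).
Qed.

(** The constant does not accumulate: [E] pays for the radii above the stopping scale, while its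
    complement, partitioned into the cells where the recursion restarts, pays for the smaller radii.
    [T] only limits the scales at which the hypothesis on [Phi] is required. *)
Lemma sparse_recursion (Phi : int -> R) (A : R) (T : nat) :
  0 <= A -> (forall n, 0 <= Phi n) ->
  (forall K c (E : int -> bool), (K <= T)%N ->
     (2 ^ K)%:R <= 2 * dsum K c (fun n => (E n)%:R) :> R ->
     w5 K c f * w5 K c g <= A * (2 ^ K)%:R * dsum K c (fun n => (E n)%:R * Phi n)) ->
  forall K c, (K <= T)%N ->
    dsum K c (fun n => g n * cutvar K n)
      <= 400 * single_scale_const q * A * dsum K c Phi.
Proof.
move=> A0 P0 hyp K; have [M] := ubnP K; elim: M K => // M IH K KM c KT.
have p0 := p2_gt0 (R := R) K.
have := single_scale_const_ge0 q2; move eC : (single_scale_const q) IH => Cq IH C0.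
have B0 : 0 <= 400 * Cq * A by rewrite !mulr_ge0 ?ler0n.
have wf0 : 0 <= w5 K c f by exact: isum_ge0.
have wg0 : 0 <= w5 K c g by exact: isum_ge0.
have RH0 : 0 <= 400 * Cq * A * dsum K c Phi.
  by rewrite mulr_ge0// dsum_ge0.
(* Degenerate cells are removed first, because [lam] and [mu] have to be positive. *)
have [wf|wf] := eqVneq (w5 K c f) 0.
  rewrite (dsum_cst (x := 0)) ?mulr0// => n e.
  by rewrite (cutvar_f0 wf e) mulr0.
have [wg|wg] := eqVneq (w5 K c g) 0.
  rewrite (dsum_cst (x := 0)) ?mulr0// => n e.
  suff -> : g n = 0 by rewrite mul0r.
  apply/eqP; rewrite eq_le g0 andbT -wg; apply: le_trans (@dsum_le_w5 K c 0 g g0 isT).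
  rewrite addr0 /dsum; apply: le_isum_point => //.
  by have := cell_bounds K n; rewrite e /pw; lia.
have {}wf : 0 < w5 K c f by rewrite lt_neqAle eq_sym wf.
have {}wg : 0 < w5 K c g by rewrite lt_neqAle eq_sym wg.
(* By [dsum_notgood_le], the factor 20 lets the points that are bad for [f] fill at most [5/20] of
   the cell, and likewise for [g]; so [E] fills at least half. *)
have [lam edl] : exists lam : R, lam = 20 * w5 K c f / (2 ^ K)%:R by eexists.
have [mu edm] : exists mu : R, mu = 20 * w5 K c g / (2 ^ K)%:R by eexists.
have lam0 : 0 < lam by rewrite edl divr_gt0 ?mulr_gt0 ?ltr0n ?expn_gt0.
have mu0 : 0 < mu by rewrite edm divr_gt0 ?mulr_gt0 ?ltr0n ?expn_gt0.
have elam : lam * (2 ^ K)%:R = 20 * w5 K c f by rewrite edl divfK ?gt_eqF.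
have emu : mu * (2 ^ K)%:R = 20 * w5 K c g by rewrite edm divfK ?gt_eqF.
have ft (i : int) : -2 <= i <= 2 -> dsum K (c + i) f <= lam * (2 ^ K)%:R.
  by move=> hi; rewrite elam; have := dsum_le_w5 K c f0 hi; lra.
have gt (i : int) : -2 <= i <= 2 -> dsum K (c + i) g <= mu * (2 ^ K)%:R.
  by move=> hi; rewrite emu; have := dsum_le_w5 K c g0 hi; lra.
pose G k n := good2 K f g lam mu k n.
have GK n : cell K n = c -> G K n.
  move=> e; apply/andP; split; apply/goodP => l i lK hi;
    have {lK} -> : l = K by apply/eqP; rewrite eqn_leq andbC.
    by rewrite /cavg cell_shift e ler_pdivrMr// ft.
  by rewrite /cavg cell_shift e ler_pdivrMr// gt.
pose E n := G 0%N n.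
have Ebig : (2 ^ K)%:R <= 2 * dsum K c (fun n => (E n)%:R) :> R.
  have hf := dsum_notgood_le K c (ltW lam0) f0; have hg := dsum_notgood_le K c (ltW mu0) g0.
  have hf' : dsum K c (fun n => (~~ good K f lam 0 n)%:R) <= (2 ^ K)%:R / 4 :> R.
    rewrite -(ler_pM2l lam0); apply: le_trans hf _; rewrite mulrA elam; lra.
  have hg' : dsum K c (fun n => (~~ good K g mu 0 n)%:R) <= (2 ^ K)%:R / 4 :> R.
    rewrite -(ler_pM2l mu0); apply: le_trans hg _; rewrite mulrA emu; lra.
  have : dsum K c (fun=> 1) <= dsum K c (fun n => (E n)%:R + ((~~ good K f lam 0 n)%:R + (~~ good K g mu 0 n)%:R)) :> R.
    apply: le_dsum => n _; rewrite /E /G /good2.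
    by case: (good K f lam 0 n); case: (good K g mu 0 n) => /=; lra.
  rewrite (dsum_cst (x := 1)) ?mulr1// /dsum !isumD -!/(dsum _ _ _); lra.
apply: (@le_trans _ _ (dsum K c (fun n =>
   \sum_(k < K) (G k.+1 n && ~~ G k n)%:R * (g n * cutvar k n)
    + g n * pnorm q L (fun i => rav (maxn (2 ^ stopscale K lam mu n).-1 (minn (2 ^ K.+1).-1 (t n i))) f n
         - rav (maxn (2 ^ stopscale K lam mu n).-1 (minn (2 ^ K.+1).-1 (t n i.+1))) f n)))).
  apply: le_dsum => n e.
  apply: le_trans (ler_wpM2l (g0 n) (cutvar_stop (GK n e))) _.
  rewrite mulrDr lerD2r mulr_sumr; apply: ler_sum => k _.
  by rewrite mulrCA.
rewrite /dsum isumD isum_sum -!/(dsum _ _ _).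
apply: (@le_trans _ _ (400 * Cq * A * dsum K c (fun n => (~~ E n)%:R * Phi n)
   + 400 * Cq * A * dsum K c (fun n => (E n)%:R * Phi n))); last first.
  rewrite -mulrDr ler_wpM2l// /dsum -isumD; apply: le_isum => n _.
  by case: (E n); rewrite /= ?mul0r ?mul1r ?add0r ?addr0.
apply: lerD.
  apply: (@le_trans _ _ (\sum_(k < K) dsum K c (fun n =>
      (G k.+1 n && ~~ G k n)%:R * (400 * Cq * A * Phi n)))).
    apply: ler_sum => k _; have kK : (k <= K)%N by rewrite ltnW.
    apply: (le_dsum_cells c kK) => d.
    pose b := G k.+1 (d * pw k) && ~~ G k (d * pw k).
    have hb n : cell k n = d -> G k.+1 n && ~~ G k n = b.
      move=> e; have e' : cell k n = cell k (d * pw k) by rewrite cell_base.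
      by rewrite /b /G (good2_cell _ _ _ _ _ e') (good2_cell _ _ _ _ _ (cell_eq (leqnSn k) e')).
    have -> : dsum k d (fun n => (G k.+1 n && ~~ G k n)%:R * (g n * cutvar k n)) =
       b%:R * dsum k d (fun n => g n * cutvar k n).
      by rewrite -isumZ; apply: eq_dsum => n /hb ->.
    have -> : dsum k d (fun n => (G k.+1 n && ~~ G k n)%:R * (400 * Cq * A * Phi n)) =
       b%:R * (400 * Cq * A * dsum k d Phi).
      by rewrite -!isumZ; apply: eq_dsum => n /hb ->.
    apply: ler_wpM2l; first exact: ler0n.
    by apply: IH; [exact: leq_trans (ltn_ord k) KM|exact: leq_trans kK KT].
  rewrite /dsum -isum_sum -isumZ -!/(dsum _ _ _); apply: le_dsum => n e.
  rewrite -mulr_suml mulrCA; apply: ler_wpM2l; first exact: B0.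
  apply: ler_wpM2r; first exact: P0.
  (* Goodness is monotone in the scale, so the indicators of a restart at scale [k] telescope to the
     indicator of the complement of [E]. *)
  have h k : (G k.+1 n && ~~ G k n)%:R = (G k.+1 n)%:R - (G k n)%:R :> R.
    have : G k n -> G k.+1 n by exact: good2_le.
    by case: (G k n); case: (G k.+1 n) => //= h'; rewrite ?subrr ?subr0//; have := h' isT.
  under eq_bigr do rewrite h.
  have := @telescope_sumr _ 0 K (fun k => (G k n)%:R : R) isT.
  rewrite big_mkord => ->; rewrite GK// /E; case: (G 0%N n) => /=; lra.
have := @single_scale _ K c f g lam mu f0 g0 lam0 mu0 ft _ q
   (fun n i => maxn (2 ^ stopscale K lam mu n).-1 (minn (2 ^ K.+1).-1 (t n i)))
   (stopscale K lam mu) L q2 (stopscale_le K lam mu) _ _ _.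
rewrite eC; move=> /(_ _ _ _ _)/le_trans; apply.
- by rewrite -[c in dsum K c g]addr0; apply: gt.
- by move=> n e; apply: stopscale_good; exact: GK.
- move=> n i; rewrite geq_max leq_maxl/=.
  apply: leq_trans (leq_maxr _ _); rewrite leq_min geq_minl/=.
  by apply: leq_trans (geq_minr _ _) (tm n i).
- move=> n i; apply: clamp_bounds; rewrite expn_gt0/=.
  by rewrite leq_exp2l// (leq_trans (stopscale_le K lam mu n)).
have hE := hyp K c E KT Ebig.
have -> : lam * mu * (2 ^ K)%:R = 400 / (2 ^ K)%:R * (w5 K c f * w5 K c g).
  by rewrite edl edm; field; rewrite gt_eqF.
apply: (@le_trans _ _ (Cq * (400 / (2 ^ K)%:R * (A * (2 ^ K)%:R * dsum K c (fun n => (E n)%:R * Phi n))))).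
  apply: ler_wpM2l; first exact: C0.
  by apply: ler_wpM2l; [rewrite divr_ge0 ?ler0n|exact: hE].
rewrite le_eqVlt; apply/orP; left; apply/eqP.
move: (dsum _ _ _) (Cq) ((2 ^ K)%:R) p0 => x y z z0.
by field; rewrite gt_eqF.
Qed.

End Recursion.

(** * Weighted maximal functions *)

Section DyadicMaximal.
Context {R : realType}.
Variables (u s : int -> R) (p : R).
Hypothesis u0 : forall n, 0 <= u n.
Hypothesis s0 : forall n, 0 < s n.
Hypothesis p1 : 1 < p.
Implicit Types (n m c : int) (k l : nat) (a : R).

Definition wavg k n : R := dsum k (cell k n) u / dsum k (cell k n) s.

(** The dyadic maximal function of [u / s] for the measure [s], scanned from scale [k] down with
    running maximum [a], so that Doob's inequality becomes an induction on [k]. *)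
Fixpoint dmax k a n : R :=
  let b := Num.max a (wavg k n) in if k is k'.+1 then dmax k' b n else b.

Lemma dsum_gt0 k c : 0 < dsum k c s.
Proof.
rewrite /dsum /isum; have : (0 < 2 ^ k)%N by rewrite expn_gt0.
case: (2 ^ k)%N => // l _; rewrite big_ord_recl; apply: ltr_pwDl; first exact: s0.
by apply: sumr_ge0 => i _; apply: ltW; exact: s0.
Qed.

Lemma wavg_ge0 k n : 0 <= wavg k n.
Proof. by apply: divr_ge0; [exact: dsum_ge0|exact: ltW (dsum_gt0 _ _)]. Qed.

Lemma dmax_ge k a n : a <= dmax k a n.
Proof.
elim: k a => [|k IH] a /=; first by rewrite le_max lexx.
by apply: le_trans (IH _); rewrite le_max lexx.
Qed.

Lemma wavg_le_dmax k l a n : (l <= k)%N -> wavg l n <= dmax k a n.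
Proof.
elim: k a => [|k IH] a; first by rewrite leqn0 => /eqP ->; rewrite le_max lexx orbT.
rewrite leq_eqVlt => /predU1P[->|] /=; last exact: IH.
by apply: le_trans (dmax_ge _ _ _); rewrite le_max lexx orbT.
Qed.

Lemma young_power (x m : R) : 0 <= x -> 0 <= m ->
  x `^ p - m `^ p <= p / (p - 1) * (x `^ p - x * m `^ (p - 1)).
Proof.
move=> x0 m0; have p0 : 0 < p := lt_trans ltr01 p1.
have pm : 0 < p - 1 by rewrite subr_gt0.
have q0 : 0 < p / (p - 1) by rewrite divr_gt0.
have e : p^-1 + (p / (p - 1))^-1 = 1 by field; rewrite !gt_eqF.
have := conjugate_powR x0 (powR_ge0 m (p - 1)) p0 q0 e.
rewrite -powRrM (_ : (p - 1) * (p / (p - 1)) = p); last by field; rewrite gt_eqF.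
move: (x * _) (x `^ p) (m `^ p) => y z w h.
have h' : p / (p - 1) * y <= z / (p - 1) + w.
  apply: le_trans (ler_wpM2l (ltW q0) h) _.
  by rewrite le_eqVlt; apply/orP; left; apply/eqP; field; rewrite !gt_eqF.
have -> : p / (p - 1) * (z - y) = z + z / (p - 1) - p / (p - 1) * y.
  by field; rewrite gt_eqF.
lra.
Qed.

(** Doob's inequality step by step. When the running maximum rises from [b] to [x], [young_power]
    bounds the rise of its [p]-th power by [x] times the rise of its [(p-1)]-th power, up to
    [p / (p - 1)], and [x] times the mass of [s] is the mass of [u] on the cell. *)
Lemma dmax_cell k c a : 0 <= a ->
  dsum k c (fun n => (dmax k a n `^ p - Num.max a (wavg k (c * pw k)) `^ p) * s n)
  <= p / (p - 1) * dsum k c (fun n =>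
       (dmax k a n `^ (p - 1) - Num.max a (wavg k (c * pw k)) `^ (p - 1)) * u n).
Proof.
have q0 : 0 <= p / (p - 1) by rewrite divr_ge0// ?subr_ge0 ltW// (lt_trans ltr01).
have wc k' c' n : cell k' n = c' -> wavg k' n = wavg k' (c' * pw k').
  by move=> e; rewrite /wavg e cell_base.
elim: k c a => [|k IH] c a a0.
  rewrite !(dsum_cst (x := 0)) ?mulr0// => n e /=; rewrite (wc _ _ _ e) subrr mul0r//.
set b := Num.max a (wavg k.+1 (c * pw k.+1)).
have b0 : 0 <= b by rewrite le_max a0.
have eb n : cell k.+1 n = c -> dmax k.+1 a n = dmax k b n.
  by move=> e; rewrite /= (wc _ _ _ e).
have key d : (forall n, cell k n = d -> cell k.+1 n = c) ->
  dsum k d (fun n => (dmax k.+1 a n `^ p - b `^ p) * s n)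
  <= p / (p - 1) * dsum k d (fun n => (dmax k.+1 a n `^ (p - 1) - b `^ (p - 1)) * u n).
  move=> hd; have := IH d b b0; set b' := Num.max b _ => h.
  have b'0 : 0 <= b' by rewrite le_max b0.
  have -> : dsum k d (fun n => (dmax k.+1 a n `^ p - b `^ p) * s n) =
    dsum k d (fun n => (dmax k b n `^ p - b' `^ p) * s n) + (b' `^ p - b `^ p) * dsum k d s.
    rewrite /dsum -isumZ -isumD; apply: eq_dsum => n e.
    by rewrite eb ?hd//; move: (_ `^ _) (b' `^ _) (b `^ _) => x y z; ring.
  have -> : dsum k d (fun n => (dmax k.+1 a n `^ (p - 1) - b `^ (p - 1)) * u n) =
    dsum k d (fun n => (dmax k b n `^ (p - 1) - b' `^ (p - 1)) * u n)
     + (b' `^ (p - 1) - b `^ (p - 1)) * dsum k d u.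
    rewrite /dsum -isumZ -isumD; apply: eq_dsum => n e.
    by rewrite eb ?hd//; move: (_ `^ _) (b' `^ _) (b `^ _) => x y z; ring.
  rewrite mulrDr lerD// /b'; set x := wavg k (d * pw k).
  have sd := dsum_gt0 k d.
  case: (leP b x) => bx; last by rewrite !subrr !mul0r mulr0.
  have x0 : 0 <= x by exact: le_trans bx.
  have -> : dsum k d u = x * dsum k d s by rewrite /x /wavg cell_base divfK// gt_eqF.
  rewrite mulrA [leRHS]mulrA ler_wpM2r ?(ltW sd)//.
  apply: le_trans (young_power x0 b0) _.
  rewrite -(mulrA (p / (p - 1))) ler_wpM2l// -(mulr_powRB1 x0 (lt_trans ltr01 p1)).
  by rewrite mulrBl [x `^ _ * x]mulrC [b `^ _ * x]mulrC.
rewrite !dsumS mulrDr; apply: lerD; apply: key => n e; apply: cell_parent.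
  by left.
by right.
Qed.

(** Young's inequality with the parameter [z = 2^(1/q)], [q = p / (p - 1)], leaves exactly half of
    the maximal term on the right, which is then absorbed. *)
Definition doob_const : R := 2 `^ p / (p - 1).

Lemma dmax_Lp k c :
  dsum k c (fun n => dmax k 0 n `^ p * s n)
    <= doob_const * dsum k c (fun n => (u n / s n) `^ p * s n).
Proof.
have p0 : 0 < p := lt_trans ltr01 p1.
have pm : 0 < p - 1 by rewrite subr_gt0.
have q0 : 0 < p / (p - 1) by rewrite divr_gt0.
have := dmax_cell k c (lexx 0); set a := Num.max 0 _ => h.
have ea : a = wavg k (c * pw k) by rewrite /a; apply/max_idPr; exact: wavg_ge0.
have a0 : 0 <= a by rewrite ea wavg_ge0.
have h1 : dsum k c (fun n => dmax k 0 n `^ p * s n)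
    <= p / (p - 1) * dsum k c (fun n => dmax k 0 n `^ (p - 1) * u n).
  have e1 (r : R) (v : int -> R) : dsum k c (fun n => (dmax k 0 n `^ r - a `^ r) * v n)
      = dsum k c (fun n => dmax k 0 n `^ r * v n) - a `^ r * dsum k c v.
    by rewrite /dsum -isumZ -isumB; apply: eq_isum => n _; rewrite mulrBl.
  move: h; rewrite !e1.
  have -> : dsum k c u = a * dsum k c s.
    by rewrite ea /wavg cell_base divfK// gt_eqF// dsum_gt0.
  have -> : a `^ (p - 1) * (a * dsum k c s) = a `^ p * dsum k c s.
    by rewrite mulrA [_ * a]mulrC mulr_powRB1.
  set X := a `^ p * _; have X0 : 0 <= X by rewrite mulr_ge0 ?powR_ge0// ltW// dsum_gt0.
  have : X <= p / (p - 1) * X.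
    by rewrite ler_peMl// ler_pdivlMr// mul1r gerBl ler01.
  rewrite mulrBr; lra.
pose q := p / (p - 1).
have e : p^-1 + q^-1 = 1 by rewrite /q; field; rewrite !gt_eqF.
pose z : R := 2 `^ q^-1.
have z0 : 0 < z by rewrite powR_gt0.
have h2 : p / (p - 1) * dsum k c (fun n => dmax k 0 n `^ (p - 1) * u n) <=
   dsum k c (fun n => 2^-1 * (dmax k 0 n `^ p * s n) + doob_const / 2 * ((u n / s n) `^ p * s n)).
  rewrite -isumZ; apply: le_dsum => n _.
  set D := dmax k 0 n; have D0 : 0 <= D by exact: dmax_ge.
  have x0 : 0 <= u n / s n by rewrite divr_ge0// ltW.
  have -> : p / (p - 1) * (D `^ (p - 1) * u n) = (q * ((z * (u n / s n)) * (D `^ (p - 1) / z))) * s n.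
    by rewrite /q; field; rewrite !gt_eqF.
  rewrite (mulrA 2^-1) (mulrA (doob_const / 2)) -mulrDl ler_wpM2r ?(ltW (s0 _))//.
  have zx0 : 0 <= z * (u n / s n) by rewrite mulr_ge0// ltW.
  have Dz0 : 0 <= D `^ (p - 1) / z by rewrite divr_ge0 ?powR_ge0// ltW.
  have := conjugate_powR zx0 Dz0 p0 q0 e.
  rewrite powRM ?(ltW z0)// [(D `^ _ / z) `^ _]powRM ?powR_ge0 ?invr_ge0 ?(ltW z0)//.
  rewrite -(powRrM D) (_ : (p - 1) * q = p); last by rewrite /q; field; rewrite gt_eqF.
  have -> : z^-1 `^ q = 2^-1.
    have -> : z^-1 = z `^ (- 1) by rewrite powR_inv1// ltW.
    rewrite /z -!powRrM (_ : q^-1 * (- 1 * q) = - 1) ?powR_inv1//.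
    by rewrite mulN1r mulrN mulVf// gt_eqF.
  have -> : z `^ p = 2 `^ p / 2.
    rewrite /z -powRrM.
    have -> : q^-1 * p = p - 1 by rewrite /q; field; rewrite !gt_eqF.
    by rewrite powRB ?powRr1// implybE; apply/orP; right; rewrite pnatr_eq0.
  move=> /(ler_wpM2l (ltW q0)) /le_trans; apply.
  rewrite /doob_const /q; move: (2 `^ p) (_ `^ p) (D `^ p) => x y w.
  by rewrite le_eqVlt; apply/orP; left; apply/eqP; field; rewrite !gt_eqF.
move: (le_trans h1 h2); rewrite /dsum isumD !isumZ -!/(dsum _ _ _).
move: (dsum _ _ _) (dsum _ _ _) doob_const => x y C; lra.
Qed.

End DyadicMaximal.

(* The grid translated by [third m] is the second grid of the one-third trick. *)
Fixpoint third (m : nat) : nat := if m is m'.+1 then (4 * third m').+1 else 0.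

Lemma thirdE m : (3 * third m + 1 = 2 ^ (2 * m))%N.
Proof.
elim: m => // m IH; rewrite mulnS expnD /=; move: IH; move: (2 ^ (2 * m))%N => x IH.
by rewrite (_ : 2 ^ 2 = 4)%N//; lia.
Qed.

Lemma cell_mono k (n m : int) : n <= m -> cell k n <= cell k m.
Proof.
move=> nm; have := cell_bounds k n; have := cell_bounds k m; have := pw_gt0 k.
by move: (cell k n) (cell k m) (pw k) => x y z *; nia.
Qed.

(** If both grids cut the window of length [5 h], [h = pw K], then a point of one and a point of the
    other are less than [5 h] apart. But three times their difference is a nonzero multiple of
    [16 h] plus 1: [3 * third m + 1] is a power of 2, and its quotient by [16 h] is not divisible by
    3. The scale [K + 4] is taken because [16 > 3 * 5]. *)
Lemma two_grids (K : nat) (c : int) m : (K + 4 <= 2 * m)%N ->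
  exists2 v : int, v = 0 \/ v = (third m)%:Z &
    forall x, (c - 2) * pw K <= x < (c + 3) * pw K ->
      cell (K + 4) (x + v) = cell (K + 4) (c * pw K + v).
Proof.
move=> Km; set h := pw K; have h0 : 0 < h by exact: pw_gt0.
have inside (v : int) : cell (K + 4) ((c - 2) * h + v) = cell (K + 4) ((c + 3) * h - 1 + v) ->
    forall x, (c - 2) * h <= x < (c + 3) * h ->
      cell (K + 4) (x + v) = cell (K + 4) (c * h + v).
  move=> e x /andP[x1 x2].
  have a1 : cell (K + 4) ((c - 2) * h + v) <= cell (K + 4) (x + v) by apply: cell_mono; lia.
  have a2 : cell (K + 4) (x + v) <= cell (K + 4) ((c + 3) * h - 1 + v) by apply: cell_mono; lia.
  have a3 : cell (K + 4) ((c - 2) * h + v) <= cell (K + 4) (c * h + v) by apply: cell_mono; lia.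
  have a4 : cell (K + 4) (c * h + v) <= cell (K + 4) ((c + 3) * h - 1 + v).
    by apply: cell_mono; nia.
  lia.
have [e0|n0] := eqVneq (cell (K + 4) ((c - 2) * h + 0)) (cell (K + 4) ((c + 3) * h - 1 + 0)).
  by exists 0; [left|exact: inside].
set s : int := (third m)%:Z.
have [e1|n1] := eqVneq (cell (K + 4) ((c - 2) * h + s)) (cell (K + 4) ((c + 3) * h - 1 + s)).
  by exists s; [right|exact: inside].
exfalso.
have hM : pw (K + 4) = 16 * h by rewrite pwD mulrC.
have jump (v : int) : cell (K + 4) ((c - 2) * h + v) != cell (K + 4) ((c + 3) * h - 1 + v) ->
    exists y, (c - 2) * h + v < y * (16 * h) <= (c + 3) * h - 1 + v.
  move=> ne; have := @cell_mono (K + 4) ((c - 2) * h + v) ((c + 3) * h - 1 + v) ltac:(lia).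
  have := cell_bounds (K + 4) ((c - 2) * h + v); have := cell_bounds (K + 4) ((c + 3) * h - 1 + v).
  rewrite hM => b1 b2 le; exists (cell (K + 4) ((c + 3) * h - 1 + v)).
  move: ne le b1 b2; move: (cell _ _) (cell _ _) => x y ne le b1 b2.
  have yx : y + 1 <= x by lia.
  by apply/andP; split; [nia|lia].
have [y hy] := jump _ n0; have [y' hy'] := jump _ n1.
have hs : 3 * s = (2 ^ (2 * m - (K + 4)))%N%:Z * (16 * h) - 1.
  have := thirdE m; rewrite -{1}(subnKC Km) expnD => e.
  by rewrite -hM /s /pw; move: (2 ^ (K + 4))%N (2 ^ _)%N e => a b e; lia.
have r3 : ~~ (3 %| 2 ^ (2 * m - (K + 4)))%N by rewrite Euclid_dvdX.
move: hs r3; move: (2 ^ _)%N => r hs r3.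
have j0 : 3 * (y' - y) - r%:Z != 0.
  by apply/negP => /eqP e; move: r3; apply/negP; rewrite negbK; apply/dvdnP;
   exists (absz (y' - y)%R); lia.
have e : 3 * (y' * (16 * h) - s - y * (16 * h)) = (3 * (y' - y) - r%:Z) * (16 * h) + 1.
  have -> : 3 * (y' * (16 * h) - s - y * (16 * h)) = 3 * (y' - y) * (16 * h) - 3 * s by ring.
  by rewrite hs; ring.
move: (3 * (y' - y) - r%:Z) j0 e => j j0 e.
have : `|3 * (y' * (16 * h) - s - y * (16 * h))| < 15 * h by lia.
rewrite e; have [jp|jn] : j >= 1 \/ j <= -1 by lia.
  by nia.
by nia.
Qed.

(** * The Muckenhoupt condition on cells *)

Section ApWeights.
Context {R : realType}.
Variables (p : R) (w : int -> R).
Hypothesis p1 : 1 < p.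
Hypothesis w0 : forall n, 0 < w n.
Implicit Types (n m c : int) (k l : nat) (a : R).

(** The exponent dual to [p]; in this section [q] is not the exponent of the variation. *)
Let q := p / (p - 1).

Definition dual n : R := w n `^ (- (1 / (p - 1))).

Lemma dual_gt0 n : 0 < dual n.
Proof. exact: powR_gt0. Qed.

Let p0 : 0 < p. Proof. exact: lt_trans ltr01 p1. Qed.
Let pm0 : 0 < p - 1. Proof. by rewrite subr_gt0. Qed.
Let q0 : 0 < q. Proof. exact: divr_gt0. Qed.
Let pq : p^-1 + q^-1 = 1. Proof. by rewrite /q; field; rewrite !gt_eqF. Qed.
Let q1 : 1 < q. Proof. by rewrite /q ltr_pdivlMr// mul1r gtrBl ltr01. Qed.

(** Hoelder's inequality for [1 = w^(1/p) * dual^(1/q)] on [E]: a large [E] cannot have small mass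
    for both weights. *)
Lemma holder_card k c (E : int -> bool) : 0 < dsum k c (fun n => (E n)%:R) :> R ->
  [/\ 0 < dsum k c (fun n => (E n)%:R * w n),
      0 < dsum k c (fun n => (E n)%:R * dual n) &
   dsum k c (fun n => (E n)%:R) `^ p <=
     dsum k c (fun n => (E n)%:R * w n) * dsum k c (fun n => (E n)%:R * dual n) `^ (p - 1)].
Proof.
move=> N0.
have [n en En] : exists2 n, cell k n = c & E n.
  apply: contrapT => h; move: N0; rewrite (dsum_cst (x := 0)) ?mulr0 ?ltxx// => n en.
  by case: (boolP (E n)) => // En; exfalso; apply: h; exists n.
have pos (v : int -> R) : (forall n, 0 < v n) -> 0 < dsum k c (fun n => (E n)%:R * v n).
  move=> v0; apply: (@lt_le_trans _ _ ((E n)%:R * v n)); first by rewrite En mul1r.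
  apply: (@le_isum_point _ _ _ (fun n => (E n)%:R * v n)).
    by move=> m; rewrite mulr_ge0// ltW.
  by have := cell_bounds k n; rewrite en /pw; lia.
have a0 := pos _ w0; have b0 := pos _ dual_gt0.
split=> //.
set a := dsum k c (fun n => (E n)%:R * w n) in a0 *.
set b := dsum k c (fun n => (E n)%:R * dual n) in b0 *.
have ap : a `^ p^-1 * b `^ q^-1 = (a * b `^ (p - 1)) `^ p^-1.
  rewrite powRM ?(ltW a0) ?powR_ge0// -(powRrM b); congr (_ * _ `^ _).
  by rewrite /q invf_div.
have key : dsum k c (fun n => (E n)%:R) <= a `^ p^-1 * b `^ q^-1.
  apply: (@le_trans _ _ (dsum k c (fun n => (a `^ p^-1 * b `^ q^-1) *
     ((a * p)^-1 * ((E n)%:R * w n) + (b * q)^-1 * ((E n)%:R * dual n))))).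
    apply: le_dsum => m _; case: (E m); last by rewrite !mul0r !mulr0 addr0 mulr0.
    rewrite !mul1r.
    have x0 : 0 <= (w m / a) `^ p^-1 by exact: powR_ge0.
    have y0 : 0 <= (dual m / b) `^ q^-1 by exact: powR_ge0.
    have := conjugate_powR x0 y0 p0 q0 pq.
    rewrite -!powRrM !mulVf ?gt_eqF// !powRr1 ?divr_ge0 ?(ltW a0) ?(ltW b0) ?(ltW (w0 m)) ?(ltW (dual_gt0 m))//.
    rewrite !powRM ?invr_ge0 ?(ltW a0) ?(ltW b0) ?(ltW (w0 m)) ?(ltW (dual_gt0 m))//.
    have -> : dual m `^ q^-1 = (w m `^ p^-1)^-1.
      rewrite /dual -powRrM -powRN; congr (_ `^ _).
      by rewrite /q; field; rewrite !gt_eqF.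
    have inv (x r : R) : 0 < x -> x^-1 `^ r = (x `^ r)^-1.
      by move=> x0'; rewrite -powR_inv1 ?ltW// -powRrM mulN1r powRN.
    rewrite !inv// => h.
    have A0 : 0 < a `^ p^-1 by rewrite powR_gt0.
    have B0 : 0 < b `^ q^-1 by rewrite powR_gt0.
    have W0 : 0 < w m `^ p^-1 by rewrite powR_gt0.
    have -> : (1 : R) = (a `^ p^-1 * b `^ q^-1) *
        (w m `^ p^-1 / a `^ p^-1 * ((w m `^ p^-1)^-1 / b `^ q^-1)).
      by field; rewrite !gt_eqF.
    rewrite ler_wpM2l ?mulr_ge0 ?powR_ge0// (le_trans h)//.
    by rewrite le_eqVlt; apply/orP; left; apply/eqP; field; rewrite !gt_eqF.
  rewrite /dsum isumZ isumD !isumZ -!/(dsum _ _ _) -/a -/b.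
  have -> : (a * p)^-1 * a + (b * q)^-1 * b = p^-1 + q^-1 by field; rewrite !gt_eqF.
  by rewrite pq mulr1.
rewrite ap in key.
have := @ge0_ler_powR _ p (ltW p0) _ _ _ _ key; rewrite !nnegrE powR_ge0 (ltW N0) => /(_ isT isT).
by rewrite -powRrM mulVf ?gt_eqF// powRr1// mulr_ge0 ?powR_ge0// ltW.
Qed.

Definition ap_const (C : R) : R :=
  16 * C `^ p^-1 * ((C * 32 `^ p) `^ (p - 1)^-1 + C * 32 `^ p).

(** The product equals [(A sP^(1/p)) (B wP^(1/q)) (sP^(1/q) wP^(1/p))]. The Muckenhoupt condition
    bounds the last factor and Young's inequality the other two. Then [sP] and [wP] are replaced by
    multiples of [sE] and [wE], since [E] holds at least [1/32] of the points of the parent. *)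
Lemma ap_core (C A B sE wE sP wP h N : R) : 0 < C -> 0 <= A -> 0 <= B ->
  0 < sE -> 0 < wE -> sE <= sP -> wE <= wP -> 0 < h -> h <= 2 * N ->
  N `^ p <= wE * sE `^ (p - 1) -> wP * sP `^ (p - 1) <= C * (16 * h) `^ p ->
  (A * sP) * (B * wP) <= ap_const C * h * (A `^ p * sE + B `^ q * wE).
Proof.
move=> C0 A0 B0 sE0 wE0 sEP wEP h0 hN NE hC.
have sP0 : 0 < sP by exact: lt_le_trans sEP.
have wP0 : 0 < wP by exact: lt_le_trans wEP.
have N0 : 0 <= N by move: h0 hN; lra.
pose C1 := C * 32 `^ p; have C10 : 0 < C1 by rewrite mulr_gt0 ?powR_gt0.
have SE0 : 0 < sE `^ (p - 1) by rewrite powR_gt0.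
have SP0 : 0 < sP `^ (p - 1) by rewrite powR_gt0.
have SEP : sE `^ (p - 1) <= sP `^ (p - 1).
  by rewrite ge0_ler_powR ?nnegrE ?(ltW pm0) ?(ltW sE0) ?(ltW sP0).
have d1 : wP * sP `^ (p - 1) <= C1 * (wE * sE `^ (p - 1)).
  apply: le_trans hC _; rewrite /C1 -mulrA ler_wpM2l ?(ltW C0)//.
  apply: (@le_trans _ _ (32 `^ p * N `^ p)); last by rewrite ler_wpM2l ?powR_ge0.
  rewrite -powRM// ge0_ler_powR ?nnegrE ?(ltW p0)//; move: h0 hN; lra.
have hw : wP <= C1 * wE.
  rewrite -(ler_pM2r SE0) -mulrA; apply: le_trans d1.
  by rewrite ler_wpM2l// ltW.
have hs : sP <= C1 `^ (p - 1)^-1 * sE.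
  have : sP `^ (p - 1) <= C1 * sE `^ (p - 1).
    rewrite -(ler_pM2l wE0) mulrCA; apply: le_trans d1.
    by rewrite ler_wpM2r// ltW.
  move=> h1; have := @ge0_ler_powR _ (p - 1)^-1 _ _ _ _ _ h1.
  rewrite !nnegrE invr_ge0 (ltW pm0) powR_ge0 mulr_ge0 ?powR_ge0 ?(ltW C10)// => /(_ isT isT isT).
  by rewrite powRM ?powR_ge0 ?(ltW C10)// -!powRrM !mulfV ?gt_eqF// !powRr1// ltW.
have hg : sP `^ q^-1 * wP `^ p^-1 <= C `^ p^-1 * (16 * h).
  have -> : sP `^ q^-1 * wP `^ p^-1 = (wP * sP `^ (p - 1)) `^ p^-1.
    rewrite powRM ?(ltW wP0) ?(ltW SP0)// -(powRrM sP) mulrC; congr (_ * _ `^ _).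
    by rewrite /q invf_div.
  have := @ge0_ler_powR _ p^-1 _ _ _ _ _ hC.
  rewrite !nnegrE invr_ge0 (ltW p0) !mulr_ge0 ?powR_ge0 ?(ltW C0) ?(ltW wP0)// => /(_ isT isT isT).
  move/le_trans; apply.
  rewrite powRM ?powR_ge0 ?(ltW C0)// -powRrM mulfV ?gt_eqF// powRr1//.
  by rewrite mulr_ge0// ltW.
have hy : (A * sP `^ p^-1) * (B * wP `^ q^-1) <= A `^ p * sP + B `^ q * wP.
  have x0 : 0 <= A * sP `^ p^-1 by rewrite mulr_ge0 ?powR_ge0.
  have y0 : 0 <= B * wP `^ q^-1 by rewrite mulr_ge0 ?powR_ge0.
  have := conjugate_powR x0 y0 p0 q0 pq.
  rewrite !powRM ?powR_ge0// -!powRrM !mulVf ?gt_eqF// !powRr1 ?(ltW sP0) ?(ltW wP0)//.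
  move/le_trans; apply; rewrite lerD// ler_pdivrMr// ler_peMr ?mulr_ge0 ?powR_ge0 ?(ltW sP0) ?(ltW wP0)//.
    exact: ltW.
  exact: ltW.
have e1 : sP = sP `^ p^-1 * sP `^ q^-1.
  by rewrite -powRD ?pq ?powRr1 ?(ltW sP0)// implybE (gt_eqF sP0) orbT.
have e2 : wP = wP `^ p^-1 * wP `^ q^-1.
  by rewrite -powRD ?pq ?powRr1 ?(ltW wP0)// implybE (gt_eqF wP0) orbT.
have -> : (A * sP) * (B * wP) =
    ((A * sP `^ p^-1) * (B * wP `^ q^-1)) * (sP `^ q^-1 * wP `^ p^-1).
  by rewrite {1}e1 {1}e2; ring.
apply: (@le_trans _ _ ((A `^ p * sP + B `^ q * wP) * (C `^ p^-1 * (16 * h)))).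
  by rewrite ler_pM ?mulr_ge0 ?powR_ge0.
rewrite /ap_const -/C1.
set D := C1 `^ (p - 1)^-1; have D0 : 0 <= D by exact: powR_ge0.
have X0 : 0 <= A `^ p * sE by rewrite mulr_ge0 ?powR_ge0// ltW.
have Y0 : 0 <= B `^ q * wE by rewrite mulr_ge0 ?powR_ge0// ltW.
have : A `^ p * sP + B `^ q * wP <= (D + C1) * (A `^ p * sE + B `^ q * wE).
  have t1 := ler_wpM2l (powR_ge0 A p) hs; have t2 := ler_wpM2l (powR_ge0 B q) hw.
  apply: le_trans (lerD t1 t2) _.
  rewrite -subr_ge0 (_ : _ - _ = D * (B `^ q * wE) + C1 * (A `^ p * sE)); last by rewrite /D; ring.
  by rewrite addr_ge0// mulr_ge0// ltW.
move=> t; have G0 : 0 <= C `^ p^-1 * (16 * h) by rewrite mulr_ge0 ?powR_ge0// mulr_ge0// ltW.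
apply: le_trans (ler_wpM2r G0 t) _.
by rewrite le_eqVlt; apply/orP; left; apply/eqP; ring.
Qed.

End ApWeights.

Lemma half_absorb (R : realType) (x y z : R) : z <= y + x -> x <= z / 2 -> z <= 2 * y.
Proof. lra. Qed.

Lemma isum_restrict (R : realType) (a : int) (len : nat) (b : int) (m : nat) (F : int -> R) : (forall n, 0 <= F n) ->
  (forall n, ~~ (b <= n < b + m%:Z) -> F n = 0) -> isum a len F <= isum b m F.
Proof.
move=> F0 Fz.
pose a' := Num.min a b; pose e' := Num.max (a + len%:Z) (b + m%:Z).
have [h1 h2] : a' <= a /\ a' <= b by rewrite /a' !ge_min !lexx orbT.
have [h3 h4] : a + len%:Z <= e' /\ b + m%:Z <= e' by rewrite /e' !le_max !lexx orbT.
pose l1 := absz (b - a')%R; pose l2 := absz (e' - (b + m%:Z))%R.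
apply: (@le_trans _ _ (isum a' (l1 + (m + l2)) F)).
  by apply: isum_sub => //; rewrite /l1 /l2; lia.
rewrite !isum_cat.
have -> : a' + l1%:Z = b by rewrite /l1; lia.
rewrite [isum a' l1 F](_ : _ = 0); last first.
  rewrite (@eq_isum _ _ _ _ (fun=> 0)) ?isum_const ?mulr0// => n hn; apply: Fz.
  by rewrite /l1 in hn; lia.
rewrite [isum _ l2 F](_ : _ = 0); last first.
  rewrite (@eq_isum _ _ _ _ (fun=> 0)) ?isum_const ?mulr0// => n hn; apply: Fz.
  by rewrite /l2 in hn; lia.
by rewrite add0r addr0.
Qed.

(** * Strong bound *)

Section StrongBound.
Context {R : realType}.
Variables (p q : R) (w : int -> R) (C : R).
Hypothesis p1 : 1 < p.
Hypothesis q2 : 2 < q.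
Hypothesis w0 : forall n, 0 < w n.
Hypothesis C0 : 0 < C.
Hypothesis hAp : forall a len,
  isum a len w * isum a len (dual p w) `^ (p - 1) <= C * len%:R `^ p.
Implicit Types (n m c v : int) (k l K : nat) (f g u s : int -> R).

Let p' := p / (p - 1).
Let p0 : 0 < p. Proof. exact: lt_trans ltr01 p1. Qed.
Let pm0 : 0 < p - 1. Proof. by rewrite subr_gt0. Qed.
Let p'1 : 1 < p'. Proof. by rewrite /p' ltr_pdivlMr// mul1r gtrBl ltr01. Qed.
Definition shifted_dmax T v u s n : R :=
  dmax (fun m => u (m - v)) (fun m => s (m - v)) T 0 (n + v).

(** The 2 counts cells: a translated cell of scale [T] meets at most two cells of the coarser scale
    [T']. *)
Lemma shifted_dmax_Lp (r : R) T T' v c u s (X : R) : 1 < r -> (T <= T')%N ->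
  (forall n, 0 <= u n) -> (forall n, 0 < s n) ->
  (forall a len, isum a len (fun n => (u n / s n) `^ r * s n) <= X) ->
  dsum T c (fun n => shifted_dmax T' v u s n `^ r * s n) <= 2 * doob_const r * X.
Proof.
move=> r1 TT u0 s0 hX; set d := cell T' (c * pw T + v).
pose us m := u (m - v); pose ss m := s (m - v).
pose F m := dmax us ss T' 0 m `^ r * ss m.
have F0 m : 0 <= F m by rewrite mulr_ge0 ?powR_ge0// ltW// s0.
have e : dsum T c (fun n => shifted_dmax T' v u s n `^ r * s n) = isum (c * pw T + v) (2 ^ T) F.
  rewrite -isum_shift; apply: eq_isum => n _.
  by rewrite /F /shifted_dmax /ss addrK.
have D0 : 0 <= doob_const r by rewrite divr_ge0 ?powR_ge0// subr_ge0 ltW.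
have hd d' : dsum T' d' F <= doob_const r * X.
  have := @dmax_Lp R us ss r (fun m => u0 _) (fun m => s0 _) r1 T' d'.
  move/le_trans; apply; rewrite ler_wpM2l//.
  rewrite /dsum (isum_shift _ _ (fun n => (u n / s n) `^ r * s n)); exact: hX.
rewrite e; apply: (@le_trans _ _ (dsum T' d F + dsum T' (d + 1) F)).
  rewrite /dsum [(d + 1) * _]mulrDl mul1r -isum_cat.
  have := cell_bounds T' (c * pw T + v); rewrite -/d => hb.
  have := ler_pw TT; rewrite /pw in hb * => hp; apply: isum_sub => //; lia.
by have := hd d; have := hd (d + 1); lra.
Qed.

(* Young's inequality with parameter [tau] splits the product of the two maximal
   functions; [tau] is chosen large in [strong_const] to absorb the second term. *)
Definition sparse_density T (tau : R) f g n : R :=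
  \sum_(v <- [:: 0; (third (T + 4))%:Z])
    (tau `^ p * (shifted_dmax (T + 4) v f (dual p w) n `^ p * dual p w n)
     + shifted_dmax (T + 4) v g w n `^ p' * w n) / tau.

Lemma sparse_density_ge0 T (tau : R) f g n : 0 < tau -> 0 <= sparse_density T tau f g n.
Proof.
move=> t0; apply: sumr_ge0 => v _; rewrite divr_ge0 ?(ltW t0)// addr_ge0//.
  by rewrite mulr_ge0 ?powR_ge0// mulr_ge0 ?powR_ge0.
by rewrite mulr_ge0 ?powR_ge0// ltW.
Qed.

(** The five-cell window lies in a single cell of scale [K + 4] of one of the two grids, and the
    weighted averages [A] and [B] over that cell are below the maximal functions at every point of
    the cell [c]. *)
Lemma sparse_density_bound T K c (tau : R) f g (E : int -> bool) : 0 < tau ->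
  (forall n, 0 <= f n) -> (forall n, 0 <= g n) -> (K <= T)%N ->
  (2 ^ K)%:R <= 2 * dsum K c (fun n => (E n)%:R) :> R ->
  w5 K c f * w5 K c g <= ap_const p C * (2 ^ K)%:R *
     dsum K c (fun n => (E n)%:R * sparse_density T tau f g n).
Proof.
move=> t0 f0 g0 KT hE; have P0 := p2_gt0 (R := R) K.
have [v hv inP] : exists2 v : int, v = 0 \/ v = (third (T + 4))%:Z &
    forall x, (c - 2) * pw K <= x < (c + 3) * pw K ->
      cell (K + 4) (x + v) = cell (K + 4) (c * pw K + v).
  by apply: two_grids; lia.
set d := cell (K + 4) (c * pw K + v) in inP.
have h0 := pw_gt0 K.
have cellP' n : cell K n = c -> cell (K + 4) (n + v) = d.
  move=> en; apply: inP; have := cell_bounds K n; rewrite en.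
  by move: h0; clear; move: (pw K) => x; nia.
have lo : d * pw (K + 4) <= (c - 2) * pw K + v.
  by have := cell_bounds (K + 4) ((c - 2) * pw K + v); rewrite inP; [case/andP|nia].
have hi : (c + 3) * pw K + v <= (d + 1) * pw (K + 4).
  have := cell_bounds (K + 4) ((c + 3) * pw K - 1 + v); rewrite inP; last by nia.
  by case/andP => _; move: (_ * _) (_ * _) => x y; lia.
pose SP u := dsum (K + 4) d (fun m => u (m - v)).
have w5P u : (forall n, 0 <= u n) -> w5 K c u <= SP u.
  move=> u0; rewrite /SP /dsum isum_shift; apply: isum_sub => //.
    by move: lo; move: (d * _) ((c - 2) * _) => x y; lia.
  have -> : (2 ^ (K + 4))%N%:Z = pw (K + 4) by [].
  have -> : (5 * 2 ^ K)%N%:Z = 5 * pw K by rewrite PoszM.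
  by move: hi; rewrite !mulrDl mul1r; move: (d * _) (c * _) => x y; lia.
have N0 : 0 < dsum K c (fun n => (E n)%:R) :> R by move: P0 hE; lra.
have [wE0 sE0 hold] := holder_card p1 w0 N0.
have dsumE u : (forall n, 0 < u n) -> dsum K c (fun n => (E n)%:R * u n) <= SP u.
  move=> u0; apply: (@le_trans _ _ (dsum K c u)).
    apply: le_dsum => n _; have := u0 n.
    by case: (E n); rewrite ?mul1r ?mul0r// => /ltW.
  have u0' n : 0 <= u n by exact: ltW.
  apply: le_trans (w5P u u0'); rewrite -[c in dsum K c]addr0.
  exact: dsum_le_w5.
have Ppos u : (forall n, 0 < u n) -> 0 < SP u.
  by move=> u0; apply: (@dsum_gt0 R (fun m => u (m - v))) => n.
pose A := SP f / SP (dual p w); pose B := SP g / SP w.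
have sd := dual_gt0 p w0.
have A0 : 0 <= A by rewrite divr_ge0 ?(ltW (Ppos _ sd))//; apply: dsum_ge0.
have B0 : 0 <= B by rewrite divr_ge0 ?(ltW (Ppos _ w0))//; apply: dsum_ge0.
have core := ap_core p1 C0 (mulr_ge0 (ltW t0) A0) B0 sE0 wE0 (dsumE _ sd) (dsumE _ w0) P0 hE hold _.
have hC : SP w * SP (dual p w) `^ (p - 1) <= C * (16 * (2 ^ K)%:R) `^ p.
  rewrite /SP /dsum !isum_shift; apply: le_trans (hAp _ _) _.
  by rewrite expnD natrM mulrC [(2 ^ K)%:R * _]mulrC [C * _]mulrC.
have {core} := core hC.
have eA : A * SP (dual p w) = SP f by rewrite divfK// gt_eqF// Ppos.
have eB : B * SP w = SP g by rewrite divfK// gt_eqF// Ppos.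
rewrite -(mulrA tau) eA eB => core.
have Aw n : cell K n = c -> A <= shifted_dmax (T + 4) v f (dual p w) n.
  move=> en; rewrite /A /SP -(cellP' n en).
  by apply: (@wavg_le_dmax R (fun m => f (m - v)) (fun m => dual p w (m - v))); rewrite leq_add2r.
have Bw n : cell K n = c -> B <= shifted_dmax (T + 4) v g w n.
  move=> en; rewrite /B /SP -(cellP' n en).
  by apply: (@wavg_le_dmax R (fun m => g (m - v)) (fun m => w (m - v))); rewrite leq_add2r.
rewrite -(ler_pM2l t0); apply: (@le_trans _ _ (tau * SP f * SP g)).
  rewrite mulrA; apply: ler_pM; rewrite ?mulr_ge0 ?(ltW t0) ?isum_ge0//; last exact: w5P.
  by rewrite ler_wpM2l ?(ltW t0)// w5P.
apply: (le_trans core).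
have K0 : 0 <= ap_const p C * (2 ^ K)%:R.
  by rewrite mulr_ge0// /ap_const mulr_ge0 ?mulr_ge0 ?powR_ge0 ?addr_ge0 ?powR_ge0 ?mulr_ge0 ?powR_ge0 ?(ltW C0)// ltW.
have dZ x (F : int -> R) : x * dsum K c F = dsum K c (fun n => x * F n) by rewrite -isumZ.
have dD (F G : int -> R) : dsum K c F + dsum K c G = dsum K c (fun n => F n + G n) by rewrite -isumD.
rewrite [leRHS]mulrCA ler_wpM2l// !dZ dD; apply: le_dsum => n en.
have := mulr_ge0 (ltW t0) (sparse_density_ge0 T f g n t0).
case: (E n); rewrite ?mul1r ?mul0r ?mulr0 ?addr0// => _.
set one := fun x : int => (tau `^ p * (shifted_dmax (T + 4) x f (dual p w) n `^ p * dual p w n)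
     + shifted_dmax (T + 4) x g w n `^ p' * w n) / tau.
have one0 x : 0 <= one x.
  rewrite divr_ge0 ?(ltW t0)// addr_ge0//.
    by rewrite mulr_ge0 ?powR_ge0// mulr_ge0 ?powR_ge0.
  by rewrite mulr_ge0 ?powR_ge0// ltW.
apply: (@le_trans _ _ (tau * one v)).
  rewrite [tau * one v]mulrC /one divfK ?gt_eqF// powRM ?(ltW t0)// -mulrA; apply: lerD.
    rewrite ler_wpM2l ?powR_ge0// ler_wpM2r ?(ltW (sd n))//.
    by rewrite ge0_ler_powR ?nnegrE ?(ltW p0)// ?Aw// (le_trans A0)// Aw.
  rewrite ler_wpM2r ?(ltW (w0 n))// ge0_ler_powR ?nnegrE// ?Bw//.
    by rewrite ltW// (lt_trans ltr01).
  by rewrite (le_trans B0)// Bw.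
rewrite ler_wpM2l ?(ltW t0)// /sparse_density !big_cons big_nil addr0.
by case: hv => ->; rewrite ?lerDl ?lerDr; exact: one0.
Qed.

Lemma window_split T (F : int -> R) :
  dsum T (-1) F + dsum T 0 F = isum (- pw T) (2 ^ T + 2 ^ T) F.
Proof. by rewrite isum_cat /dsum mul0r mulN1r -/(pw T) addNr. Qed.

Definition strong_const : R :=
  let B := 400 * single_scale_const q * ap_const p C in
  let tau := 16 * B * doob_const p' + 1 in
  16 * B * (tau `^ p / tau) * doob_const p.

Lemma ap_const_ge0 : 0 <= ap_const p C.
Proof.
rewrite /ap_const; apply: mulr_ge0; first by rewrite mulr_ge0 ?powR_ge0 ?ler0n.
by rewrite addr_ge0 ?powR_ge0// mulr_ge0 ?powR_ge0// ltW.
Qed.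

Lemma strong_cutvar f (t : int -> nat -> nat) (L T : nat) (X : R) :
  (forall n, 0 <= f n) -> (forall n i, (t n i <= t n i.+1)%N) ->
  (forall a len, isum a len (fun n => f n `^ p * w n) <= X) ->
  isum (- pw T) (2 ^ T + 2 ^ T) (fun n => cutvar q f t L T n `^ p * w n)
    <= strong_const * X.
Proof.
move=> f0 tm hX.
rewrite /strong_const; set B := 400 * _ * _; set tau := 16 * B * _ + 1.
have D1 : 0 <= doob_const p by rewrite divr_ge0 ?powR_ge0// ltW.
have D2 : 0 <= doob_const p' by rewrite divr_ge0 ?powR_ge0// subr_ge0 ltW.
have B0 : 0 <= B.
  apply: mulr_ge0; last exact: ap_const_ge0.
  by apply: mulr_ge0; [exact: ler0n|exact: single_scale_const_ge0].
have tau0 : 0 < tau.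
  apply: ltr_pwDr; first exact: ltr01.
  apply: mulr_ge0; last exact: D2.
  by apply: mulr_ge0; [exact: ler0n|exact: B0].
set v := cutvar q f t L T; have v0 n : 0 <= v n by exact: cutvar_ge0.
pose Win n := - pw T <= n < - pw T + (2 ^ T + 2 ^ T)%N%:Z.
(* With this choice both [g * v] and [(g / w)^p' * w] equal [v^p * w] on the window, so [Y] is
   bounded by a multiple of [X] plus a small multiple of [Y] itself. *)
pose g n := if Win n then v n `^ (p - 1) * w n else 0.
have g0 n : 0 <= g n by rewrite /g; case: ifP => // _; rewrite mulr_ge0 ?powR_ge0// ltW.
set Y := isum _ _ (fun n => v n `^ p * w n).
have Y0 : 0 <= Y by apply: isum_ge0 => n; rewrite mulr_ge0 ?powR_ge0// ltW.
have X0 : 0 <= X by apply: le_trans (hX 0 0%N); rewrite /isum big_ord0.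
have eY : Y = dsum T (-1) (fun n => g n * v n) + dsum T 0 (fun n => g n * v n).
  rewrite window_split; apply: eq_isum => n hn; rewrite /g /Win hn.
  by rewrite -(mulr_powRB1 (v0 n) p0); ring.
have hXd a len : isum a len (fun n => (f n / dual p w n) `^ p * dual p w n) <= X.
  rewrite (@eq_isum _ _ _ _ (fun n => f n `^ p * w n)) ?hX// => n _.
  have dn := dual_gt0 p w0 n.
  rewrite powRM ?invr_ge0 ?(ltW dn)// -mulrA; congr (_ * _).
  rewrite -powR_inv1 ?(ltW dn)// /dual -!powRrM -powRD.
    rewrite (_ : _ + _ = 1) ?powRr1 ?(ltW (w0 _))//.
    by field; rewrite gt_eqF.
  by rewrite implybE (gt_eqF (w0 n)) orbT.
have ep : (p - 1) * p' = p by rewrite /p' mulrCA divff ?mulr1// gt_eqF.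
have hYd a len : isum a len (fun n => (g n / w n) `^ p' * w n) <= Y.
  have z n : (g n / w n) `^ p' * w n = if Win n then v n `^ p * w n else 0.
    rewrite /g; case: ifP => _; last by rewrite mul0r powR0 ?mul0r// gt_eqF// (lt_trans ltr01).
    have -> : v n `^ (p - 1) * w n / w n = v n `^ (p - 1) by exact: mulfK (lt0r_neq0 (w0 n)) _.
    by rewrite -powRrM ep.
  apply: le_trans (@isum_restrict R a len (- pw T) (2 ^ T + 2 ^ T) _ _ _) _.
  - by move=> n; rewrite mulr_ge0 ?powR_ge0// ltW.
  - by move=> n hn; rewrite z /Win (negbTE hn).
  - by apply: le_isum => n hn; rewrite z /Win hn.
have rec c : dsum T c (fun n => g n * v n) <= B * dsum T c (sparse_density T tau f g).
  apply: (@sparse_recursion R q f g t L q2 f0 g0 tm (sparse_density T tau f g) (ap_const p C) T ap_const_ge0) => //.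
    by move=> n; exact: sparse_density_ge0.
  by move=> K d E KT hE; exact: sparse_density_bound.
have dens c : dsum T c (sparse_density T tau f g)
    <= (tau `^ p * (4 * doob_const p * X) + 4 * doob_const p' * Y) / tau.
  rewrite /sparse_density /dsum isum_sum -!/(dsum _ _ _).
  apply: (@le_trans _ _ (\sum_(s <- [:: 0; (third (T + 4))%:Z])
     (tau `^ p * (2 * doob_const p * X) + 2 * doob_const p' * Y) / tau)).
    apply: ler_sum => s _.
    rewrite (@eq_isum _ _ _ _ (fun n => tau^-1 * (tau `^ p * (shifted_dmax (T + 4) s f (dual p w) n `^ p * dual p w n)
     + shifted_dmax (T + 4) s g w n `^ p' * w n))); last by move=> n _; rewrite mulrC.
    rewrite isumZ isumD isumZ mulrC ler_wpM2r ?invr_ge0 ?(ltW tau0)// lerD//.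
      rewrite ler_wpM2l ?powR_ge0//; apply: shifted_dmax_Lp => //; first exact: leq_addr.
      exact: dual_gt0.
    by apply: shifted_dmax_Lp => //; exact: leq_addr.
  rewrite !big_cons big_nil addr0 -mulrDl ler_wpM2r ?invr_ge0 ?(ltW tau0)//.
  have dbl (a b d x y : R) : a * (2 * b * x) + 2 * d * y + (a * (2 * b * x) + 2 * d * y)
      = a * (4 * b * x) + 4 * d * y by ring.
  by rewrite dbl.
have h1 := ler_wpM2l B0 (dens (-1)); have h2 := ler_wpM2l B0 (dens 0).
have h3 : Y <= B * ((tau `^ p * (8 * doob_const p * X) + 8 * doob_const p' * Y) / tau).
  rewrite {1}eY; apply: le_trans (lerD (le_trans (rec (-1)) h1) (le_trans (rec 0) h2)) _.
  have dbl (a b d x y z : R) : B * ((a * (4 * b * x) + 4 * d * y) / z) +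
      B * ((a * (4 * b * x) + 4 * d * y) / z) = B * ((a * (8 * b * x) + 8 * d * y) / z) by ring.
  by rewrite dbl.
have h4 : B * (8 * doob_const p' * Y) / tau <= Y / 2.
  rewrite ler_pdivrMr// /tau; have := mulr_ge0 B0 (mulr_ge0 D2 Y0).
  move: (doob_const p') (B) (Y) Y0 => d b y y0 h.
  rewrite [leLHS](_ : _ = 8 * (b * (d * y))); last by ring.
  rewrite [leRHS](_ : _ = 8 * (b * (d * y)) + y / 2); last by field.
  by rewrite lerDl divr_ge0.
have h5 : B * ((tau `^ p * (8 * doob_const p * X) + 8 * doob_const p' * Y) / tau)
   = 8 * B * (tau `^ p / tau) * doob_const p * X + B * (8 * doob_const p' * Y) / tau.
  by move: (tau `^ p) (doob_const p') => a b; field; rewrite gt_eqF.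
rewrite h5 in h3.
have h6 : Y <= 2 * (8 * B * (tau `^ p / tau) * doob_const p * X).
  exact: half_absorb h3 h4.
apply: le_trans h6 _; move: (tau `^ p / tau) (doob_const p) (B) => x y z.
by rewrite (_ : 2 * _ = 16 * z * x * y * X)//; ring.
Qed.

End StrongBound.

(** * Weak bound *)

Section WeakBound.
Context {R : realType}.
Variables (w : int -> R) (C : R).
Hypothesis w0 : forall n, 0 < w n.
Hypothesis C0 : 0 < C.
Hypothesis hA1 : forall a (len : nat) n, a <= n < a + len%:Z ->
  isum a len w <= C * len%:R * w n.
Implicit Types (n m c : int) (k l K : nat).

(* With exponent 2, so that the strong bound applies to the good part. *)
Lemma A1_A2 a (len : nat) :
  isum a len w * isum a len (dual 2 w) `^ (2 - 1) <= C * len%:R `^ 2.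
Proof.
have e21 : (2 : R) - 1 = 1 by ring.
have d2 n : dual 2 w n = (w n)^-1.
  by rewrite /dual e21 divr1 powR_inv1// ltW.
rewrite e21.
rewrite powRr1; last by apply: isum_ge0 => n; rewrite d2 invr_ge0 ltW.
rewrite (powR_mulrn 2 (ler0n _ _)).
rewrite -isumZ.
apply: (@le_trans _ _ (isum a len (fun=> C * len%:R))).
  by apply: le_isum => n hn; rewrite d2 ler_pdivrMr// hA1.
by rewrite isum_const expr2 mulrCA.
Qed.

(** By [hA1], the average of [w] over a cell is at most [5 C] times its value at any point within
    two cells, so the weight can be moved inside the average. *)
Lemma A1_shift K k c (i : int) (F : int -> R) : (k <= K)%N -> -2 <= i <= 2 ->
  (forall n, 0 <= F n) ->
  dsum K c (fun n => w n * cavg k F (n + i * pw k))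
    <= 5 * C * w5 K c (fun n => w n * F n).
Proof.
move=> kK hi F0.
have wF0 n : 0 <= w n * F n by rewrite mulr_ge0// ltW.
apply: (@le_trans _ _ (5 * C * dsum K c (fun n => w (n + i * pw k) * F (n + i * pw k)))); last first.
  rewrite ler_wpM2l ?mulr_ge0 ?(ltW C0)//.
  exact: (@le_window5 _ K c k i (fun n => w n * F n)).
rewrite -isumZ; apply: (le_dsum_cells c kK) => d.
have -> : dsum k d (fun n => w n * cavg k F (n + i * pw k))
    = dsum k d w * (dsum k (d + i) F / (2 ^ k)%:R).
  rewrite [RHS]mulrC -isumZ; apply: eq_dsum => n e.
  by rewrite mulrC /cavg cell_shift e.
rewrite [leRHS]isumZ -/(dsum _ _ _) (dsum_shift k d (fun n => w n * F n)).
have p0 := p2_gt0 (R := R) k.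
rewrite mulrA ler_pdivrMr//.
have -> : dsum k d w * dsum k (d + i) F = dsum k (d + i) (fun m => dsum k d w * F m).
  by rewrite -isumZ.
have -> : 5 * C * dsum k (d + i) (fun n => w n * F n) * (2 ^ k)%:R
    = dsum k (d + i) (fun m => (5 * C * (2 ^ k)%:R * w m) * F m).
  rewrite mulrAC -isumZ; apply: eq_isum => m _; by rewrite mulrA.
apply: le_dsum => m em; rewrite ler_wpM2r//.
have h5 : dsum k d w <= isum ((d - 2) * pw k) (5 * 2 ^ k) w.
  have -> : isum ((d - 2) * pw k) (5 * 2 ^ k) w = w5 k d w by [].
  rewrite -[d in dsum k d]addr0; apply: dsum_le_w5 => // n; exact: ltW.
apply: (le_trans h5); apply: le_trans (hA1 (n := m) _) _; last first.
  by rewrite natrM le_eqVlt; apply/orP; left; apply/eqP; ring.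
have := cell_bounds k m; rewrite em => hb; have := pw_gt0 k.
have -> : (5 * 2 ^ k)%N%:Z = 5 * pw k by rewrite PoszM.
by move: hb hi; clear; move: (pw k) => x hb hi x0; nia.
Qed.

Section Truncated.
Variables (K : nat) (f : int -> R) (lam X : R).
Hypothesis f0 : forall n, 0 <= f n.
Hypothesis lam0 : 0 < lam.
Hypothesis top : forall n, cavg K f n <= lam.
Hypothesis hX : forall a (len : nat), isum a len (fun n => w n * f n) <= X.

Local Notation st := (st K f lam).
Local Notation badpart := (badpart K f lam).

Definition stf j n : R := (st j n)%:R * f n.

Lemma stf_ge0 j n : 0 <= stf j n.
Proof. by rewrite mulr_ge0. Qed.

Lemma cavg_stf j n : cavg j (stf j) n = (st j n)%:R * cavg j f n.
Proof.
rewrite /cavg mulrA; congr (_ / _); rewrite -isumZ; apply: eq_dsum => m e.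
by rewrite /stf (st_cell _ _ _ e).
Qed.

Lemma sum_stf c : \sum_(j < K.+1) w5 K c (fun n => w n * stf j n) <= X.
Proof.
rewrite /w5 -isum_sum; apply: le_trans (hX ((c - 2) * pw K) (5 * 2 ^ K)).
apply: le_isum => n _; rewrite -mulr_sumr ler_wpM2l ?(ltW (w0 n))// -mulr_suml.
by rewrite -[leRHS]mul1r ler_wpM2r// sum_st_le1.
Qed.

(** [top] excludes stopping at scale [K], so the parent of a stopping cell exists in the scan and
    has average at most [lam]. *)
Lemma st_cavg_le j n : st j n -> cavg j f n <= 2 * lam.
Proof.
move=> /and3P[jK hj /nsP h]; have jK' : (j < K)%N.
  rewrite ltn_neqAle jK andbT; apply/negP => /eqP e.
  by move: hj; rewrite e ltNge top.
apply: le_trans (cavg_parent f0 j n) _; rewrite ler_wpM2l//.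
by apply: h; rewrite leqnn.
Qed.

Definition goodpart n : R := f n - \sum_(j < K.+1) badpart j n.

Lemma goodpart_st j n : st j n -> goodpart n = cavg j f n.
Proof.
move=> sj; have jK : (j < K.+1)%N by case/and3P: sj.
rewrite /goodpart (bigD1 (Ordinal jK))//= big1 ?addr0; last first.
  move=> i ij; rewrite /badpart; case: ifP => // si.
  by move: ij; rewrite -val_eqE/= (st_uniq si sj) eqxx.
by rewrite /badpart sj opprB addrCA subrr addr0.
Qed.

Lemma goodpart_nst n : (forall j, ~~ st j n) -> goodpart n = f n /\ f n <= lam.
Proof.
move=> h; split.
  by rewrite /goodpart big1 ?subr0// => j _; rewrite /badpart (negbTE (h j)).
have [/nsP /(_ 0%N isT)|/(notns_st (leq0n K)) [j _ sj]] := boolP (ns K f lam 0 n).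
  by rewrite cavg0.
by move: (h j); rewrite sj.
Qed.

Lemma st_or n : (exists j, st j n) \/ (forall j, ~~ st j n).
Proof.
have [?|h] := pselect (exists j, st j n); [by left|right => j].
by apply/negP => sj; apply: h; exists j.
Qed.

Lemma goodpart_bounds n : 0 <= goodpart n <= 2 * lam.
Proof.
have [[j sj]|h] := st_or n; last by have [-> hl] := goodpart_nst h; rewrite f0/=; move: lam0 hl; lra.
by rewrite (goodpart_st sj) cavg_ge0//= st_cavg_le.
Qed.

Lemma goodpart_le n : goodpart n <= f n + \sum_(j < K.+1) cavg j (stf j) n.
Proof.
have s0 (P : pred 'I_K.+1) : 0 <= \sum_(j < K.+1 | P j) cavg j (stf j) n.
  by apply: sumr_ge0 => j _; apply: cavg_ge0 => m; exact: stf_ge0.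
have [[j sj]|h] := st_or n; last by have [-> _] := goodpart_nst h; rewrite lerDl s0.
have jK : (j < K.+1)%N by case/and3P: sj.
rewrite (goodpart_st sj) (bigD1 (Ordinal jK))//= cavg_stf sj mul1r.
by rewrite addrCA lerDl addr_ge0.
Qed.

(** One factor of [goodpart] is at most [2 * lam]; the weighted sum of the other is compared with
    that of [f] by [A1_shift], on two cells of scale [K] that cover the interval. *)
Lemma goodpart_sum a (len : nat) : - pw K <= a -> a + len%:Z <= pw K ->
  isum a len (fun n => goodpart n ^+ 2 * w n) <= 2 * lam * ((2 + 10 * C) * X).
Proof.
move=> ha hl.
have h1 c : dsum K c (fun n => w n * goodpart n) <= (1 + 5 * C) * X.
  apply: (@le_trans _ _ (dsum K c (fun n => w n * f n +
      \sum_(j < K.+1) w n * cavg j (stf j) (n + 0 * pw j)))).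
    apply: le_dsum => n _; rewrite -mulr_sumr -mulrDr ler_wpM2l ?(ltW (w0 n))//.
    apply: le_trans (goodpart_le n) _; rewrite lerD2l; apply: ler_sum => j _.
    by rewrite mul0r addr0.
  rewrite /dsum isumD isum_sum mulrDl mul1r; apply: lerD; first exact: hX.
  apply: (@le_trans _ _ (\sum_(j < K.+1) 5 * C * w5 K c (fun n => w n * stf j n))).
    apply: ler_sum => j _; apply: A1_shift => //; first by rewrite -ltnS.
    by move=> n; exact: stf_ge0.
  by rewrite -mulr_sumr ler_wpM2l ?sum_stf// mulr_ge0// ltW.
apply: (@le_trans _ _ (isum (- pw K) (2 ^ K + 2 ^ K) (fun n => 2 * lam * (w n * goodpart n)))).
  apply: (@le_trans _ _ (isum (- pw K) (2 ^ K + 2 ^ K) (fun n => goodpart n ^+ 2 * w n))).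
    apply: isum_sub => // [n|]; first by rewrite mulr_ge0 ?sqr_ge0// ltW.
    by rewrite PoszD -/(pw K); move: hl; clear; move: (pw K) => x; lia.
  apply: le_isum => n _; have /andP[g0 g2] := goodpart_bounds n.
  rewrite expr2 -mulrA [goodpart n * w n]mulrC ler_wpM2r//.
  by rewrite mulr_ge0// ltW.
rewrite isumZ ler_wpM2l ?mulr_ge0 ?(ltW lam0)// -window_split.
have := h1 (-1); have := h1 0; move: (dsum K _ _) (dsum K _ _) => x y; lra.
Qed.

(** A point that is not good is within two cells of a stopping cell, where the average exceeds
    [lam]; [25 C] is five shifts times the constant of [A1_shift]. *)
Lemma notgood_weight c :
  dsum K c (fun n => w n * (~~ good K f lam 0 n)%:R) <= 25 * C * X / lam.
Proof.
rewrite ler_pdivlMr// mulrC -isumZ.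
apply: (@le_trans _ _ (dsum K c (fun n => \sum_(j < K.+1) \sum_(i <- shifts5)
    w n * cavg j (stf j) (n + i * pw j)))).
  apply: le_dsum => n _; rewrite mulrCA.
  have -> : \sum_(j < K.+1) \sum_(i <- shifts5) w n * cavg j (stf j) (n + i * pw j)
      = w n * \sum_(j < K.+1) \sum_(i <- shifts5) cavg j (stf j) (n + i * pw j).
    by rewrite mulr_sumr; apply: eq_bigr => j _; rewrite mulr_sumr.
  rewrite ler_wpM2l ?(ltW (w0 n))//.
  apply: le_trans (ler_wpM2l (ltW lam0) (@notgood_le R K f lam 0 n)) _.
  rewrite mulr_sumr; apply: ler_sum => j _; rewrite mulr_sumr; apply: ler_sum => i _.
  rewrite cavg_stf; case: (boolP (st _ _)) => s; last by rewrite mulr0 mul0r.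
  by rewrite mulr1 mul1r ltW//; case/and3P: s.
rewrite /dsum isum_sum.
apply: (@le_trans _ _ (\sum_(j < K.+1) 25 * C * w5 K c (fun n => w n * stf j n))).
  apply: ler_sum => j _; rewrite isum_sum.
  apply: (@le_trans _ _ (\sum_(i <- shifts5) 5 * C * w5 K c (fun n => w n * stf j n))).
    rewrite big_seq [leRHS]big_seq; apply: ler_sum => i; rewrite shifts5P => hi.
    apply: A1_shift => //; first by rewrite -ltnS.
    by move=> n; exact: stf_ge0.
  by rewrite !big_cons big_nil; lra.
by rewrite -mulr_sumr ler_wpM2l ?sum_stf// mulr_ge0// ltW.
Qed.

(** On a stopping cell one of the two averages in the energy is at most [2 * lam], which makes the
    bound linear in [f]. The 200 is [8 * 5] for each of five cells. *)
Lemma badpart_energy_sum c :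
  \sum_(j < K.+1) w5 K c (fun n => w n * energy j (badpart j) n) <= 200 * (C * lam * X).
Proof.
have h1 c' : \sum_(j < K.+1) dsum K c' (fun n => w n * energy j (badpart j) n)
    <= 8 * lam * (5 * C * X).
  apply: (@le_trans _ _ (\sum_(j < K.+1) 8 * lam * (5 * C * w5 K c' (fun n => w n * stf j n)))).
    apply: ler_sum => j _; have jK : (j <= K)%N by rewrite -ltnS.
    apply: (@le_trans _ _ (8 * lam * dsum K c' (fun n => w n * cavg j (stf j) (n + 0 * pw j)))).
      rewrite -isumZ; apply: le_dsum => n _; rewrite [leRHS]mulrCA ler_wpM2l ?(ltW (w0 n))//.
      rewrite mul0r addr0 cavg_stf; apply: le_trans (energy_badpart _ _ f0 _ _) _.
      case: (boolP (st j n)) => s; last by rewrite !mul0r mulr0.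
      rewrite !mul1r expr2 mulrA ler_wpM2r ?cavg_ge0//.
      by move: lam0 (st_cavg_le s); lra.
    rewrite ler_wpM2l ?mulr_ge0 ?(ltW lam0)//; apply: A1_shift => // n.
    exact: stf_ge0.
  by rewrite -!mulr_sumr ler_wpM2l ?mulr_ge0 ?(ltW lam0)// ler_wpM2l ?sum_stf// mulr_ge0// ltW.
under eq_bigr do rewrite w5E.
rewrite !big_split/=.
apply: le_trans (lerD (lerD (lerD (lerD (h1 _) (h1 _)) (h1 _)) (h1 _)) (h1 _)) _.
by rewrite le_eqVlt; apply/orP; left; apply/eqP; ring.
Qed.

(** Bad parts of scale above [k] vanish on a window of scale [k] around a good point, as nothing
    there stops at scale [k] or above. Only [j <= k] remains, and the geometric decay applies. *)
Lemma badpart_variation2 n (t : nat -> nat) L : good K f lam 0 n ->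
  (forall i, (t i <= t i.+1)%N) -> (forall i, (t i < 2 ^ K.+1)%N) ->
  \sum_(i < L) (rav (t i) (fun m => \sum_(j < K.+1) badpart j m) n
      - rav (t i.+1) (fun m => \sum_(j < K.+1) badpart j m) n) ^+ 2
  <= 800 * \sum_(k < K.+1) \sum_(j < k.+1) (4 / 5) ^+ (k - j)
           * \sum_(i <- shifts5) cavg k (energy j (badpart j)) (n + i * pw k).
Proof.
move=> hg tm ht.
pose ch k N : R := (blo k <= N <= bhi K k)%N%:R.
pose b m : R := \sum_(j < K.+1) badpart j m.
pose v k m : R := \sum_(j < k.+1) badpart j m.
have hlev N : (lev K N <= K)%N by rewrite /lev geq_minl.
have hy k N : (k <= K)%N -> ch k N * rav N b n = ch k N * rav N (v k) n.
  move=> hk; rewrite /ch; case: (boolP (_ <= _ <= _)%N) => hN; last by rewrite !mul0r.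
  congr (_ * _); apply: eq_rav => m hm.
  have nsm : ns K f lam k m.
    apply: (good_ns (good_le (leq0n k) hg)); apply: window_near hm.
    by have := blo_ge k; have := bhi_le K k; lia.
  rewrite /b /v -!(big_mkord xpredT (fun j => badpart j m)) (big_cat_nat (n := k.+1))//=.
  rewrite [X in _ + X]big_nat [X in _ + X]big1 ?addr0// => j /andP[kj _].
  rewrite /badpart; case: ifP => // sj.
  by move: (st_ns sj); rewrite (ns_le (ltnW kj) nsm).
apply: (@le_trans _ _ (\sum_(i < L) 2 * \sum_(k < K.+1)
    (ch k (t i) * rav (t i) (v k) n - ch k (t i.+1) * rav (t i.+1) (v k) n) ^+ 2)).
  apply: ler_sum => i _.
  have := @sqr_diff_single R K (fun=> rav (t i) b n) (fun=> rav (t i.+1) b n)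
    predT _ _ (hlev (t i)) (hlev (t i.+1)) isT isT.
  move/le_trans; apply; rewrite ler_wpM2l//; apply: ler_sum => k _.
  have kK : (k <= K)%N by rewrite -ltnS.
  by rewrite -!lev_block// -!/(ch _ _) !hy.
rewrite -mulr_sumr exchange_big/= [leRHS](_ : _ = 2 * \sum_(k < K.+1) 400 *
   \sum_(j < k.+1) (4 / 5) ^+ (k - j)
           * \sum_(i <- shifts5) cavg k (energy j (badpart j)) (n + i * pw k)); last first.
  by rewrite -mulr_sumr mulrA -natrM.
rewrite ler_wpM2l//; apply: ler_sum => k _; have kK : (k <= K)%N by rewrite -ltnS.
have := @block_variation2_meanzero_sum _ k (blo k) (bhi K k) t L badpart n tm
   (blo_bhi kK) (blo_ge k) (bhi_le K k) (fun j c _ => dsum_badpart K f lam j c).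
move/le_trans; apply; rewrite ler_wpM2l ?ler0n//.
by apply: ler_sum => j _; rewrite w5_cavg.
Qed.

Lemma badpart_weight (t : int -> nat -> nat) L c :
  (forall n i, (t n i <= t n i.+1)%N) -> (forall n i, (t n i < 2 ^ K.+1)%N) ->
  dsum K c (fun n => w n * ((good K f lam 0 n)%:R *
    \sum_(i < L) (rav (t n i) (fun m => \sum_(j < K.+1) badpart j m) n
      - rav (t n i.+1) (fun m => \sum_(j < K.+1) badpart j m) n) ^+ 2))
  <= 800 * (5 * (25 * C * (200 * (C * lam * X)))).
Proof.
move=> tm ht.
pose en j := energy j (badpart j).
have en0 j n : 0 <= en j n by exact: energy_ge0.
apply: (@le_trans _ _ (dsum K c (fun n => 800 * \sum_(k < K.+1) \sum_(j < k.+1) (4 / 5) ^+ (k - j)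
           * \sum_(i <- shifts5) w n * cavg k (en j) (n + i * pw k)))).
  apply: le_dsum => n _.
  have -> : 800 * \sum_(k < K.+1) \sum_(j < k.+1) (4 / 5) ^+ (k - j)
           * \sum_(i <- shifts5) w n * cavg k (en j) (n + i * pw k)
     = w n * (800 * \sum_(k < K.+1) \sum_(j < k.+1) (4 / 5) ^+ (k - j)
           * \sum_(i <- shifts5) cavg k (en j) (n + i * pw k)).
    rewrite [RHS]mulrCA; congr (_ * _); rewrite mulr_sumr; apply: eq_bigr => k _.
    rewrite mulr_sumr; apply: eq_bigr => j _; rewrite mulrCA -mulr_sumr//.
  rewrite ler_wpM2l ?(ltW (w0 n))//; case: (boolP (good K f lam 0 n)) => hg.
    by rewrite mul1r; exact: badpart_variation2.
  rewrite mul0r mulr_ge0 ?ler0n//; apply: sumr_ge0 => k _; apply: sumr_ge0 => j _.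
  rewrite mulr_ge0 ?exprn_ge0//; apply: sumr_ge0 => i _.
  by apply: cavg_ge0; exact: en0.
rewrite /dsum isumZ ler_wpM2l ?ler0n// isum_sum.
pose a j := 25 * C * w5 K c (fun n => w n * en j n).
have a0 j : 0 <= a j.
  by rewrite mulr_ge0 ?mulr_ge0 ?(ltW C0)//; apply: isum_ge0 => n; rewrite mulr_ge0// ltW.
apply: (@le_trans _ _ (\sum_(k < K.+1) \sum_(j < k.+1) (4 / 5) ^+ (k - j) * a j)).
  apply: ler_sum => k _; rewrite isum_sum; apply: ler_sum => j _.
  rewrite isumZ ler_wpM2l ?exprn_ge0// isum_sum.
  apply: (@le_trans _ _ (\sum_(i <- shifts5) 5 * C * w5 K c (fun n => w n * en j n))).
    rewrite big_seq [leRHS]big_seq; apply: ler_sum => i; rewrite shifts5P => hi.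
    by apply: A1_shift => //; rewrite -ltnS.
  by rewrite /a !big_cons big_nil; lra.
apply: le_trans (geometric_double_sum K.+1 a0) _.
by rewrite ler_wpM2l// /a -mulr_sumr ler_wpM2l ?badpart_energy_sum// mulr_ge0// ltW.
Qed.

End Truncated.
End WeakBound.

Section WeakTypeBound.
Context {R : realType}.
Variables (q : R) (w : int -> R) (C : R).
Hypothesis q2 : 2 < q.
Hypothesis w0 : forall n, 0 < w n.
Hypothesis C0 : 0 < C.
Hypothesis hA1 : forall a (len : nat) n, a <= n < a + len%:Z ->
  isum a len w <= C * len%:R * w n.
Implicit Types (n m c : int) (k l K : nat).

Definition weak_const : R :=
  4 * (strong_const 2 q C * (2 * (2 + 10 * C))) +
  (22 * (2 * (800 * (5 * (25 * C * (200 * C))))) + 2 * (25 * C)).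

(** If [V > lam] at a good point, then [Vh] or [Vb] exceeds [lam / 2]. The first case is Chebyshev's
    inequality; in the second the bound with [lam / 8] forces [Sb >= 3/64 lam^2], and
    [22 > 64/3]. *)
Lemma indicator_le (lam V Vh Vb Sb : R) (b : bool) : 0 < lam -> 0 <= Vh -> 0 <= Sb ->
  V <= Vh + Vb -> Vb <= lam / 8 * (1 + Sb / (lam / 8) ^+ 2) ->
  (lam < V)%R%:R <= 4 / lam ^+ 2 * Vh ^+ 2 + (22 / lam ^+ 2 * (b%:R * Sb) + (~~ b)%:R).
Proof.
move=> l0 h0 s0 hV hb.
have l20 : 0 < lam ^+ 2 by rewrite exprn_gt0.
have t1 : 0 <= 4 / lam ^+ 2 * Vh ^+ 2 by rewrite mulr_ge0 ?sqr_ge0// divr_ge0// ltW.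
have t2 : 0 <= 22 / lam ^+ 2 * (b%:R * Sb).
  by apply: mulr_ge0; [rewrite divr_ge0 ?ler0n// ltW|rewrite mulr_ge0].
have [lV|_] := ltrP lam V; last by rewrite !addr_ge0.
case: b t2 => t2 /=; last by rewrite -[leLHS]add0r lerD// lerDr.
rewrite addr0 mul1r in t2 *.
have [h1|h1] := lerP Vh (lam / 2); last first.
  rewrite -[leLHS]addr0 lerD// mulrAC ler_pdivlMr// mul1r.
  have -> : lam ^+ 2 = 4 * (lam / 2) ^+ 2 by field.
  rewrite ler_wpM2l// lerXn2r ?nnegrE ?(ltW h1)//; first by rewrite divr_ge0// ltW.
rewrite -[leLHS]add0r lerD// mulrAC ler_pdivlMr// mul1r.
have e : lam / 8 * (1 + Sb / (lam / 8) ^+ 2) = lam / 8 + 8 * Sb / lam.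
  by field; rewrite gt_eqF.
rewrite e in hb.
have h3 : 3 / 8 * lam <= 8 * Sb / lam by move: hb hV lV h1; lra.
by move: h3 s0; rewrite ler_pdivlMr// expr2; lra.
Qed.

Lemma weak_cutvar (f : int -> R) (t : int -> nat -> nat) (L T : nat) (lam X : R) :
  (forall n, 0 <= f n) -> (forall n i, (t n i <= t n i.+1)%N) -> 0 < lam ->
  (forall a len, isum a len (fun n => w n * f n) <= X) ->
  isum (- pw T) (2 ^ T + 2 ^ T) (fun n => (lam < cutvar q f t L T n)%R%:R * w n)
    <= weak_const * (X / lam).
Proof.
move=> f0 tm lam0 hX.
have X0 : 0 <= X by apply: le_trans (hX 0 0%N); rewrite /isum big_ord0.
have q1 : 1 <= q by rewrite ltW// (lt_trans _ q2)// ltr1n.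
have T0 := pw_gt0 T.
(* [f] is cut to a window containing every point that [cutvar] at scale [T] can see. Its total mass
   is then finite, which yields a scale [K] at which all averages are at most [lam], as the stopping
   scan requires. *)
pose Big n := - (4 * pw T) <= n < - (4 * pw T) + (8 * 2 ^ T)%N%:Z.
pose F n := if Big n then f n else 0.
have F0 n : 0 <= F n by rewrite /F; case: ifP.
have Ff n : F n <= f n by rewrite /F; case: ifP.
have FX a len : isum a len (fun n => w n * F n) <= X.
  by apply: le_trans (hX a len); apply: le_isum => n _; rewrite ler_wpM2l// ltW.
pose S := isum (- (4 * pw T)) (8 * 2 ^ T) f.
have [K TK SK] : exists2 K, (T + 2 <= K)%N & S <= lam * (2 ^ K)%:R.
  pose M := Num.bound (S / lam); exists (T + 2 + M)%N; first exact: leq_addr.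
  have S0 : 0 <= S / lam by rewrite divr_ge0 ?isum_ge0// ltW.
  rewrite mulrC -ler_pdivrMr//; apply: le_trans (ltW (archi_boundP S0)) _.
  rewrite ler_nat; apply: leq_trans (ltnW (ltn_expl _ (isT : (1 < 2)%N))) _.
  by rewrite leq_exp2l// leq_addl.
have hS a len : isum a len F <= S.
  apply: le_trans (@isum_restrict R a len (- (4 * pw T)) (8 * 2 ^ T)%N F F0 _) _.
    by move=> n hn; rewrite /F /Big (negbTE hn).
  by apply: le_isum => n _; exact: Ff.
have top n : cavg K F n <= lam.
  by rewrite /cavg ler_pdivrMr ?p2_gt0// (le_trans (hS _ _)).
have KT4 : 4 * pw T <= pw K.
  by rewrite -(subnKC TK) !pwD; have := pw_gt0 (K - (T + 2)); rewrite /pw; nia.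
pose h := goodpart K F lam; pose b m := \sum_(j < K.+1) badpart K F lam j m.
have h0 n : 0 <= h n by have /andP[] := goodpart_bounds F0 lam0 top n.
have Fhb n : F n = h n + b n by rewrite /h /goodpart /b subrK.
have hz n : ~~ (- pw K <= n < - pw K + (2 ^ K + 2 ^ K)%N%:Z) -> h n = 0.
  move=> hn.
  have hn' : n < - pw K \/ pw K <= n by move: hn; rewrite PoszD -/(pw K); lia.
  have Fz m : m < - pw K \/ pw K <= m -> F m = 0.
    move=> hm; rewrite /F /Big; case: ifP => // hb; exfalso.
    have e8 : (8 * 2 ^ T)%N%:Z = 8 * pw T by rewrite PoszM.
    by move: hb; rewrite e8; move: KT4 hm T0; clear; lia.
  have nst j : ~~ st K F lam j n.
    apply/negP => /and3P[jK + _]; apply/negP; rewrite -leNgt /cavg (dsum_cst (x := 0)).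
      by rewrite mulr0 mul0r ltW.
    move=> m em; apply: Fz; have e := cell_eq jK em.
    have hc (z : int) : z < - pw K \/ pw K <= z <-> cell K z <= -2 \/ 1 <= cell K z.
      have := cell_bounds K z; have := pw_gt0 K; clear.
      by move: (cell K z) (pw K) => x y y0 hb; split => hh; nia.
    by apply/hc; rewrite e; apply/hc.
  have [e _] := goodpart_nst nst.
  by rewrite /h e Fz.
pose X2 := 2 * lam * ((2 + 10 * C) * X).
have hX2 a len : isum a len (fun n => h n `^ 2 * w n) <= X2.
  rewrite (@eq_isum _ _ _ _ (fun n => h n ^+ 2 * w n)); last first.
    by move=> n _; rewrite (powR_mulrn 2 (h0 n)).
  apply: le_trans (@isum_restrict R a len (- pw K) (2 ^ K + 2 ^ K)%N _ _ _) _.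
  - by move=> n; rewrite mulr_ge0 ?sqr_ge0// ltW.
  - by move=> n /hz ->; rewrite expr0n mul0r.
  - by apply: (goodpart_sum w0 C0 hA1 F0 lam0 top FX) => //; rewrite PoszD -/(pw K); lia.
have p12 : (1 : R) < 2 by rewrite ltr1n.
have strong := strong_cutvar p12 q2 w0 C0 (A1_A2 w0 hA1) L T h0 tm hX2.
pose t' n i := minn (2 ^ T.+1).-1 (t n i).
have tm' n i : (t' n i <= t' n i.+1)%N.
  by rewrite /t' leq_min geq_minl/= (leq_trans (geq_minr _ _)).
have p2T : (0 < 2 ^ T.+1)%N by rewrite expn_gt0.
have tT n i : (t' n i < 2 ^ T.+1)%N.
  by rewrite /t' (leq_ltn_trans (geq_minl _ _))// prednK.
have tK n i : (t' n i < 2 ^ K.+1)%N.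
  apply: leq_trans (tT n i) _; rewrite leq_exp2l// ltnS.
  exact: leq_trans (leq_addr _ _) TK.
pose Sb n := \sum_(i < L) (rav (t' n i) b n - rav (t' n i.+1) b n) ^+ 2.
have Sb0 n : 0 <= Sb n by apply: sumr_ge0 => i _; exact: sqr_ge0.
pose G n := good K F lam 0 n.
have bw c := badpart_weight w0 C0 hA1 F0 lam0 top FX L c tm' tK.
have nw c := notgood_weight w0 C0 hA1 K F0 lam0 FX c.
apply: (@le_trans _ _ (isum (- pw T) (2 ^ T + 2 ^ T) (fun n =>
   4 / lam ^+ 2 * (cutvar q h t L T n `^ 2 * w n) +
   (22 / lam ^+ 2 * (w n * ((G n)%:R * Sb n)) + w n * (~~ G n)%:R)))).
  apply: le_isum => n hn.
  have eF : cutvar q f t L T n = cutvar q F t L T n.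
    have ef N : rav (minn (2 ^ T.+1).-1 N) f n = rav (minn (2 ^ T.+1).-1 N) F n.
      apply: eq_rav => m hm; rewrite /F /Big.
      have := geq_minl (2 ^ T.+1).-1 N; move: hm; set M := minn _ _ => hm hM.
      have e2 := expnS 2 T.
      rewrite (_ : _ && _ = true)//.
      by move: hm hM e2 hn p2T; rewrite /pw; clear; lia.
    by apply: eq_pnorm => i; rewrite !ef.
  have hV : cutvar q F t L T n <= cutvar q h t L T n +
      pnorm q L (fun i => rav (t' n i) b n - rav (t' n i.+1) b n).
    have -> : cutvar q F t L T n = pnorm q L (fun i =>
        (rav (t' n i) h n - rav (t' n i.+1) h n) + (rav (t' n i) b n - rav (t' n i.+1) b n)).
      apply: eq_pnorm => i.
      have eN N : rav N F n = rav N h n + rav N b n.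
        by rewrite -ravD; apply: eq_rav => m _; exact: Fhb.
      by rewrite !eN -!/(t' n _); ring.
    exact: minkowski_pnorm.
  have lam8 : 0 < lam / 8 by rewrite divr_gt0.
  have hb := pnorm_le_sqr L (fun i => rav (t' n i) b n - rav (t' n i.+1) b n) (ltW q2) lam8.
  rewrite -mulr_suml -/(Sb n) in hb.
  have := indicator_le (G n) lam0 (cutvar_ge0 q h t L T n) (Sb0 n) hV hb.
  rewrite eF => /(ler_wpM2r (ltW (w0 n)))/le_trans; apply.
  rewrite (powR_mulrn 2 (cutvar_ge0 q h t L T n)).
  move: (cutvar _ _ _ _ _ _ ^+ 2) (lam ^+ 2) (Sb n) => x y z.
  by rewrite le_eqVlt; apply/orP; left; apply/eqP; ring.
rewrite isumD isumZ isumD isumZ.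
have toK (H : int -> R) (B : R) : (forall n, 0 <= H n) -> (forall c, dsum K c H <= B) ->
    isum (- pw T) (2 ^ T + 2 ^ T) H <= 2 * B.
  move=> H0 hB; apply: le_trans (@isum_sub _ _ (- pw K) _ (2 ^ K + 2 ^ K)%N _ H0 _ _) _.
  - by move: KT4 T0; clear; lia.
  - by rewrite !PoszD -!/(pw _); move: KT4 T0; clear; lia.
  - by rewrite -window_split mulr_natl mulr2n lerD.
have lq : 0 < lam ^+ 2 by rewrite exprn_gt0.
have i1 : 4 / lam ^+ 2 * isum (- pw T) (2 ^ T + 2 ^ T) (fun n => cutvar q h t L T n `^ 2 * w n)
    <= 4 / lam ^+ 2 * (strong_const 2 q C * X2).
  by apply: ler_wpM2l => //; rewrite divr_ge0 ?ler0n// ltW.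
have i2 : 22 / lam ^+ 2 * isum (- pw T) (2 ^ T + 2 ^ T) (fun n => w n * ((G n)%:R * Sb n))
    <= 22 / lam ^+ 2 * (2 * (800 * (5 * (25 * C * (200 * (C * lam * X)))))).
  apply: ler_wpM2l; first by rewrite divr_ge0 ?ler0n// ltW.
  by apply: toK => // n; apply: mulr_ge0; [exact: ltW|apply: mulr_ge0].
have i3 : isum (- pw T) (2 ^ T + 2 ^ T) (fun n => w n * (~~ G n)%:R) <= 2 * (25 * C * X / lam).
  by apply: toK => // n; apply: mulr_ge0; [exact: ltW|exact: ler0n].
apply: le_trans (lerD i1 (lerD i2 i3)) _.
rewrite /weak_const /X2 le_eqVlt; apply/orP; left; apply/eqP.
by move: (strong_const 2 q C) => sc; field; rewrite gt_eqF.
Qed.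

End WeakTypeBound.

(** * Linearisation *)

Section ComplexAverages.
Context {R : realType}.
Implicit Types (f : int -> R[i]) (n : int) (N : nat) (z : R[i]).

Lemma cabsE z : cabs z = Num.sqrt (complex.Re z ^+ 2 + complex.Im z ^+ 2).
Proof. by case: z. Qed.

Lemma cabs_le z : cabs z <= `|complex.Re z| + `|complex.Im z|.
Proof.
rewrite cabsE -[leRHS]ger0_norm ?addr_ge0// -sqrtr_sqr ler_wsqrtr//.
rewrite sqrrD !real_normK ?num_real// addrAC lerDl.
by rewrite mulrn_wge0// mulr_ge0.
Qed.

Lemma Re_le_cabs z : `|complex.Re z| <= cabs z.
Proof. by rewrite cabsE -sqrtr_sqr ler_wsqrtr// lerDl sqr_ge0. Qed.

Lemma Im_le_cabs z : `|complex.Im z| <= cabs z.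
Proof. by rewrite cabsE -sqrtr_sqr ler_wsqrtr// lerDr sqr_ge0. Qed.

Lemma cabs_real (x : R) : cabs (x%:C)%C = `|x|.
Proof. by rewrite cabsE /= expr0n addr0 sqrtr_sqr. Qed.

Lemma ReD : {morph (@complex.Re R) : x y / x + y}. Proof. by case=> ? ? []. Qed.

Lemma ImD : {morph (@complex.Im R) : x y / x + y}. Proof. by case=> ? ? []. Qed.

Lemma avg_coords f N n :
  complex.Re (avg N f n) = rav N (fun m => complex.Re (f m)) n /\
  complex.Im (avg N f n) = rav N (fun m => complex.Im (f m)) n.
Proof.
rewrite /avg /rav /isum.
have -> : (N.*2.+1%:R : R[i])^-1 = ((N.*2.+1%:R)^-1)%:C%C by rewrite fmorphV rmorph_nat.
have sh (i : 'I_N.*2.+1) : n + (i%:Z - N%:Z) = n - N%:Z + i%:Z by ring.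
have -> : \sum_(i < N.*2.+1) f (n + (i%:Z - N%:Z)) = \sum_(i < N.*2.+1) f (n - N%:Z + i%:Z).
  by apply: eq_bigr => i _; rewrite sh.
rewrite -(big_morph _ ReD (erefl : complex.Re (0 : R[i]) = 0)).
rewrite -(big_morph _ ImD (erefl : complex.Im (0 : R[i]) = 0)).
by case: (\sum_(i < _) _) => a b; split; rewrite /= ?mul0r ?subr0 ?addr0.
Qed.

Definition part (s : 'I_4) f n : R :=
  if val s == 0%N then Num.max (complex.Re (f n)) 0
  else if val s == 1%N then Num.max (- complex.Re (f n)) 0
  else if val s == 2 then Num.max (complex.Im (f n)) 0
  else Num.max (- complex.Im (f n)) 0.

Lemma part_ge0 s f n : 0 <= part s f n.
Proof. by rewrite /part; do ?case: ifP => _; rewrite le_max lexx orbT. Qed.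

Lemma part_le s f n : part s f n <= cabs (f n).
Proof.
have c0 : 0 <= cabs (f n) by rewrite cabsE sqrtr_ge0.
have hr := Re_le_cabs (f n); have hi := Im_le_cabs (f n).
move: hr hi; rewrite !ler_norml => /andP[r1 r2] /andP[i1 i2].
by rewrite /part; do ?case: ifP => _; rewrite ge_max c0 andbT//; lra.
Qed.

Lemma max_diff (x : R) : x = Num.max x 0 - Num.max (- x) 0.
Proof. by rewrite /Num.max; case: ifP => h1; case: ifP => h2; lra. Qed.

Lemma cabs_avg_diff f n (N M : nat) :
  cabs (avg N f n - avg M f n) <= \sum_(s < 4) `|rav N (part s f) n - rav M (part s f) n|.
Proof.
apply: le_trans (cabs_le _) _; rewrite !ReD !ImD.
have -> : complex.Re (- avg M f n) = - complex.Re (avg M f n) by case: (avg M f n).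
have -> : complex.Im (- avg M f n) = - complex.Im (avg M f n) by case: (avg M f n).
have [-> ->] := avg_coords f N n; have [-> ->] := avg_coords f M n.
rewrite !big_ord_recl big_ord0 addr0.
have dec (u v1 v2 : int -> R) : (forall m, u m = v1 m - v2 m) ->
   `|rav N u n - rav M u n| <= `|rav N v1 n - rav M v1 n| + `|rav N v2 n - rav M v2 n|.
  move=> h; have e k : rav k u n = rav k v1 n - rav k v2 n.
    rewrite -[X in _ - X]mul1r -mulNr -ravZ -ravD; apply: eq_rav => m _.
    by rewrite h mulN1r.
  by rewrite !e (_ : _ - _ = (rav N v1 n - rav M v1 n) - (rav N v2 n - rav M v2 n)) ?ler_normB//; ring.
rewrite addrA; apply: lerD; apply: dec => m; exact: max_diff.
Qed.

(** A value below the supremum is exceeded along one sequence, and already by a partial sum of its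
    series. *)
Lemma vnorm_gt (q c : R) (a : nat -> R[i]) : 0 < q -> 0 <= c -> (c%:E < vnorm q a)%E ->
  exists (t : nat -> nat) (L : nat), (forall i, (t i <= t i.+1)%N) /\
    c < pnorm q L (fun i => cabs (a (t i) - a (t i.+1))).
Proof.
move=> q0 c0 /ereal_sup_gt [y [N incN <-]] cy.
have h0 j : (0 <= (cabs (a (N j) - a (N j.+1)) `^ q)%:E)%E by rewrite lee_fin powR_ge0.
have S0 : (0 <= \sum_(0 <= j <oo) (cabs (a (N j) - a (N j.+1)) `^ q)%:E)%E.
  by apply: nneseries_ge0 => j _ _.
have cS : ((c `^ q)%:E < \sum_(0 <= j <oo) (cabs (a (N j) - a (N j.+1)) `^ q)%:E)%E.
  rewrite ltNge; apply/negP => hS.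
  move: cy; rewrite ltNge => /negP; apply.
  have iq : 0 <= q^-1 by rewrite invr_ge0 ltW.
  have -> : c%:E = ((c `^ q)%:E `^ q^-1)%E.
    by rewrite poweR_EFin -powRrM mulfV ?gt_eqF// powRr1.
  by apply: gt0_ler_poweR => //; rewrite in_itv/= leey ?andbT// lee_fin powR_ge0.
exists N.
have [L hL] : exists L, c `^ q < \sum_(i < L) cabs (a (N i) - a (N i.+1)) `^ q.
  apply: contrapT => hn.
  have : (\sum_(0 <= j <oo) (cabs (a (N j) - a (N j.+1)) `^ q)%:E <= (c `^ q)%:E)%E.
    apply: lime_le; first by apply: is_cvg_nneseries => j _ _.
    apply: nearW => L /=; rewrite sumEFin lee_fin big_mkord leNgt; apply/negP => h.
    by apply: hn; exists L.
  by rewrite leNgt cS.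
exists L; split; first by move=> i; rewrite -[(_ <= _)%N]/((N i <= N i.+1)%O) incN.
rewrite ltNge; apply/negP => h; move: hL; apply/negP; rewrite -leNgt.
have := @ge0_ler_powR _ q (ltW q0) _ _ _ _ h; rewrite !nnegrE pnorm_ge0 c0 => /(_ isT isT).
rewrite pnorm_powR ?gt_eqF//; apply: le_trans; apply: ler_sum => i _.
by rewrite ger0_norm// cabsE sqrtr_ge0.
Qed.

Lemma le_pnorm_lt (q : R) L (a b : nat -> R) : 0 <= q ->
  (forall i, (i < L)%N -> `|a i| <= `|b i|) -> pnorm q L a <= pnorm q L b.
Proof.
move=> q0 ab; rewrite /pnorm ge0_ler_powR ?nnegrE ?invr_ge0 ?sum_powR_ge0//.
by apply: ler_sum => i _; rewrite ge0_ler_powR ?nnegrE// ab.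
Qed.

Lemma pnorm_mono (q : R) L L' (a : nat -> R) : 0 < q -> (L <= L')%N ->
  pnorm q L a <= pnorm q L' a.
Proof.
move=> q0 LL; rewrite /pnorm ge0_ler_powR ?nnegrE ?sum_powR_ge0 ?invr_ge0 ?(ltW q0)//.
rewrite -!(big_mkord xpredT (fun i => `|a i| `^ q)) [leRHS](big_cat_nat (n := L))//=.
by rewrite lerDl; apply: sumr_ge0 => i _; exact: powR_ge0.
Qed.

Lemma pnorm_sum (q : R) L (I : Type) (r : seq I) (b : I -> nat -> R) : 1 <= q ->
  pnorm q L (fun i => \sum_(s <- r) b s i) <= \sum_(s <- r) pnorm q L (b s).
Proof.
move=> q1; have q0 : 0 < q by lra.
elim: r => [|s r IH].
  rewrite big_nil (@eq_pnorm _ q L _ (fun=> 0)); last by move=> i; rewrite big_nil.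
  rewrite /pnorm big1 ?powR0 ?invr_neq0 ?gt_eqF// => i _.
  by rewrite normr0 powR0 ?gt_eqF.
rewrite big_cons (@eq_pnorm _ q L _ (fun i => b s i + \sum_(s' <- r) b s' i)).
  by apply: le_trans (minkowski_pnorm _ _ _ q1) _; rewrite lerD2l.
by move=> i; rewrite big_cons.
Qed.

(* Below finitely many values [c n] of [VqA q f n], the defining suprema are
   attained along finite sequences of a common length and range. *)
Lemma linearize (q : R) f (F : seq int) (c : int -> R) : 2 < q ->
  (forall n, n \in F -> 0 <= c n) ->
  (forall n, n \in F -> c n = 0 \/ ((c n)%:E < VqA q f n)%E) ->
  exists (t : int -> nat -> nat) (L T : nat),
    [/\ forall n i, (t n i <= t n i.+1)%N,
        forall n, n \in F -> - pw T <= n < - pw T + (2 ^ T + 2 ^ T)%N%:Z &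
        forall n, n \in F -> c n <= \sum_(s < 4) cutvar q (part s f) t L T n].
Proof.
move=> q2 c0 hc; have q0 : 0 < q by lra.
have /choice[tL htL] : forall n, exists p : (nat -> nat) * nat,
    (forall i, (p.1 i <= p.1 i.+1)%N) /\
    (n \in F -> c n <= pnorm q p.2 (fun i => cabs (avg (p.1 i) f n - avg (p.1 i.+1) f n))).
  move=> n.
  have [nF|nF] := boolP (n \in F); last by exists (fun=> 0%N, 0%N).
  have [->|h] := hc n nF; first by exists (fun=> 0%N, 0%N); split => // _; exact: pnorm_ge0.
  have [t [L [tm hL]]] := vnorm_gt q0 (c0 n nF) h.
  by exists (t, L); split => // _; exact: ltW.
pose L := \max_(n <- F) (tL n).2.
have LF n : n \in F -> ((tL n).2 <= L)%N by move=> nF; apply: (leq_bigmax_seq (F := fun n => (tL n).2)).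
(* [T] dominates every [|n|] and every radius used, so the truncation in [cutvar] changes
   nothing. *)
pose T := (\max_(n <- F) ((tL n).1 L + absz n))%N.
have TF n : n \in F -> ((tL n).1 L + absz n <= T)%N.
  by move=> nF; apply: (leq_bigmax_seq (F := fun n => ((tL n).1 L + absz n)%N)).
have T2 : (T < 2 ^ T)%N by exact: ltn_expl.
exists (fun n => (tL n).1), L, T; split.
- by move=> n i; have [] := htL n.
- by move=> n nF; have := TF n nF; rewrite PoszD /pw; lia.
move=> n nF; have [tm h] := htL n.
apply: le_trans (h nF) _; apply: le_trans (pnorm_mono _ q0 (LF n nF)) _.
have tiL i : (i <= L)%N -> ((tL n).1 i <= (2 ^ T.+1).-1)%N.
  move=> iL; have : ((tL n).1 i <= (tL n).1 L)%N.
    by rewrite -(subnKC iL); elim: (L - i)%N => [|d IHd]; rewrite ?addn0// addnS (leq_trans IHd).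
  by have := TF n nF; rewrite expnS; lia.
pose bb (s : 'I_4) i : R := `|rav (minn (2 ^ T.+1).-1 ((tL n).1 i)) (part s f) n
    - rav (minn (2 ^ T.+1).-1 ((tL n).1 i.+1)) (part s f) n|.
apply: (@le_trans _ _ (pnorm q L (fun i => \sum_(s < 4) bb s i))).
  apply: le_pnorm_lt => [|i iL]; first exact: ltW.
  have B0 : 0 <= \sum_(s < 4) bb s i by apply: sumr_ge0 => s _; exact: normr_ge0.
  rewrite ger0_norm ?cabsE ?sqrtr_ge0// -cabsE [leRHS]ger0_norm//.
  by rewrite /bb !(minn_idPr _) ?tiL ?(ltnW iL)//; exact: cabs_avg_diff.
have q1 : 1 <= q by lra.
apply: le_trans (@pnorm_sum q L _ (index_enum 'I_4) bb q1) _.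
apply: ler_sum => s _; rewrite /cutvar le_pnorm ?(ltW q0)// => i.
by rewrite /bb normr_id.
Qed.

End ComplexAverages.

(** * From finite sums to the operator *)

Section Sufficiency.
Context {R : realType}.
Implicit Types (f : int -> R[i]) (n a : int) (len : nat) (w g : int -> R).

Definition iset a len : {fset int} := [fset x in [seq (a + i%:Z)%R | i <- iota 0 len]]%fset.

Lemma iset_uniq a len : uniq [seq a + i%:Z | i <- iota 0 len].
Proof. by rewrite map_inj_uniq ?iota_uniq// => i j /addrI []. Qed.

Lemma mem_iset a len n : (n \in iset a len) = (a <= n < a + len%:Z).
Proof.
rewrite /iset inE/=; apply/mapP/idP => [[j + ->]|/andP[h1 h2]].
  by rewrite mem_iota add0n /= => jlen; lia.
by exists `|n - a|%N; rewrite ?mem_iota; lia.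
Qed.

Lemma card_iset a len : #|` iset a len|%fset = len.
Proof. by rewrite card_fseq undup_id ?iset_uniq// size_map size_iota. Qed.

Lemma interval_iset a len : is_interval [set` iset a len].
Proof. by move=> x y /=; rewrite !mem_iset => hx hy z hz; rewrite mem_iset; lia. Qed.

Lemma sum_iset a len g : \sum_(i <- iset a len) g i = isum a len g.
Proof.
rewrite (perm_big [seq a + i%:Z | i <- iota 0 len]); last first.
  apply: uniq_perm; [exact: fset_uniq|exact: iset_uniq|].
  by move=> x; rewrite /iset inE.
by rewrite big_map /isum -(big_mkord xpredT (fun i => g (a + i%:Z))) /index_iota subn0.
Qed.

Lemma sum_le_isum a len g (F : {fset int}) : (forall n, 0 <= g n) ->
  (forall n, n \in F -> a <= n < a + len%:Z) -> \sum_(n <- F) g n <= isum a len g.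
Proof.
move=> g0 hF; rewrite -sum_iset.
have: {subset F <= iset a len} by move=> n nF; rewrite mem_iset hF.
move: (iset a len) => J FJ; rewrite (big_fsetID _ (mem F) J)/=.
have -> : [fset x in J | x \in F]%fset = F.
  by apply/fsetP => x; rewrite !inE/=; case xF: (x \in F); rewrite ?andbF ?FJ.
by rewrite lerDl sumr_ge0.
Qed.

Lemma sum_le_esum g (F : {fset int}) :
  ((\sum_(n <- F) g n)%:E <= \esum_(n in [set: int]) (g n)%:E)%E.
Proof.
apply: esum_ge; exists [set` F]%classic.
  by split; [exact: finite_fset|].
by rewrite -fsbig_seq ?fset_uniq// sumEFin.
Qed.

Lemma esum_leP (S : set int) (g : int -> \bar R) (B : \bar R) :
  (forall F : {fset int}, (forall n, n \in F -> S n) -> (\sum_(n <- F) g n <= B)%E) ->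
  (\esum_(n in S) g n <= B)%E.
Proof.
move=> h; apply: ge_ereal_sup => _ [A [finA AS] <-].
rewrite fsbig_finite//; apply: h => n; rewrite in_fset_set// inE; exact: AS.
Qed.

Lemma VqA_ge0 (q : R) f n : (0 <= VqA q f n)%E.
Proof.
apply: ereal_sup_ge; exists ((\sum_(0 <= j <oo)
    (cabs (avgs f n j - avgs f n j.+1) `^ q)%:E) `^ q^-1)%E; last exact: poweR_ge0.
by exists id.
Qed.

Lemma Ap_isum (p : R) w : 1 < p -> Ap p w -> exists2 C : R, 0 < C &
  forall a len, isum a len w * isum a len (dual p w) `^ (p - 1) <= C * len%:R `^ p.
Proof.
move=> p1 [C hC]; exists (Num.max C 1); first by rewrite lt_max ltr01 orbT.
move=> a len; have := hC _ (@interval_iset a len).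
rewrite !sum_iset card_iset => h; apply: le_trans h _.
by rewrite ler_wpM2r ?powR_ge0// le_max lexx.
Qed.

Lemma A1_isum w : weight w -> A1 w -> exists2 C : R, 0 < C &
  forall a len n, a <= n < a + len%:Z -> isum a len w <= C * len%:R * w n.
Proof.
move=> w0 [C hC]; exists (Num.max C 1); first by rewrite lt_max ltr01 orbT.
move=> a len n hn; have lgt0 : 0 < len%:R :> R by rewrite ltr0n; lia.
have : (((len%:R)^-1 * isum a len w)%:E <= maxfun w n)%E.
  apply: ereal_sup_ubound; exists (iset a len).
    by split; [exact: interval_iset|rewrite mem_iset].
  rewrite card_iset (eq_bigr w) ?sum_iset// => i _.
  by rewrite ger0_norm// ltW.
move/le_trans => /(_ _ (hC n)); rewrite lee_fin mulrC ler_pdivrMr// => h.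
apply: le_trans h _; rewrite mulrAC ler_wpM2r ?(ltW (w0 n))//.
by rewrite ler_wpM2r ?(ltW lgt0)// le_max lexx.
Qed.

Lemma le_sum_term (k : nat) (x : 'I_k -> R) s : (forall i, 0 <= x i) ->
  x s <= \sum_(i < k) x i.
Proof. by move=> x0; rewrite (bigD1 s)//= lerDl sumr_ge0. Qed.

Lemma sum_powR_le (p : R) (k : nat) (x : 'I_k -> R) : 0 < p -> (forall s, 0 <= x s) ->
  (\sum_(s < k) x s) `^ p <= k%:R `^ p * \sum_(s < k) x s `^ p.
Proof.
move=> p0 x0; set S := \sum_(s < k) x s `^ p.
have S0 : 0 <= S by apply: sumr_ge0 => s _; exact: powR_ge0.
have hx s : x s <= S `^ p^-1.
  rewrite -[leLHS]powRr1// -(mulfV (lt0r_neq0 p0)) powRrM.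
  rewrite ge0_ler_powR ?nnegrE ?invr_ge0 ?(ltW p0) ?powR_ge0//.
  by apply: (le_sum_term (x := fun s => x s `^ p)) => i; exact: powR_ge0.
have : \sum_(s < k) x s <= k%:R * S `^ p^-1.
  by apply: le_trans (ler_sum _ (fun s _ => hx s)) _; rewrite sumr_const card_ord mulr_natl.
move/(@ge0_ler_powR _ p (ltW p0) _ _ _ _); rewrite !nnegrE sumr_ge0// mulr_ge0 ?powR_ge0// => /(_ isT isT).
move/le_trans; apply; rewrite powRM ?powR_ge0//.
by rewrite -powRrM mulVf ?lt0r_neq0// powRr1.
Qed.

Lemma part_isum w (p X : R) (s : 'I_4) f a len : 0 <= p -> weight w ->
  wsum w p f = X%:E -> isum a len (fun n => part s f n `^ p * w n) <= X.
Proof.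
move=> p0 w0 hX; apply: (@le_trans _ _ (\sum_(n <- iset a len) cabs (f n) `^ p * w n)).
  rewrite sum_iset; apply: le_isum => n _; rewrite ler_wpM2r ?(ltW (w0 n))//.
  by rewrite ge0_ler_powR ?nnegrE ?part_ge0 ?part_le// cabsE sqrtr_ge0.
by rewrite -lee_fin -hX; exact: sum_le_esum.
Qed.

(** Stated for values [c n] strictly below [VqA q f n], or zero, since finite sequences reach only
    those; in this form it can be used before [VqA] is known to be finite. *)
Lemma Ap_sub (p q : R) w f (X C : R) (F : {fset int}) (c : int -> R) :
  1 < p -> 2 < q -> weight w -> 0 < C ->
  (forall a len, isum a len w * isum a len (dual p w) `^ (p - 1) <= C * len%:R `^ p) ->
  wsum w p f = X%:E ->
  (forall n, n \in F -> 0 <= c n) ->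
  (forall n, n \in F -> c n = 0 \/ ((c n)%:E < VqA q f n)%E) ->
  \sum_(n <- F) c n `^ p * w n <= 4 `^ p * (4 * (strong_const p q C * X)).
Proof.
move=> p1 q2 w0 C0 hAp hX c0 hc; have p0 : 0 < p by lra.
have [t [L [T [tm hF hcut]]]] := linearize q2 c0 hc.
pose g n := 4 `^ p * \sum_(s < 4) cutvar q (part s f) t L T n `^ p * w n.
have g0 n : 0 <= g n.
  by apply: mulr_ge0; [exact: powR_ge0|apply: sumr_ge0 => s _; rewrite mulr_ge0 ?powR_ge0// ltW].
apply: (@le_trans _ _ (\sum_(n <- F) g n)).
  rewrite big_seq [leRHS]big_seq; apply: ler_sum => n nF.
  rewrite /g -mulr_suml mulrA ler_wpM2r ?(ltW (w0 n))//.
  apply: le_trans (sum_powR_le p0 (fun s => cutvar_ge0 _ _ _ _ _ _)).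
  rewrite ge0_ler_powR ?nnegrE ?(ltW p0) ?c0 ?hcut//.
  by apply: sumr_ge0 => s _; exact: cutvar_ge0.
apply: le_trans (sum_le_isum g0 hF) _.
rewrite /g isumZ isum_sum ler_wpM2l ?powR_ge0//.
apply: (@le_trans _ _ (\sum_(s < 4) strong_const p q C * X)).
  apply: ler_sum => s _; apply: (strong_cutvar p1 q2 w0 C0 hAp) => //.
    by move=> n; exact: part_ge0.
  by move=> a len; apply: part_isum => //; exact: ltW.
by rewrite sumr_const card_ord mulr_natl.
Qed.

Lemma Ap_bounded (p q : R) w : 1 < p -> 2 < q -> weight w -> Ap p w ->
  bounded_ellp w p (VqA q).
Proof.
move=> p1 q2 w0 /(Ap_isum p1)[C C0 hAp]; have p0 : 0 < p by lra.
pose K := 4 `^ p * (4 * strong_const p q C).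
exists K => f; rewrite inE /ellp/= => fin.
have ws0 : (0 <= wsum w p f)%E.
  by apply: esum_ge0 => n _; rewrite lee_fin mulr_ge0 ?powR_ge0// ltW.
have hX : wsum w p f = (fine (wsum w p f))%:E by rewrite fineK// ge0_fin_numE.
move: (fine _) hX => X hX {fin ws0}.
have sub F c := @Ap_sub p q w f X C F c p1 q2 w0 C0 hAp hX.
rewrite hX -EFinM (_ : K * X = 4 `^ p * (4 * (strong_const p q C * X))); last by rewrite /K -!mulrA.
set B := 4 `^ p * _ in sub *.
have B0 : 0 <= B.
  have := sub fset0 (fun=> 0); rewrite big_seq_fset0; apply; move=> n; by rewrite inE.
have finV n : VqA q f n \is a fin_num.
  rewrite ge0_fin_numE ?VqA_ge0// ltNge leye_eq; apply/negP => /eqP Vy.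
  (* Chosen so that [M^p * w n = B + w n] exceeds [B]; an infinite value at [n] would make [M]
     admissible in [sub]. *)
  pose M := (B / w n + 1) `^ p^-1.
  have b0 : 0 <= B / w n + 1 by rewrite addr_ge0// divr_ge0// ltW.
  have := sub [fset n]%fset (fun=> M); rewrite big_seq_fset1.
  have -> : M `^ p * w n = B + w n.
    by rewrite /M -powRrM mulVf ?lt0r_neq0// powRr1// mulrDl mul1r divfK ?lt0r_neq0.
  have M1 m : m \in [fset n]%fset -> 0 <= M by move=> _; exact: powR_ge0.
  have M2 m : m \in [fset n]%fset -> M = 0 \/ (M%:E < VqA q f m)%E.
    by rewrite inE => /eqP ->; right; rewrite Vy ltey.
  by move=> /(_ M1 M2); have := w0 n; lra.
apply: esum_leP => F _.
pose v n := fine (VqA q f n).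
have v0 n : 0 <= v n by exact: fine_ge0 (VqA_ge0 q f n).
have vE n : VqA q f n = (v n)%:E by rewrite fineK.
rewrite (eq_bigr (fun n => (v n `^ p * w n)%:E)); last first.
  by move=> n _; rewrite vE poweR_EFin EFinM.
rewrite sumEFin lee_fin leNgt; apply/negP.
set S := \sum_(n <- F) _ => BS.
have S0 : 0 < S by lra.
(* [sub] needs values strictly below [v], so [v] is multiplied by some [th < 1] for which the sum
   [th^p * S = r] still exceeds [B]. *)
pose r := (B + S) / 2; have [r1 r2] : B < r /\ r < S by rewrite /r; split; lra.
pose th := (r / S) `^ p^-1.
have rS0 : 0 <= r / S by apply: divr_ge0; lra.
have rS1 : r / S < 1 by rewrite ltr_pdivrMr// mul1r.
have th0 : 0 <= th by exact: powR_ge0.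
have thp : th `^ p = r / S by rewrite /th -powRrM mulVf ?lt0r_neq0// powRr1.
have th1 : th < 1.
  rewrite ltNge; apply/negP => h; have : 1 <= th `^ p.
    by have := @ge0_ler_powR _ p (ltW p0) 1 th; rewrite powR1 !nnegrE; apply.
  by rewrite thp leNgt rS1.
have : \sum_(n <- F) (th * v n) `^ p * w n <= B.
  apply: (sub F (fun n => th * v n)) => n _; first by rewrite mulr_ge0.
  have [->|vn] := eqVneq (v n) 0; first by left; rewrite mulr0.
  by right; rewrite vE lte_fin gtr_pMl// lt_neqAle eq_sym vn v0.
rewrite (eq_bigr (fun n => th `^ p * (v n `^ p * w n))); last first.
  by move=> n _; rewrite powRM// mulrA.
by rewrite -mulr_sumr thp divfK ?gt_eqF// leNgt r1.
Qed.

Lemma A1_bounded (q : R) w : 2 < q -> weight w -> A1 w -> bounded_weak_ell1 w (VqA q).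
Proof.
move=> q2 w0 /(A1_isum w0)[C C0 hA1].
exists (32 * weak_const q C) => f; rewrite inE /ellp/= => fin lam lam0.
have ws0 : (0 <= wsum w 1 f)%E.
  by apply: esum_ge0 => n _; rewrite lee_fin mulr_ge0 ?powR_ge0// ltW.
have cab n : cabs (f n) `^ 1 = cabs (f n) by rewrite powRr1// cabsE sqrtr_ge0.
have -> : (\esum_(n in [set: int]) (cabs (f n) * w n)%:E)%E = wsum w 1 f.
  by apply: eq_esum => n _; rewrite cab.
have hX : wsum w 1 f = (fine (wsum w 1 f))%:E by rewrite fineK// ge0_fin_numE.
move: (fine _) hX => X hX {fin ws0}.
rewrite hX -EFinM; apply: esum_leP => F FE; rewrite sumEFin lee_fin.
have [||t [L [T [tm hF hcut]]]] := @linearize R q f F (fun=> lam) q2.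
- by move=> n _; exact: ltW.
- by move=> n nF; right; exact: FE.
(* With [lam / 8] rather than [lam / 4], four small terms add up to at most [lam / 2], which
   contradicts the non-strict inequality supplied by [linearize]. *)
pose g n : R := \sum_(s < 4) (lam / 8 < cutvar q (part s f) t L T n)%R%:R * w n.
have g0 n : 0 <= g n by apply: sumr_ge0 => s _; rewrite mulr_ge0 ?ler0n// ltW.
apply: (@le_trans _ _ (\sum_(n <- F) g n)).
  rewrite big_seq [leRHS]big_seq; apply: ler_sum => n nF.
  have [s hs] : exists s : 'I_4, lam / 8 < cutvar q (part s f) t L T n.
    apply: contrapT => hn; have := hcut n nF; apply/negP; rewrite -ltNge.
    apply: (@le_lt_trans _ _ (\sum_(s < 4) lam / 8)).
      by apply: ler_sum => s _; rewrite leNgt; apply/negP => h; apply: hn; exists s.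
    by rewrite sumr_const card_ord -mulr_natl; lra.
  have h0 i : 0 <= (lam / 8 < cutvar q (part i f) t L T n)%R%:R * w n.
    by apply: mulr_ge0; [exact: ler0n|exact: ltW].
  apply: le_trans (le_sum_term s h0).
  by rewrite -[leLHS]mul1r ler_wpM2r ?(ltW (w0 n))//; move: hs; case: (_ < _)%R.
apply: le_trans (sum_le_isum g0 hF) _.
rewrite /g isum_sum.
apply: (@le_trans _ _ (\sum_(s < 4) weak_const q C * (X / (lam / 8)))).
  apply: ler_sum => s _; apply: (weak_cutvar q2 w0 C0) => //.
  - by move=> n; exact: part_ge0.
  - by rewrite divr_gt0.
  move=> a len; have := @part_isum w 1 X s f a len ler01 w0 hX.
  rewrite (eq_isum (G := fun n => w n * part s f n))// => n _.
  by rewrite powRr1 ?part_ge0// mulrC.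
rewrite sumr_const card_ord -mulr_natl le_eqVlt; apply/orP; left; apply/eqP.
by field; lra.
Qed.

End Sufficiency.

(** * Necessity *)

Section Necessity.
Context {R : realType}.
Implicit Types (f : int -> R[i]) (n a : int) (len : nat) (w g : int -> R) (I J : {fset int}).

Lemma vnorm_ge (q : R) (a : nat -> R[i]) (N : nat -> nat) : 0 < q -> increasing_seq N ->
  ((cabs (a (N 0%N) - a (N 1%N)))%:E <= vnorm q a)%E.
Proof.
move=> q0 incN; set c := cabs _.
have c0 : 0 <= c by rewrite /c cabsE sqrtr_ge0.
pose S := (\sum_(0 <= j <oo) (cabs (a (N j) - a (N j.+1)) `^ q)%:E)%E.
have h0 j : (0 <= (cabs (a (N j) - a (N j.+1)) `^ q)%:E)%E by rewrite lee_fin powR_ge0.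
have cS : ((c `^ q)%:E <= S)%E.
  have := @nneseries_lim_ge R (fun j => (cabs (a (N j) - a (N j.+1)) `^ q)%:E) xpredT 0 1
    (fun j _ _ => h0 j).
  by rewrite big_nat1.
apply: (@le_trans _ _ (S `^ q^-1)%E); last by apply: ereal_sup_ubound; exists N.
have -> : c%:E = ((c `^ q)%:E `^ q^-1)%E.
  by rewrite poweR_EFin -powRrM mulfV ?gt_eqF// powRr1.
have iq : 0 <= q^-1 by rewrite invr_ge0 ltW.
by apply: gt0_ler_poweR => //; rewrite in_itv/= leey ?andbT// ?(le_trans _ cS)// lee_fin powR_ge0.
Qed.

Lemma interval_dist I n m : is_interval [set` I] -> n \in I -> m \in I ->
  n - #|` I|%fset%:Z <= m <= n + #|` I|%fset%:Z.
Proof.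
move=> hI; have key u v : u \in I -> v \in I -> u <= v -> v - u < #|` I|%fset%:Z.
  move=> uI vI uv; have /fsubset_leq_card : (iset u `|v - u|.+1 `<=` I)%fset.
    by apply/fsubsetP => x; rewrite mem_iset => hx; apply: (hI u v) => //; lia.
  by rewrite card_iset; lia.
by move=> nI mI; case: (leP n m) => nm; [have := key n m nI mI nm|have := key m n mI nI (ltW nm)]; lia.
Qed.

Lemma isum_supp J g a len : (forall n, n \notin J -> g n = 0) ->
  (forall n, n \in J -> a <= n < a + len%:Z) -> isum a len g = \sum_(n <- J) g n.
Proof.
move=> g0 hJ; rewrite -sum_iset; apply/esym/big_fset_incl => [|x _]; last exact: g0.
by apply/fsubsetP => n nJ; rewrite mem_iset hJ.
Qed.

Lemma esum_supp J g : (forall n, 0 <= g n) -> (forall n, n \notin J -> g n = 0) ->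
  (\esum_(n in [set: int]) (g n)%:E = (\sum_(n <- J) g n)%:E)%E.
Proof.
move=> g0 hJ; apply/eqP; rewrite eq_le sum_le_esum andbT.
rewrite (eq_esum (b := fun n => if n \in [set` J]%classic then (g n)%:E else 0%E)); last first.
  move=> n _; case: ifPn => //; rewrite notin_setE/= => /negP /hJ ->//.
rewrite -esum_mkcond esum_fset; [|exact: finite_fset|by move=> i _; rewrite lee_fin].
by rewrite -fsbig_seq ?fset_uniq// sumEFin.
Qed.

(* The windows of radius [L = #|I|] and [3 L + 1] around a point of [I] both
   contain [I], and the second is exactly three times as long as the first. *)
Lemma VqA_ge (q : R) I g n : 0 < q -> is_interval [set` I] -> n \in I ->
  (forall n, n \notin I -> g n = 0) -> 0 <= \sum_(i <- I) g i ->
  ((2 / 9 * (\sum_(i <- I) g i) / (#|` I|%fset)%:R)%:E <= VqA q (fun n => (g n)%:C%C) n)%E.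
Proof.
move=> q0 hI nI g0; set S := \sum_(i <- I) g i; set L := #|` I|%fset => S0.
have L0 : (0 < L)%N by rewrite cardfs_gt0; apply/fset0Pn; exists n.
pose N j := (L + j * L.*2.+1)%N.
have incN : increasing_seq N by move=> j k; rewrite leEnat leq_add2l leq_pmul2r.
apply: le_trans (vnorm_ge _ q0 incN); rewrite lee_fin.
apply: le_trans (Re_le_cabs _); rewrite /avgs ReD.
have -> z : complex.Re (- z) = - complex.Re z :> R by case: z.
have E k : (L <= k)%N -> complex.Re (avg k (fun n => (g n)%:C%C) n) = S / k.*2.+1%:R.
  move=> Lk; rewrite (avg_coords _ _ _).1 /rav (isum_supp (J := I))/= 1?mulrC// => m mI.
  by have := interval_dist hI nI mI; rewrite -/L; lia.
rewrite !E /N ?mul0n ?addn0 ?mul1n ?leq_addr//.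
have -> : (L + L.*2.+1).*2.+1%:R = 3 * L.*2.+1%:R :> R by rewrite -natrM; congr (_%:R); lia.
have -> : L.*2.+1%:R = 2 * L%:R + 1 :> R by rewrite -addn1 natrD -mul2n natrM.
have L1 : 1 <= L%:R :> R by rewrite ler1n.
move: (L%:R) L1 => l l1.
(* The constant [2/9] is [1 - 1/3], from the ratio 3 of the two lengths, times [1/3], from
   [2 l + 1 <= 3 l]. *)
have -> : S / (2 * l + 1) - S / (3 * (2 * l + 1)) = 2 / 3 * (S / (2 * l + 1)) by field; lra.
rewrite ger0_norm; last by rewrite mulr_ge0 ?divr_ge0//; lra.
rewrite (_ : 2 / 9 * S / l = 2 / 3 * (S / (3 * l))); last by field; lra.
rewrite ler_wpM2l; [by []|lra|].
by rewrite ler_wpM2l// lef_pV2 ?posrE; lra.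
Qed.

Lemma powR_invl (x p : R) : 0 < x -> x^-1 `^ p = (x `^ p)^-1.
Proof.
move=> x0; have xp : x `^ p != 0 by rewrite gt_eqF ?powR_gt0.
by apply: (mulIf xp); rewrite mulVf// -powRM ?invr_ge0 ?(ltW x0)// mulVf ?powR1 ?gt_eqF.
Qed.

Lemma bounded_Ap (p q : R) w : 1 < p -> 2 < q -> weight w ->
  bounded_ellp w p (VqA q) -> Ap p w.
Proof.
move=> p1 q2 w0 [C hC]; have p0 : 0 < p by lra.
have q0 : 0 < q by lra.
exists (C * (9 / 2) `^ p) => I hI.
have [->|/fset0Pn [m mI]] := eqVneq I fset0.
  by rewrite !big_seq_fset0 mul0r cardfs0 powR0 ?mulr0// gt_eqF.
pose s n := w n `^ (- (1 / (p - 1))).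
have s0 n : 0 < s n by exact: powR_gt0.
pose g n := if n \in I then s n else 0.
have gN n : n \notin I -> g n = 0 by rewrite /g => /negbTE ->.
have gS : \sum_(i <- I) g i = \sum_(i <- I) s i.
  by rewrite big_seq [RHS]big_seq; apply: eq_bigr => i iI; rewrite /g iI.
set W := \sum_(i <- I) w i; set S := \sum_(i <- I) s i in gS *.
rewrite -/(\sum_(i <- I) s i) -/S.
have S0 : 0 < S.
  rewrite /S (big_fsetD1 m)//= ltr_pwDl//.
  by apply: sumr_ge0 => i _; exact: ltW.
(* The reason for testing with [s]: the weighted norm and the plain sum of the test function are
   both [S], so one power of [S] cancels at the end. *)
have sp n : s n `^ p * w n = s n.
  rewrite /s -powRrM -[X in _ * X]powRr1 ?(ltW (w0 n))// -powRD; last by rewrite (gt_eqF (w0 n)) implybT.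
  by congr (_ `^ _); field; lra.
have fX : wsum w p (fun n => (g n)%:C%C) = S%:E.
  rewrite /wsum (eq_esum (b := fun n => (g n)%:E)) => [|n _].
    by rewrite (esum_supp (J := I)) ?gS// => n; rewrite /g; case: ifP => // _; exact: ltW.
  rewrite cabs_real /g; case: ifP => _; last by rewrite normr0 powR0 ?mul0r// gt_eqF.
  by rewrite ger0_norm ?(ltW (s0 n))// sp.
have := hC (fun n => (g n)%:C%C); rewrite inE /ellp/= fX ltey => /(_ isT).
set L : R := (#|` I|%fset)%:R; have L0 : 0 < L by rewrite ltr0n cardfs_gt0; apply/fset0Pn; exists m.
pose c := 2 / 9 * S / L; have c0 : 0 <= c by rewrite !mulr_ge0 ?invr_ge0 ?(ltW S0) ?(ltW L0).
have low : ((c `^ p * W)%:E <= \esum_(n in [set: int]) (VqA q (fun n => (g n)%:C%C) n `^ p * (w n)%:E))%E.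
  apply: esum_ge; exists [set` I]%classic; first by split; [exact: finite_fset|].
  rewrite -fsbig_seq ?fset_uniq// /W mulr_sumr -sumEFin big_seq [leRHS]big_seq.
  apply: lee_sum => n nI; rewrite EFinM lee_wpmul2r ?lee_fin ?(ltW (w0 n))//.
  rewrite -poweR_EFin; apply: gt0_ler_poweR; rewrite ?(ltW p0)// ?in_itv/= ?leey ?andbT ?lee_fin ?VqA_ge0//.
  by rewrite /c -gS; apply: VqA_ge => //; rewrite gS ltW.
move/(le_trans low); rewrite -EFinM lee_fin => {low}.
have -> : c = S * (2 / 9 * L^-1) by rewrite /c -mulrA mulrCA.
have i29 : 0 <= 2 / 9 :> R by lra.
have iL : 0 <= L^-1 by rewrite invr_ge0 ltW.
rewrite powRM ?(ltW S0) ?mulr_ge0// powRM//.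
have -> : S `^ p = S * S `^ (p - 1).
  rewrite -[X in X * _]powRr1 ?(ltW S0)// -powRD; last by rewrite (gt_eqF S0) implybT.
  by congr (_ `^ _); ring.
have -> : (2 / 9) `^ p = ((9 / 2) `^ p)^-1 :> R.
  by rewrite -powR_invl ?invf_div//; lra.
rewrite (powR_invl _ L0).
have : 0 < (9 / 2) `^ p :> R by apply: powR_gt0; lra.
have : 0 < L `^ p by exact: powR_gt0.
move: (_ `^ (p - 1)) (L `^ p) ((9 / 2) `^ p) => s1 l k l0 k0 h.
rewrite -(ler_pM2l S0) -(ler_pM2l (_ : 0 < (k * l)^-1)) ?invr_gt0 ?mulr_gt0//.
rewrite (_ : (k * l)^-1 * (S * (C * k * l)) = C * S); last by field; lra.
by rewrite (_ : (k * l)^-1 * (S * (W * s1)) = S * s1 * (k^-1 * l^-1) * W)//; field; lra.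
Qed.

Lemma bounded_A1 (q : R) w : 2 < q -> weight w ->
  bounded_weak_ell1 w (VqA q) -> A1 w.
Proof.
move=> q2 w0 [C hC]; have q0 : 0 < q by lra.
exists (9 * C) => n; apply: ge_ereal_sup => _ [I [hI nI] <-].
rewrite lee_fin (eq_bigr w); last by move=> i _; rewrite ger0_norm// ltW.
set L : R := (#|` I|%fset)%:R; have L0 : 0 < L by rewrite ltr0n cardfs_gt0; apply/fset0Pn; exists n.
pose g m : R := (m == n)%:R.
have gN J m : n \in J -> m \notin J -> g m = 0 by rewrite /g; case: eqVneq => // -> ->.
have gI : \sum_(i <- I) g i = 1.
  rewrite (big_fsetD1 n)//= /g eqxx big_seq big1 ?addr0// => i.
  by rewrite in_fsetD1 => /andP[/negbTE ->].
have supp (h : int -> R) : (forall m, 0 <= h m) ->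
    (\esum_(m in [set: int]) (h m * g m)%:E = (h n)%:E)%E.
  move=> h0; rewrite (esum_supp (J := [fset n]%fset)).
  - by rewrite big_seq_fset1 /g eqxx mulr1.
  - by move=> m; rewrite mulr_ge0 ?ler0n.
  by move=> m /(gN _ m); rewrite inE eqxx => ->//; rewrite mulr0.
have cg m : cabs ((g m)%:C)%C = g m by rewrite cabs_real ger0_norm ?ler0n.
have fX : wsum w 1 (fun m => (g m)%:C%C) = (w n)%:E.
  rewrite -(supp w) => [|m]; last exact: ltW.
  by apply: eq_esum => m _; rewrite cg powRr1 ?ler0n// mulrC.
(* Half of the lower bound [2 / (9 L)] given by [VqA_ge], since the level set is defined by a strict
   inequality. *)
have lam0 : 0 < (9 * L)^-1 by rewrite invr_gt0 mulr_gt0.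
have := hC (fun m => (g m)%:C%C); rewrite inE /ellp/= fX ltey => /(_ isT _ lam0).
have -> : (\esum_(m in [set: int]) (cabs ((g m)%:C)%C * w m)%:E = (w n)%:E)%E.
  rewrite -(supp w) => [|m]; last exact: ltW.
  by apply: eq_esum => m _; rewrite cg mulrC.
set E := [set _ | _]%classic.
have low : ((\sum_(i <- I) w i)%:E <= wmeas w E)%E.
  apply: esum_ge; exists [set` I]%classic.
    split; first exact: finite_fset.
    move=> m /= mI; apply: lt_le_trans (VqA_ge q0 hI mI _ _) => [|i /(gN _ i nI)//|].
      by rewrite gI lte_fin mulr1 invfM ltr_pM2r ?invr_gt0//; lra.
    by rewrite gI.
  by rewrite -fsbig_seq ?fset_uniq// sumEFin.
move/(le_trans low); rewrite -EFinM lee_fin invrK => h.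
rewrite mulrC ler_pdivrMr//; apply: le_trans h _.
by rewrite le_eqVlt; apply/orP; left; apply/eqP; ring.
Qed.

End Necessity.

Theorem corollary2p6 (R : realType) (q : R) (w : int -> R)
    (hq : 2 < q) (hw : weight w) :
  (forall p : R, 1 < p -> (bounded_ellp w p (VqA q) <-> Ap p w)) /\
  (bounded_weak_ell1 w (VqA q) <-> A1 w).
Proof.
split=> [p p1|]; split; [exact: bounded_Ap|exact: Ap_bounded|exact: bounded_A1|exact: A1_bounded].
Qed.
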